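(* Let $n\ge3$, $p>1$, $\lambda\in\mathbb R$ satisfy either (i) $p<\frac{n+2}{n-2}$ and $\lambda<\frac{(n-1)^2}{4}$, or (ii) $n\ge4$, $p=\frac{n+2}{n-2}$ and $\frac{n(n-2)}{4}<\lambda<\frac{(n-1)^2}{4}$. Let $\kappa\in(0,1)$ and $j\in\{1,\dots,n\}$. Then there exist $\delta_0>0$ and a constant $C\ge1$ depending only on $\kappa,\delta_0,n,\lambda,p$ such that for all $z=(z_1,\dots,z_n)\in\mathbb B^n$ with $|z_j|\ge\kappa$ and $1-|z|<\delta_0$: $$C^{-1}e^{-c(n,\lambda)d(z,0)}\le\int_{\mathbb B^n}\mathcal U[z]^p\,V_j(\mathcal U[0])\,dv\le C\,e^{-c(n,\lambda)d(z,0)}\quad\text{if }z_j<-\kappa,$$ $$C^{-1}e^{-c(n,\lambda)d(z,0)}\le-\int_{\mathbb B^n}\mathcal U[z]^p\,V_j(\mathcal U[0])\,dv\le C\,e^{-c(n,\lambda)d(z,0)}\quad\text{if }z_j>\kappa.$$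
   Context: $\mathbb B^n$ is the Poincaré ball model of hyperbolic $n$-space: the Euclidean unit ball with metric $\left(\frac{2}{1-|x|^2}\right)^2dx^2$, Laplace-Beltrami operator $\Delta_{\mathbb B^n}$, volume element $dv$ and distance $d(\cdot,\cdot)$; $|\cdot|$ is the Euclidean norm. $H^1(\mathbb B^n)$ is the completion of $C_c^\infty(\mathbb B^n)$ with respect to the $L^2$ norm of the hyperbolic gradient. Under the stated conditions on $n,p,\lambda$, $\mathcal U\in H^1(\mathbb B^n)$ denotes the unique positive, radially symmetric (and decreasing) solution of $-\Delta_{\mathbb B^n}\mathcal U-\lambda\,\mathcal U=\mathcal U^p$. Viewing $\mathcal U$ as a function of $d(x,0)$, $\mathcal U[z](x)=\mathcal U(d(x,z))$ for $z\in\mathbb B^n$. Set $c(n,\lambda)=\frac{n-1+\sqrt{(n-1)^2-4\lambda}}{2}$. The following sharp decay is taken as known: there are constants $\chi_1,\chi_2>0$ depending only on $n,p,\lambda$ with $\chi_1e^{-c(n,\lambda)d(x,z)}\le\mathcal U[z](x)\le\chi_2e^{-c(n,\lambda)d(x,z)}$. $V_j$ is the vector field $V_j=(1+|x|^2)\frac{\partial}{\partial x_j}-2x_j\sum_{l=1}^nx_l\frac{\partial}{\partial x_l}$ (Euclidean partial derivatives), so that $V_j(\mathcal U[0])(x)=\frac{d}{dt}\big|_{t=0}\mathcal U(\tau_{te_j}(x))$, with $\tau_b$ the hyperbolic translation taking $0$ to $b$; explicitly $V_j(\mathcal U[0])(x)=2\frac{x_j}{|x|}\mathcal U'(d(x,0))$.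 *)

(* Defs.v *)
From HB Require Import structures.
From mathcomp Require Import all_boot all_order all_algebra.
From mathcomp Require Import all_classical all_reals all_analysis.

Set Implicit Arguments.
Unset Strict Implicit.
Unset Printing Implicit Defensive.
Import Order.TTheory GRing.Theory Num.Theory.
Import numFieldNormedType.Exports.
Local Open Scope classical_set_scope.
Local Open Scope ring_scope.

(** * Lebesgue measure and integral on R^n *)

Section lebesgue_Rn.
Context {R : realType}.

(* The library has the product sigma-algebra on [n.-tuple T] but no
   n-dimensional Lebesgue measure; it is built here as the n-fold product of
   [lebesgue_measure]. *)
Definition tuple_ext (n : nat)
    (tx : n.-tuple (measurableTypeR R) * measurableTypeR R) :
    n.+1.-tuple (measurableTypeR R) :=
  [the n.+1.-tuple (measurableTypeR R) of tx.2 :: tx.1].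

Lemma measurable_tuple_ext (n : nat) :
  measurable_fun [set: n.-tuple (measurableTypeR R) * measurableTypeR R]
    (@tuple_ext n).
Proof. exact: measurable_cons. Qed.

Fixpoint lebesgue_tuple (n : nat) :
    set (n.-tuple (measurableTypeR R)) -> \bar R :=
  match n with
  | 0 => \d_([tuple] : 0.-tuple (measurableTypeR R))
  | m.+1 => pushforward (@lebesgue_tuple m \x @lebesgue_measure R)%E
                        (@tuple_ext m)
  end.

Lemma lebesgue_tuple_measure (n : nat) :
  exists m : {measure set (n.-tuple (measurableTypeR R)) -> \bar R},
    @lebesgue_tuple n = m.
Proof.
elim: n => [|n [m mE]] /=.
  by exists \d_([tuple] : 0.-tuple (measurableTypeR R)).
have mext := @measurable_tuple_ext n.
rewrite mE.
by unshelve eexists [the {measure set _ -> \bar R} of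
  pushforward (m \x @lebesgue_measure R)%E (@tuple_ext n)].
Qed.

Let lebesgue_tuple0 n : @lebesgue_tuple n set0 = 0%E.
Proof. by have [m ->] := lebesgue_tuple_measure n; exact: measure0. Qed.

Let lebesgue_tuple_ge0 n A : (0 <= @lebesgue_tuple n A)%E.
Proof. by have [m ->] := lebesgue_tuple_measure n; exact: measure_ge0. Qed.

Let lebesgue_tuple_sigma_additive n :
  semi_sigma_additive (@lebesgue_tuple n).
Proof.
have [m ->] := lebesgue_tuple_measure n.
exact: measure_semi_sigma_additive.
Qed.

HB.instance Definition _ (n : nat) := isMeasure.Build _ _ _
  (@lebesgue_tuple n) (@lebesgue_tuple0 n) (@lebesgue_tuple_ge0 n)
  (@lebesgue_tuple_sigma_additive n).

Definition row_of_tuple (n : nat) (t : n.-tuple (measurableTypeR R)) :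
    'rV[R]_n := \row_i tnth t i.

(* Points of R^n are row vectors (for calculus); integration goes through the
   coordinate tuples. *)
Definition integral_Rn (n : nat) (D : set 'rV[R]_n) (f : 'rV[R]_n -> R) :
    \bar R :=
  (\int[@lebesgue_tuple n]_(t in [set t | D (row_of_tuple t)])
     (f (row_of_tuple t))%:E)%E.

End lebesgue_Rn.

(** * Calculus on R^n *)

Section calculus.
Context {R : realType} {n : nat}.
Implicit Types (x y z : 'rV[R]_n) (f : 'rV[R]_n -> R).

(* The library norm [`|x|] on row vectors is the sup norm. *)
Definition enorm x : R := Num.sqrt (\sum_(i < n) x 0 i ^+ 2).

Definition partial (i : 'I_n) f x : R := 'D_(delta_mx 0 i) f x.

(* C^k regularity on a set D, meant for D open. *)
Fixpoint Ck (k : nat) (D : set 'rV[R]_n) f : Prop :=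
  (forall x, D x -> {for x, continuous f}) /\
  match k with
  | 0 => True
  | k'.+1 => forall i : 'I_n,
      (forall x, D x -> derivable f x (delta_mx 0 i)) /\ Ck k' D (partial i f)
  end.

End calculus.

(** * The Poincare ball model *)

Section ball_model.
Context {R : realType} {n : nat}.
Implicit Types (x y z : 'rV[R]_n) (f : 'rV[R]_n -> R).

Definition hball : set 'rV[R]_n := [set x | enorm x < 1].

(* The metric is [rho x ^+ 2 *: dx^2]. *)
Definition rho x : R := 2 / (1 - enorm x ^+ 2).

Definition arcosh (t : R) : R := ln (t + Num.sqrt (t ^+ 2 - 1)).

Definition hdist x y : R :=
  arcosh (1 + 2 * enorm (x - y) ^+ 2 /
                ((1 - enorm x ^+ 2) * (1 - enorm y ^+ 2))).

Definition hintegral f : \bar R := integral_Rn hball (fun x => f x * rho x ^+ n).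

(* Laplace-Beltrami operator |g|^{-1/2} d_i (|g|^{1/2} g^{ij} d_j f) of the
   metric g = rho^2 dx^2, for n >= 2. *)
Definition hlaplacian f x : R :=
  (rho x ^+ n)^-1 *
  \sum_(i < n) partial i (fun y => rho y ^+ (n - 2) * partial i f y) x.

(* Squared hyperbolic length of the hyperbolic gradient rho^{-2} grad f. *)
Definition hgrad_sq f x : R := (rho x ^+ 2)^-1 * \sum_(i < n) partial i f x ^+ 2.

Definition test_function f : Prop :=
  [/\ forall k, Ck k setT f,
      compact (closure [set x | f x != 0]) &
      closure [set x | f x != 0] `<=` hball].

(* Completion of the test functions for the L^2 norm of the gradient. By the
   Poincare inequality (bottom of the spectrum (n-1)^2/4 > 0), a
   gradient-Cauchy sequence also converges in L^2(dv), and the completion is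
   identified with the space of these L^2 limits. *)
Definition in_H1 f : Prop :=
  measurable_fun [set t | hball (row_of_tuple t)]
    (fun t : n.-tuple (measurableTypeR R) => f (row_of_tuple t)) /\
  exists phi : nat -> 'rV[R]_n -> R,
    [/\ forall k, test_function (phi k),
        forall e : R, 0 < e -> exists N : nat, forall k l : nat,
          (N <= k)%N -> (N <= l)%N ->
          (hintegral (hgrad_sq (fun x => phi k x - phi l x)%R) < e%:E)%E &
        (fun k => hintegral (fun x => (phi k x - f x) ^+ 2)) @ \oo --> 0%E].

(* A radial function x |-> u (d(x,0)) is given by its profile u : R -> R;
   [radial_at u z] is the same profile centred at z. *)
Definition radial_at (u : R -> R) z : 'rV[R]_n -> R := fun x => u (hdist x z).

Definition vfield (j : 'I_n) f x : R :=
  (1 + enorm x ^+ 2) * partial j f x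
  - 2 * x 0 j * \sum_(l < n) x 0 l * partial l f x.

End ball_model.

(* Positive, radially symmetric, decreasing H^1 solution of
   -Delta U - lambda U = U^p, as a classical solution: by elliptic regularity
   weak H^1 solutions are C^2. *)
Definition ground_state {R : realType} (n : nat) (p lambda : R) (u : R -> R) :
    Prop :=
  let U : 'rV[R]_n -> R := radial_at u 0 in
  [/\ in_H1 U,
      Ck 2 hball U,
      forall x, hball x -> 0 < U x,
      forall r s : R, 0 <= r -> r < s -> u s < u r &
      forall x, hball x -> - hlaplacian U x - lambda * U x = U x `^ p].

Definition decay_rate {R : realType} (n : nat) (lambda : R) : R :=
  (n%:R - 1 + Num.sqrt ((n%:R - 1) ^+ 2 - 4 * lambda)) / 2.

Definition sharp_decay {R : realType} (n : nat) (lambda chi1 chi2 : R)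
    (u : R -> R) : Prop :=
  forall x z : 'rV[R]_n, hball x -> hball z ->
    chi1 * expR (- (decay_rate n lambda * hdist x z)) <= radial_at u z x
      <= chi2 * expR (- (decay_rate n lambda * hdist x z)).

(* Main.v *)
(* Reflecting the [j]-th coordinate changes the sign of [V_j U] and turns
   [U[z](x)] into [U[z](x')], so twice the integral is that of
   [(U[z](x)^p - U[z](x')^p) V_j U(x)], which has a constant sign because [U]
   decreases with the distance and [z_j] has a sign.  The lower bound comes from
   a Euclidean box of size comparable to [1 - |z|] near [z]: there [U[z](x)] is
   bounded below, [U[z](x')] is small, and [U'] is comparable to [e^(-c d)] on a
   whole interval of radii.  For this, the two-sided decay and the mean value
   theorem give one good radius, and the radial equation in divergence form
   propagates the bound to its neighbours.  The same argument bounds [U'] above.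

   For the upper bound put [w = 1 - |x|^2], [h = 1 - |z|^2] and
   [M = max(h, |x - z|)].  The integrand is at most a constant times
   [h^c h^e w^b M^(-n-e-b)] with [e > 0] and [-1 < b < 0]; the latter is possible
   because [2 c > n - 1].  Some coordinate [i] satisfies
   [w >= (A - |x_i|) / n] with [A] a function of the other coordinates, so
   integrating first in [x_i], and splitting the power of [M] over the
   coordinates, leaves one-dimensional integrals bounded independently of [h]. *)
Require Import Defs.
From HB Require Import structures.
From mathcomp Require Import all_boot all_order all_algebra.
From mathcomp Require Import all_classical all_reals all_analysis.
From mathcomp Require Import measurable_realfun.
From mathcomp Require Import ring lra zify.

Set Implicit Arguments.
Unset Strict Implicit.
Unset Printing Implicit Defensive.
Import Order.TTheory GRing.Theory Num.Theory.
Import numFieldNormedType.Exports.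
Local Open Scope classical_set_scope.
Local Open Scope ring_scope.

(** * Lebesgue measure on tuples *)

(** The constants are chosen before [u], so the one-dimensional analysis is done for an abstract
    pair [F], [F1] satisfying [radial_profile], and every bound depends only on the dimension, [p],
    [lam], [c], [chi1] and [chi2]. The sharp decay controls the size of the profile but not its
    derivative, whereas the slope of the flux in the radial equation involves only [F] itself; this
    is why the derivative estimates pass through the flux. The weight w^b is singular on the whole
    sphere, which is not adapted to products. Bounding it by distances to the ends of chords
    parallel to the axes, and M by coordinatewise scales, makes iterated integration possible
    without polar coordinates. The identity that doubles the integral is a cancellation, available
    only for integrable functions. Hence the upper bound is proved for the absolute value of the
    integrand, on the whole ball and for every [z], and the lower bound uses the integrability so
    obtained. Reflecting [z] negates the integral, so the lower bound is only needed for
    [z 0 j <= - kappa]. *)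

Section lebesgue_1d.
Context {R : realType}.
Local Notation T := (measurableTypeR R).
Local Notation mu := (@lebesgue_measure R).
Local Open Scope ereal_scope.

Lemma ge0_integral_opp (f : T -> \bar R) :
  measurable_fun [set: T] f -> (forall x, 0 <= f x) ->
  \int[mu]_x f (- x)%R = \int[mu]_x f x.
Proof.
move=> mf f0.
have mN : measurable_fun [set: T] (-%R : T -> T) by exact: oppr_measurable.
transitivity (\int[pushforward mu (-%R : T -> T)]_x f x).
  by rewrite (ge0_integral_pushforward mN).
by apply: eq_measure_integral => A mA _; exact: lebesgue_measureN.
Qed.

Lemma lebesgue_measure_shift (a : R) (A : set T) : measurable A ->
  pushforward mu (fun x : measurableTypeR R => (x + a)%R : measurableTypeR R) A
    = mu A.
Proof.
have ma : measurable_fun [set: measurableTypeR R]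
    (fun x : measurableTypeR R => (x + a)%R : measurableTypeR R).
  exact: measurable_funD.
move=> mA; apply/esym.
apply: (@lebesgue_measure_unique R
  [the {measure set (measurableTypeR R) -> \bar R} of pushforward mu
   (fun x : measurableTypeR R => (x + a)%R : measurableTypeR R)]) => //.
move=> _ [[b c]] _ <- /=; rewrite /pushforward.
rewrite (_ : _ @^-1` _ = `]b - a, c - a]%classic)%R; last first.
  by apply/seteqP; split => x /=; rewrite !in_itv/= ltrBlDr lerBrDr.
by rewrite !lebesgue_measure_itv/= !lte_fin ltrD2r -!EFinB opprB addrA subrK.
Qed.

Lemma ge0_integral_shift (a : R) (f : T -> \bar R) :
  measurable_fun [set: T] f -> (forall x, 0 <= f x) ->
  \int[mu]_x f (x + a)%R = \int[mu]_x f x.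
Proof.
move=> mf f0.
have ma : measurable_fun [set: measurableTypeR R]
    (fun x : measurableTypeR R => (x + a)%R : measurableTypeR R).
  exact: measurable_funD.
transitivity (\int[pushforward mu (fun x : T => (x + a)%R : T)]_x f x).
  by rewrite (ge0_integral_pushforward ma).
by apply: eq_measure_integral => A mA _; exact: lebesgue_measure_shift.
Qed.

End lebesgue_1d.

Section lebesgue_tuple_theory.
Context {R : realType}.
Local Notation T := (measurableTypeR R).
Local Notation mu := (@lebesgue_measure R).
Local Notation leb n := (@lebesgue_tuple R n).
Local Open Scope ereal_scope.

(** The closed sup-norm ball: it provides the exhaustion for sigma-finiteness and later the region
    that carries the lower bound. *)
Definition tuple_box (n : nat) (a : 'I_n -> R) (r : R) : set (n.-tuple T) :=
  [set t | forall i, `|tnth t i - a i| <= r]%R.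

Lemma measurable_tuple_box n (a : 'I_n -> R) (r : R) : measurable (tuple_box a r).
Proof.
rewrite (_ : tuple_box a r =
    \big[setI/setT]_(i < n) ((fun t : n.-tuple T => tnth t i) @^-1`
       [set x : T | `|x - a i| <= r]%R)); last first.
  apply/seteqP; split => t /=.
    by move=> h; rewrite -bigcap_seq => i _ /=; exact: h.
  by rewrite -bigcap_seq => h i; apply: (h i); rewrite /= mem_index_enum.
apply: bigsetI_measurable => i _.
rewrite -[X in measurable X]setTI; apply: (measurable_tnth i) => //.
have mf : measurable_fun [set: T] (fun x : T => `|x - a i|%R : T).
  apply: measurableT_comp => //; exact: measurable_funB.
rewrite (_ : mkset _ = [set: T] `&` (fun x : T => `|x - a i|%R : T) @^-1` `]-oo, r]%classic)%R.
  by apply: mf => //; exact: measurable_itv.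
by rewrite setTI; apply/seteqP; split => x /=; rewrite in_itv.
Qed.

Lemma lebesgue_tuple_box n (a : 'I_n -> R) (r : R) : (0 <= r)%R ->
  leb n (tuple_box a r) = ((2 * r) ^+ n)%:E.
Proof.
move=> r0; elim: n a => [|n IH] a.
  by rewrite /= diracE mem_set// => -[].
have [m mE] := lebesgue_tuple_measure (R := R) n.
have mb := @measurable_tuple_box n (a \o lift ord0) r.
rewrite /= /pushforward (_ : _ @^-1` _ = tuple_box (a \o lift ord0) r `*`
    `[(a ord0 - r)%R, (a ord0 + r)%R]%classic); last first.
  apply/seteqP; split => -[t x] /=.
    move=> h; split => [i|].
      by have := h (lift ord0 i); rewrite /tuple_ext/= tnthS.
    by have := h ord0; rewrite /tuple_ext/= tnth0 in_itv/= -ler_distl.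
  move=> [h1 h2] i; case: (unliftP ord0 i) => [i'|] ->.
    by rewrite /tuple_ext/= tnthS; exact: h1.
  by rewrite /tuple_ext/= tnth0 ler_distl; rewrite in_itv/= in h2.
rewrite mE product_measure1E//= -mE IH /= lebesgue_measure_itv/= lte_fin.
(* The interval is degenerate only for [r = 0], and then both sides vanish. *)
case: ifPn => [_|]; first by rewrite -EFinB -EFinM exprS; congr EFin; ring.
rewrite -leNgt => h; have -> : r = 0%R by lra.
by rewrite mule0 !mulr0 expr0n.
Qed.

Lemma lebesgue_tuple_sigma_finite n :
  sigma_finite [set: n.-tuple T] (@lebesgue_tuple R n).
Proof.
exists (fun k => tuple_box (fun=> 0%R) k%:R).
  apply/esym/seteqP; split => // t _.
  have [k hk] : exists k : nat, forall i, (`|tnth t i| <= k%:R)%R.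
    exists (\max_(i < n) Num.bound `|tnth t i|%R)%N => i.
    apply: (le_trans (ltW (archi_boundP (normr_ge0 _)))).
    by rewrite ler_nat; exact: leq_bigmax.
  by exists k => // i; rewrite subr0.
move=> k; split; first exact: measurable_tuple_box.
by rewrite lebesgue_tuple_box// ltry.
Qed.

HB.instance Definition _ n := Measure_isSigmaFinite.Build _ _ _
  (@lebesgue_tuple R n) (@lebesgue_tuple_sigma_finite n).

(** [unlift i k] is [None] exactly at [k = i]: the value [s] enters at position [i] and the entries
    of [y] keep their order around it. *)
Definition tuple_ins n (i : 'I_n.+1) (y : n.-tuple T) (s : T) : n.+1.-tuple T :=
  [tuple oapp (tnth y) s (unlift i k) | k < n.+1].

Lemma tnth_ins n (i : 'I_n.+1) y s : tnth (tuple_ins i y s) i = s.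
Proof. by rewrite tnth_mktuple unlift_none. Qed.

Lemma tnth_ins_lift n (i : 'I_n.+1) y s k :
  tnth (tuple_ins i y s) (lift i k) = tnth y k.
Proof. by rewrite tnth_mktuple liftK. Qed.

Lemma tuple_ins0 n (y : n.-tuple T) s : tuple_ins ord0 y s = tuple_ext (y, s).
Proof.
apply: eq_from_tnth => i; case: (unliftP ord0 i) => [k|] ->.
  by rewrite tnth_ins_lift /tuple_ext/= tnthS.
by rewrite tnth_ins /tuple_ext/= tnth0.
Qed.

Lemma tuple_ins_ext n (i : 'I_n.+1) (y : n.-tuple T) s x :
  tuple_ins (lift ord0 i) (tuple_ext (y, x)) s =
  tuple_ext (tuple_ins i y s, x).
Proof.
apply: eq_from_tnth => k; case: (unliftP (lift ord0 i) k) => [j|] ->.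
  rewrite tnth_ins_lift; case: (unliftP ord0 j) => [l|] ->.
    have -> : lift (lift ord0 i) (lift ord0 l) = lift ord0 (lift i l).
      by apply: val_inj; rewrite /= /bump /=; lia.
    by rewrite /tuple_ext/= !tnthS tnth_ins_lift.
  have -> : lift (lift ord0 i) ord0 = ord0 by apply: val_inj.
  by rewrite /tuple_ext/= !tnth0.
by rewrite tnth_ins /tuple_ext/= tnthS tnth_ins.
Qed.

Lemma measurable_tuple_ins n (i : 'I_n.+1) :
  measurable_fun [set: n.-tuple T * T] (fun z => tuple_ins i z.1 z.2).
Proof.
apply/measurable_fun_tnthP => k /=; case: (unliftP i k) => [l|] ->.
  rewrite (_ : _ \o _ = (fun t : n.-tuple T => tnth t l) \o fst).
    exact: (measurableT_comp (measurable_tnth l) measurable_fst).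
  by apply/funext => z /=; exact: tnth_ins_lift.
rewrite (_ : _ \o _ = snd); first exact: measurable_snd.
by apply/funext => z /=; exact: tnth_ins.
Qed.

(* Tonelli with an arbitrary coordinate integrated first; [lebesgue_tuple]
   privileges coordinate 0. *)
Lemma ge0_integral_ins n (i : 'I_n.+1) (f : n.+1.-tuple T -> \bar R) :
  measurable_fun setT f -> (forall t, 0 <= f t) ->
  \int[leb n.+1]_t f t =
  \int[leb n]_y \int[mu]_s f (tuple_ins i y s).
Proof.
have base k (g : k.+1.-tuple T -> \bar R) : measurable_fun setT g ->
    (forall t, 0 <= g t) ->
    \int[leb k.+1]_t g t =
    \int[(leb k \x mu)]_z g (tuple_ext z).
  move=> mg g0; rewrite /=.
  by rewrite (ge0_integral_pushforward (@measurable_tuple_ext R k)).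
have base1 k (g : k.+1.-tuple T -> \bar R) : measurable_fun setT g ->
    (forall t, 0 <= g t) ->
    \int[leb k.+1]_t g t =
    \int[leb k]_y \int[mu]_s g (tuple_ext (y, s)).
  move=> mg g0; rewrite base// fubini_tonelli1//.
  exact: (measurableT_comp mg (@measurable_tuple_ext R k)).
elim: n i f => [|n IH] i f mf f0.
  rewrite (base1 _ _ mf f0); apply: eq_integral => y _; apply: eq_integral => s _.
  by rewrite -tuple_ins0; congr (f (tuple_ins _ _ _)); apply: val_inj; case: i => -[].
case: (unliftP ord0 i) => [j|] ->; last first.
  rewrite (base1 _ _ mf f0); apply: eq_integral => y _; apply: eq_integral => s _.
  by rewrite tuple_ins0.
have mfe := measurableT_comp mf (@measurable_tuple_ext R n.+1).
rewrite base// fubini_tonelli2// [RHS]base1//; last 2 first.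
- apply: (measurable_fun_fubini_tonelli_F (m2 := mu)
    (f \o (fun z => tuple_ins (lift ord0 j) z.1 z.2))) => [|z]; last exact: f0.
  exact: (measurableT_comp mf (@measurable_tuple_ins _ _)).
- by move=> t; apply: integral_ge0.
rewrite /fubini_G.
(* [g] exposes the head coordinate [x], the remaining coordinates [y] and the inserted value [s].
   The induction hypothesis splits [s] off the tail, and Tonelli then exchanges [x] and [y]. *)
pose g (z : (T * n.-tuple T) * T) := f (tuple_ext (tuple_ins j z.1.2 z.2, z.1.1)).
have mg : measurable_fun setT g.
  apply: (measurableT_comp mfe); apply/measurable_fun_pairP; split => /=.
    have mp : measurable_fun setT
        (fun z : (T * n.-tuple T) * T => (z.1.2, z.2) : n.-tuple T * T).
      apply/measurable_fun_pairP; split => /=; last exact: measurable_snd.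
      exact: (measurableT_comp measurable_snd measurable_fst).
    exact: (measurableT_comp (@measurable_tuple_ins n j) mp).
  exact: (measurableT_comp measurable_fst measurable_fst).
transitivity (\int[mu]_x \int[leb n]_y \int[mu]_s g ((x, y), s)).
  apply: eq_integral => x _; rewrite (IH j)//.
  exact: (measurableT_comp mfe (pair2_measurable x)).
transitivity (\int[leb n]_y \int[mu]_x \int[mu]_s g ((x, y), s)).
  apply: (fubini_tonelli (m1 := mu) (m2 := leb n) (fubini_F mu g)).
    by apply: (measurable_fun_fubini_tonelli_F (m2 := mu) g) => // z; exact: f0.
  by move=> z; rewrite /fubini_F; apply: integral_ge0 => s _; exact: f0.
apply: eq_integral => y _; apply: eq_integral => x _; apply: eq_integral => s _.
by rewrite /g/= tuple_ins_ext.
Qed.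


(** * Invariance of the measure under reflection of a coordinate *)

Definition tuple_refl n (j : 'I_n) (t : n.-tuple T) : n.-tuple T :=
  [tuple if k == j then - tnth t k else tnth t k | k < n]%R.

Lemma measurable_tuple_refl n (j : 'I_n) :
  measurable_fun [set: n.-tuple T] (tuple_refl j).
Proof.
apply/measurable_fun_tnthP => k /=.
have mk := @measurable_tnth _ T n k.
have [->|kj] := eqVneq k j.
  rewrite (_ : _ \o _ = (fun x : T => - x : T)%R \o (fun t : n.-tuple T => tnth t j)).
    exact: (measurableT_comp (@oppr_measurable R setT) (measurable_tnth j)).
  by apply/funext => t /=; rewrite tnth_mktuple eqxx.
rewrite (_ : _ \o _ = (fun t : n.-tuple T => tnth t k)) //.
by apply/funext => t /=; rewrite tnth_mktuple (negbTE kj).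
Qed.

Lemma tuple_refl_ins n (j : 'I_n.+1) y s :
  tuple_refl j (tuple_ins j y s) = tuple_ins j y (- s)%R.
Proof.
apply: eq_from_tnth => k; rewrite tnth_mktuple.
case: (unliftP j k) => [l|] ->; last by rewrite eqxx !tnth_ins.
by rewrite !tnth_ins_lift eq_sym (negbTE (neq_lift _ _)).
Qed.

(** Integrating the reflected coordinate first reduces this to the invariance of Lebesgue measure on
    the line under negation. *)
Lemma ge0_integral_tuple_refl n (j : 'I_n) (f : n.-tuple T -> \bar R) :
  measurable_fun setT f -> (forall t, 0 <= f t) ->
  \int[leb n]_t f (tuple_refl j t) = \int[leb n]_t f t.
Proof.
case: n j f => [[] //|n] j f mf f0.
have mfr := measurableT_comp mf (measurable_tuple_refl j).
rewrite (ge0_integral_ins j mfr (fun=> f0 _)) (ge0_integral_ins j mf f0).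
apply: eq_integral => y _ /=.
rewrite -[RHS](ge0_integral_opp (f := fun s => f (tuple_ins j y s)))//.
  by apply: eq_integral => s _; rewrite tuple_refl_ins.
have mi := measurableT_comp mf (@measurable_tuple_ins n j).
exact: (measurableT_comp mi (pair1_measurable y)).
Qed.

(** No integrability is required, because the positive and negative parts are reflected
    separately. *)
Lemma integral_tuple_refl n (j : 'I_n) (f : n.-tuple T -> \bar R) :
  measurable_fun setT f ->
  \int[leb n]_t f (tuple_refl j t) = \int[leb n]_t f t.
Proof.
move=> mf; rewrite integralE [RHS]integralE.
congr (_ - _).
  rewrite -(ge0_integral_tuple_refl j (measurable_funepos mf) (fun=> funepos_ge0 _ _)).
  by apply: eq_integral => t _; rewrite !funeposE.
rewrite -(ge0_integral_tuple_refl j (measurable_funeneg mf) (fun=> funeneg_ge0 _ _)).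
by apply: eq_integral => t _; rewrite !funenegE.
Qed.

Lemma measurable_prod_tnth n (g : 'I_n -> T -> R) :
  (forall i, measurable_fun setT (g i)) ->
  measurable_fun [set: n.-tuple T] (fun t => \prod_(i < n) g i (tnth t i))%R.
Proof.
move=> mg; apply: measurable_prod => i _.
exact: (measurableT_comp (mg i) (measurable_tnth i)).
Qed.

(** One step of iterated integration: the factor containing coordinate [i] integrates to at most [K]
    uniformly in the others, so [K] can be pulled out before the remaining coordinates are
    integrated. *)
Lemma ge0_integral_ins_prod n (i : 'I_n.+1) (F : n.+1.-tuple T -> R)
    (h : n.-tuple T -> T -> R) (q : n.-tuple T -> R) (K : R) :
  measurable_fun setT F -> (forall t, 0 <= F t)%R ->
  (forall y s, F (tuple_ins i y s) = q y * h y s)%R ->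
  (forall y, measurable_fun setT (h y)) -> (forall y s, 0 <= h y s)%R ->
  measurable_fun setT q -> (forall y, 0 <= q y)%R -> (0 <= K)%R ->
  (forall y, \int[mu]_s (h y s)%:E <= K%:E) ->
  \int[leb n.+1]_t (F t)%:E <= K%:E * \int[leb n]_y (q y)%:E.
Proof.
move=> mF F0 FE mh h0 mq q0 K0 hK.
have mF' : measurable_fun setT (EFin \o F) by exact/measurable_EFinP.
have mq' : measurable_fun setT (EFin \o q) by exact/measurable_EFinP.
rewrite (ge0_integral_ins i mF')/=; last by move=> t; rewrite lee_fin.
rewrite -(ge0_integralZl (leb n) measurableT mq'); last 2 first.
- by move=> y _; rewrite lee_fin.
- by rewrite lee_fin.
apply: ge0_le_integral => //.
- by move=> y _; apply: integral_ge0 => s _ /=; rewrite lee_fin.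
- apply: (measurable_fun_fubini_tonelli_F (m2 := mu)
    (EFin \o F \o (fun z => tuple_ins i z.1 z.2))) => [|z]; last by rewrite /= lee_fin.
  exact: (measurableT_comp mF' (@measurable_tuple_ins _ _)).
- exact: measurable_funeM.
move=> y _; have mh' : measurable_fun setT (EFin \o h y) by exact/measurable_EFinP.
under eq_integral do rewrite FE EFinM.
rewrite (ge0_integralZl mu measurableT mh'); last 2 first.
- by move=> s _; rewrite lee_fin.
- by rewrite lee_fin.
by rewrite muleC; apply: lee_wpmul2r => //=; rewrite lee_fin.
Qed.

Lemma ge0_integral_prod_le n (g : 'I_n -> T -> R) (K : R) :
  (forall i, measurable_fun setT (g i)) -> (forall i s, 0 <= g i s)%R ->
  (0 <= K)%R -> (forall i, \int[mu]_s (g i s)%:E <= K%:E) ->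
  \int[leb n]_t (\prod_(i < n) g i (tnth t i))%R%:E <= (K ^+ n)%:E.
Proof.
move=> + + K0; elim: n g => [|n IH] g mg g0 gK.
  under eq_integral do rewrite big_ord0.
  by rewrite /= integral_dirac// diracT mul1e.
pose g' i := g (lift ord0 i).
apply: (@le_trans _ _ (K%:E * \int[leb n]_t (\prod_(i < n) g' i (tnth t i))%R%:E)).
  apply: (@ge0_integral_ins_prod n ord0 _ (fun=> g ord0)
      (fun t => (\prod_(i < n) g' i (tnth t i))%R)) => //.
  - exact: measurable_prod_tnth.
  - by move=> t; exact: prodr_ge0.
  - move=> y s; rewrite big_ord_recl tnth_ins mulrC; congr (_ * _)%R.
    by apply: eq_bigr => i _; rewrite tnth_ins_lift.
  - by apply: measurable_prod_tnth => i; exact: mg.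
  - by move=> t; apply: prodr_ge0 => i _; exact: g0.
rewrite exprS EFinM; apply: lee_wpmul2l; rewrite ?lee_fin//.
by apply: IH => i; [exact: mg|exact: g0|exact: gK].
Qed.

End lebesgue_tuple_theory.

(** * Kernels on the line and their products *)

Section kernels.
Context {R : realType}.
Local Notation T := (measurableTypeR R).
Local Notation mu := (@lebesgue_measure R).
Local Notation leb n := (@lebesgue_tuple R n).

Lemma powR_neg_le (x y b : R) : 0 < x -> x <= y -> b <= 0 -> y `^ b <= x `^ b.
Proof.
move=> x0 xy b0; have y0 : 0 < y by apply: lt_le_trans xy.
have -> : b = - - b by rewrite opprK.
rewrite (powRN y) (powRN x) lef_pV2 ?posrE ?powR_gt0//.
by apply: ge0_ler_powR => //; rewrite ?nnegrE ?oppr_ge0// ltW.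
Qed.

Lemma measurable_powR_comp d (X : measurableType d) (f : X -> T) (b : R) :
  measurable_fun setT f -> measurable_fun setT (fun x => f x `^ b : T).
Proof. by move=> mf; exact: (measurableT_comp (measurable_powR b) mf). Qed.

(** This is the rescaling h^-1 phi(t / h) of phi(t) = max(1, |t|)^(-1-g), so its integral does not
    depend on [h]. *)
Definition decay_kernel (h g t : R) : R := h `^ g * Num.max h `|t| `^ (- 1 - g).

Lemma decay_kernel_ge0 h g t : 0 <= decay_kernel h g t.
Proof. by rewrite mulr_ge0 ?powR_ge0. Qed.

Lemma measurable_decay_kernel h g : measurable_fun setT (decay_kernel h g : T -> T).
Proof.
apply: measurable_funM => //; apply: measurable_powR_comp.
exact: measurable_maxr.
Qed.

(** An even function on the line is handled as a function on one side of 0 plus its mirror image. *)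
Lemma ge0_integral_even_le (f : T -> R) (D : set T) (K : R) :
  measurable D -> measurable_fun D f -> (forall x, D x -> 0 <= f x) ->
  (\int[mu]_(x in D) (f x)%:E <= K%:E)%E ->
  (\int[mu]_x ((f \_ D) x + (f \_ D) (- x))%:E <= (2 * K)%:E)%E.
Proof.
move=> mD mf f0 fK.
have mfD : measurable_fun setT (f \_ D) by apply/(measurable_restrictT _ mD).
have fD0 x : 0 <= (f \_ D) x by rewrite patchE; case: ifPn => // /set_mem /f0.
have mfE : measurable_fun setT (EFin \o (f \_ D)) by exact/measurable_EFinP.
have mfN : measurable_fun setT ((EFin \o (f \_ D)) \o (-%R : T -> T)).
  exact: (measurableT_comp mfE (@oppr_measurable R setT)).
under eq_integral do rewrite EFinD.
rewrite ge0_integralD//; last 2 first.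
- by move=> x _; rewrite lee_fin.
- by move=> x _; rewrite lee_fin.
rewrite (@ge0_integral_opp R (EFin \o (f \_ D)))//.
have h : (\int[mu]_x (EFin \o (f \_ D)) x <= K%:E)%E.
  by apply: le_trans fK; rewrite [leRHS]integral_mkcond restrict_EFin.
by rewrite mulrDl mul1r EFinD; exact: leeD.
Qed.

(** The integrand blows up at 0, so the fundamental theorem is applied on the intervals
    [[h / k.+1%:R, h]]; the bound does not depend on [k] and passes to the limit by monotone
    convergence. *)
Lemma integral_powR_small (b h : R) : - 1 < b -> b < 0 -> 0 < h ->
  (\int[mu]_(x in `]0%R, h]) (x `^ b)%:E <= (h `^ (b + 1) / (b + 1))%:E)%E.
Proof.
move=> b1 b0 h0.
have b10 : 0 < b + 1 by lra.
pose F k : set T := `[h / k.+1%:R, h]%classic.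
have UF : `]0%R, h]%classic = \bigcup_k F k :> set T.
  apply/seteqP; split => x /=.
    rewrite in_itv/= => /andP[x0 xh].
    exists (Num.bound (h / x)) => //; rewrite /F/= in_itv/= xh andbT.
    rewrite ler_pdivrMr// -ler_pdivrMl// mulrC.
    have := archi_boundP (divr_ge0 (ltW h0) (ltW x0)).
    move=> /ltW /le_trans; apply; by rewrite ler_nat.
  by move=> [k _]; rewrite /F/= !in_itv/= => /andP[x0 ->]; rewrite (lt_le_trans _ x0) ?divr_gt0.
have mF k : measurable (F k) by exact: measurable_itv.
have mpow : measurable_fun setT (fun x : T => (x `^ b)%:E).
  by apply/measurable_EFinP; exact: measurable_powR.
have Fk k : (\int[mu]_(x in F k) (x `^ b)%:E <= (h `^ (b + 1) / (b + 1))%:E)%E.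
  (* For [k = 0] the interval is the single point [h], where the fundamental theorem does not
     apply. *)
  case: k => [|k].
    rewrite /F divr1 set_itv1 integral_set1.
    by rewrite lee_fin divr_ge0 ?powR_ge0// ltW.
  have hk0 : 0 < h / k.+2%:R by rewrite divr_gt0.
  have hkh : h / k.+2%:R < h by rewrite ltr_pdivrMr// ltr_pMr// ltr1n.
  have dG (x : R) : 0 < x -> is_derive x (1 : R) (fun x : R => x `^ (b + 1) / (b + 1)) (x `^ b).
    move=> x0; have := is_derive1_powR (b + 1) x0 => hd.
    have -> : x `^ b = (b + 1)^-1 *: ((b + 1) * x `^ (b + 1 - 1)).
      by rewrite /GRing.scale/= addrK mulrA mulVf ?mul1r ?gt_eqF.
    rewrite (_ : (fun x => _) = (b + 1)^-1 *: (fun x : R => x `^ (b + 1)))%R.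
      exact: is_deriveZ.
    by apply/funext => y /=; rewrite mulrC.
  have cG (x : R) : 0 < x -> {for x, continuous (fun x : R => x `^ (b + 1) / (b + 1))}.
    by move=> x0; apply/differentiable_continuous/derivable1_diffP; have [] := dG x x0.
  rewrite (@continuous_FTC2 _ (fun x => x `^ b) (fun x => x `^ (b + 1) / (b + 1)))//.
  - rewrite -EFinB lee_fin lerBlDr lerDl divr_ge0 ?powR_ge0//; exact: ltW.
  - apply: continuous_in_subspaceT => x; rewrite inE/= in_itv/= => /andP[x0 _].
    have x00 : 0 < x by exact: lt_le_trans x0.
    apply: differentiable_continuous; apply/derivable1_diffP.
    by apply: derivable_powR; rewrite in_itv/= x00.
  - split.
    + move=> x; rewrite in_itv/= => /andP[x0 _].
      by have [] := dG x (lt_trans hk0 x0).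
    + by apply: cvg_at_right_filter; exact: cG.
    + by apply: cvg_at_left_filter; exact: cG.
  - move=> x; rewrite in_itv/= => /andP[x0 _].
    by rewrite derive1E; have [_ ->] := dG x (lt_trans hk0 x0).
rewrite UF.
have ndF : nondecreasing_seq F.
  move=> k l kl; apply/subsetPset => x; rewrite /F/= !in_itv/= => /andP[x0 ->].
  rewrite andbT (le_trans _ x0)// ler_pM2l// lef_pV2 ?posrE// ler_nat//.
have cv : (\int[mu]_(x in F i) (x `^ b)%:E)%E @[i --> \oo] -->
    (\int[mu]_(x in \bigcup_i F i) (x `^ b)%:E)%E.
  apply: (@ge0_nondecreasing_set_cvg_integral _ _ _ F (fun x : T => (x `^ b)%:E)) => //.
  - by move=> k; exact: measurable_funTS.
  - by move=> k x _; rewrite lee_fin powR_ge0.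
rewrite -(cvg_lim _ cv)//; apply: lime_le; first by apply/cvg_ex; eexists; exact: cv.
by near=> k; exact: Fk.
Unshelve. all: by end_near. Qed.

Lemma powRN_cvg_pinfty (g : R) : 0 < g -> x `^ (- g) @[x --> +oo] --> (0 : R).
Proof.
move=> g0; apply/cvgrPdist_le => e e0.
near=> x.
have x0 : 0 < x by near: x; exact: nbhs_pinfty_gt.
rewrite sub0r normrN ger0_norm ?powR_ge0//.
have -> : e = (e `^ (- g^-1)) `^ (- g).
  by rewrite -powRrM mulrNN mulVf ?gt_eqF// powRr1// ltW.
apply: powR_neg_le; first exact: powR_gt0.
  by near: x; apply: nbhs_pinfty_ge; exact: num_real.
by rewrite oppr_le0 ltW.
Unshelve. all: by end_near. Qed.

Lemma integral_powR_tail (g h : R) : 0 < g -> 0 < h ->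
  (\int[mu]_(x in `[0%R, +oo[) ((x + h) `^ (- 1 - g))%:E = (h `^ (- g) / g)%:E)%E.
Proof.
move=> g0 h0.
pose F (x : R) := - ((x + h) `^ (- g) / g).
have dF (x : R) : 0 <= x -> is_derive x (1 : R) F ((x + h) `^ (- 1 - g)).
  move=> x0; have xh0 : 0 < x + h by lra.
  have := is_derive1_powR (- g) xh0 => hd.
  have hs : is_derive x (1 : R) (fun x : R => x + h) 1.
    by apply: is_derive_eq; rewrite addr0.
  have hc := @is_derive1_comp _ ((@powR R)^~ (- g)) (fun x : R => x + h) x _ _ hd hs.
  have -> : (x + h) `^ (- 1 - g) = (- g^-1) *: (- g * (x + h) `^ (- g - 1) * 1).
    rewrite /GRing.scale/= (addrC (- 1)); field; exact: lt0r_neq0.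
  rewrite (_ : F = (- g^-1) *: (fun x : R => (x + h) `^ (- g)))%R.
    exact: is_deriveZ.
  by apply/funext => y; rewrite /F !fctE /GRing.scale/=; ring.
have cF (x : R) : 0 <= x -> {for x, continuous F}.
  by move=> x0; apply/differentiable_continuous/derivable1_diffP; have [] := dF x x0.
rewrite (@ge0_continuous_FTC2y _ _ F 0 0).
- by rewrite -EFinB /F sub0r opprK add0r.
- by move=> x _; exact: powR_ge0.
- apply: continuous_in_subspaceT => x; rewrite inE/= in_itv/= andbT => x0.
  apply/differentiable_continuous/derivable1_diffP.
  have xh0 : 0 < x + h by lra.
  have hs : is_derive x (1 : R) (fun x : R => x + h) 1.
    by apply: is_derive_eq; rewrite addr0.
  by have [] := @is_derive1_comp _ ((@powR R)^~ (- 1 - g)) _ x _ _ (is_derive1_powR _ xh0) hs.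
- rewrite /F -[X in _ --> X]oppr0; apply: cvgN; rewrite -(mul0r g^-1).
  apply: cvgMl.
  apply: (@cvg_comp _ _ _ (fun x : R => x + h) ((@powR R)^~ (- g))); last exact: powRN_cvg_pinfty.
  apply/cvgryPge => A; near=> x; rewrite -lerBlDr; near: x.
  by apply: nbhs_pinfty_ge; exact: num_real.
- by move=> x x0; have [] := dF x (ltW x0).
- by apply: cvg_at_right_filter; exact: cF.
- move=> x; rewrite in_itv/= andbT => x0.
  by rewrite derive1E; have [_ ->] := dF x (ltW x0).
Unshelve. all: by end_near. Qed.

(** Since max(h, |x|) >= (h + |x|) / 2, the maximum may be replaced by a shifted power with an
    explicit primitive, at the cost of 2^(1+g). The tail contributes h^(-g), which cancels the h^g
    of the kernel. *)
Lemma integral_decay_kernel (g h a : R) : 0 < g -> 0 < h ->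
  (\int[mu]_x (decay_kernel h g (x - a))%:E <= (2 `^ (1 + g) * (2 / g))%:E)%E.
Proof.
move=> g0 h0.
rewrite (@ge0_integral_shift _ (- a) (fun x => (decay_kernel h g x)%:E)); last 2 first.
- by apply/measurable_EFinP; exact: measurable_decay_kernel.
- by move=> x; rewrite lee_fin decay_kernel_ge0.
pose D := `[0%R, +oo[%classic : set T.
pose f (x : T) := (x + h) `^ (- 1 - g) : T.
have mf : measurable_fun setT f.
  by apply: measurable_powR_comp; exact: measurable_funD.
have mD : measurable D by exact: measurable_itv.
have h1 := ge0_integral_even_le mD (measurable_funTS mf) (fun _ _ => powR_ge0 _ _).
have {}h1 := h1 (h `^ (- g) / g) (eq_ind_r (fun t => (t <= _)%E) (lexx _) (integral_powR_tail g0 h0)).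
pose G (x : T) := (f \_ D) x + (f \_ D) (- x).
have mfD : measurable_fun setT (f \_ D).
  by apply/(measurable_restrictT _ mD); exact: measurable_funTS.
have mG : measurable_fun setT G.
  apply: measurable_funD => //.
  exact: (measurableT_comp mfD (@oppr_measurable R setT)).
have fD0 x : 0 <= (f \_ D) x by rewrite patchE; case: ifPn => // _; exact: powR_ge0.
apply: (@le_trans _ _ (\int[mu]_x ((2 `^ (1 + g) * h `^ g)%:E * (G x)%:E))%E).
  apply: ge0_le_integral => //.
  - by move=> x _; rewrite lee_fin decay_kernel_ge0.
  - by apply/measurable_EFinP; exact: measurable_decay_kernel.
  - by apply: measurable_funeM; exact/measurable_EFinP.
  move=> x _; rewrite -EFinM lee_fin /decay_kernel [X in _ <= X]mulrAC [leRHS]mulrC.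
  rewrite ler_wpM2l ?powR_ge0//.
  have [x0|x0] := leP 0 x.
    apply: (@le_trans _ _ (2 `^ (1 + g) * (f \_ D) x)); last first.
      by rewrite ler_wpM2l ?powR_ge0// /G lerDl.
    rewrite patchE mem_set; last by rewrite /D/= in_itv/= x0.
    rewrite ger0_norm//.
    have -> : 2 `^ (1 + g) * f x = ((x + h) / 2) `^ (- 1 - g).
      rewrite powRM//; last lra.
      rewrite mulrC; congr (_ * _).
      by rewrite -powR_inv1 // -powRrM; congr (_ `^ _); ring.
    apply: powR_neg_le; [lra| |lra].
    by rewrite le_max; have [] := leP x h => xh; apply/orP; [left|right]; lra.
  apply: (@le_trans _ _ (2 `^ (1 + g) * (f \_ D) (- x))); last first.
    by rewrite ler_wpM2l ?powR_ge0// /G lerDr.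
  rewrite patchE mem_set; last by rewrite /D/= in_itv/= andbT; lra.
  rewrite ltr0_norm//.
  have -> : 2 `^ (1 + g) * f (- x) = ((- x + h) / 2) `^ (- 1 - g).
    rewrite powRM//; last lra.
    rewrite mulrC; congr (_ * _).
    by rewrite -powR_inv1 // -powRrM; congr (_ `^ _); ring.
  apply: powR_neg_le; [lra| |lra].
  by rewrite le_max; have [] := leP (- x) h => xh; apply/orP; [left|right]; lra.
have mG' : measurable_fun setT (EFin \o G) by exact/measurable_EFinP.
rewrite (ge0_integralZl mu measurableT mG'); last 2 first.
- by move=> x _; rewrite lee_fin addr_ge0.
- by rewrite lee_fin mulr_ge0 ?powR_ge0.
apply: (le_trans (lee_wpmul2l _ h1)); first by rewrite lee_fin mulr_ge0 ?powR_ge0.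
rewrite -EFinM lee_fin -!mulrA ler_wpM2l ?powR_ge0//.
have hg : h `^ g != 0 by rewrite gt_eqF// powR_gt0.
rewrite powRN le_eqVlt; apply/orP; left; apply/eqP; field.
by rewrite hg gt_eqF.
Qed.

(** A decay kernel centred at [a] with an additional singularity at [A]. The exponent of the maximum
    is lowered by [b] so that the total degree stays -1, as scale invariance requires. *)
Definition singular_kernel (h b g A a s : R) : R :=
  h `^ g * (`|s - A| `^ b * Num.max h `|s - a| `^ (- 1 - g - b)).

Lemma singular_kernel_ge0 h b g A a s : 0 <= singular_kernel h b g A a s.
Proof. by rewrite !mulr_ge0 ?powR_ge0. Qed.

Lemma measurable_singular_kernel h b g A a :
  measurable_fun setT (singular_kernel h b g A a : T -> T).
Proof.
apply: measurable_funM => //; apply: measurable_funM.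
  apply: measurable_powR_comp; apply: measurableT_comp => //.
  exact: measurable_funB.
apply: measurable_powR_comp; apply: measurable_maxr => //.
by apply: measurableT_comp => //; exact: measurable_funB.
Qed.

(* Where [|s - A| < h] the singularity is integrated directly; elsewhere both
   factors are powers of quantities at least [h], and the smaller one wins. *)
Lemma integral_singular_kernel (h b g A a : R) :
  0 < h -> - 1 < b -> b < 0 -> 0 < g ->
  (\int[mu]_s (singular_kernel h b g A a s)%:E <=
   (2 / (b + 1) + 2 * (2 `^ (1 + g) * (2 / g)))%:E)%E.
Proof.
move=> h0 b1 b0 g0.
have b10 : 0 < b + 1 by lra.
pose D := `]0%R, h]%classic : set T.
have mD : measurable D by exact: measurable_itv.
pose f (x : T) := x `^ b : T.
have mf : measurable_fun setT f by exact: measurable_powR.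
have mfD : measurable_fun setT (f \_ D).
  by apply/(measurable_restrictT _ mD); exact: measurable_funTS.
have fD0 x : 0 <= (f \_ D) x by rewrite patchE; case: ifPn => // _; exact: powR_ge0.
pose G (x : T) := (f \_ D) x + (f \_ D) (- x).
have mG : measurable_fun setT G.
  apply: measurable_funD => //.
  exact: (measurableT_comp mfD (@oppr_measurable R setT)).
have G0 x : 0 <= G x by rewrite addr_ge0.
have hG : (\int[mu]_x (G x)%:E <= (2 * (h `^ (b + 1) / (b + 1)))%:E)%E.
  apply: ge0_integral_even_le => //.
  - exact: measurable_funTS.
  - by move=> x _; exact: powR_ge0.
  - exact: integral_powR_small.
pose G1 (x : T) := h `^ (- 1 - b) * G (x - A).
pose k1 (x : T) := decay_kernel h g (x - A).
pose k2 (x : T) := decay_kernel h g (x - a).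
have mG1 : measurable_fun setT G1.
  apply: measurable_funM => //.
  apply: (measurableT_comp mG (_ : measurable_fun setT (fun x : T => x - A : T))).
  exact: measurable_funB.
have mk c : measurable_fun setT (fun x : T => decay_kernel h g (x - c) : T).
  apply: (measurableT_comp (measurable_decay_kernel h g)
    (_ : measurable_fun setT (fun x : T => x - c : T))).
  exact: measurable_funB.
have G10 x : 0 <= G1 x by rewrite mulr_ge0 ?powR_ge0.
have eG1 : measurable_fun setT (EFin \o G1) by exact/measurable_EFinP.
have ek1 : measurable_fun setT (EFin \o k1) by apply/measurable_EFinP; exact: mk.
have ek2 : measurable_fun setT (EFin \o k2) by apply/measurable_EFinP; exact: mk.
apply: (@le_trans _ _ (\int[mu]_s ((G1 s)%:E + ((k1 s)%:E + (k2 s)%:E)))%E).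
  apply: ge0_le_integral => //.
  - by move=> x _; rewrite lee_fin singular_kernel_ge0.
  - by apply/measurable_EFinP; exact: measurable_singular_kernel.
  - by do 2 apply: emeasurable_funD => //.
  move=> x _; rewrite -!EFinD lee_fin /singular_kernel.
  set X := `|x - A|; set M := Num.max h `|x - a|.
  have hM : h <= M by rewrite le_max lexx.
  have M0 : 0 < M by apply: lt_le_trans hM.
  have [Xh|hX] := ltP X h.
    have {1}-> : X `^ b = G (x - A).
      rewrite /G !patchE /D /f !mem_setE !in_itv/= /X.
      have [xA|xA|xA] := ltrgtP 0 (x - A).
      - rewrite gtr0_norm// (_ : (0 < - (x - A)) = false) ?addr0; last lra.
        by rewrite /X gtr0_norm// in Xh; rewrite ltW.
      - rewrite ltr0_norm// add0r (_ : 0 < - (x - A)); last lra.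
        by rewrite /X ltr0_norm// in Xh; rewrite ltW.
      (* At [x = A] both sides are 0, because a nonzero power of 0 is 0 by convention. *)
      - by rewrite -xA oppr0 ltxx normr0 powR0 ?addr0// lt_eqF.
    apply: (@le_trans _ _ (G1 x)); last first.
      by rewrite lerDl addr_ge0// decay_kernel_ge0.
    rewrite mulrCA /G1 mulrC ler_wpM2r//.
    apply: (@le_trans _ _ (h `^ g * h `^ (- 1 - g - b))).
      by rewrite ler_wpM2l ?powR_ge0//; apply: powR_neg_le => //; lra.
    rewrite -powRD; last by apply/implyP => _; rewrite gt_eqF.
    by rewrite (_ : g + _ = - 1 - b)//; ring.
  apply: (@le_trans _ _ (k1 x + k2 x)); last by rewrite lerDr.
  rewrite /k1 /k2 /decay_kernel -/X -/M -mulrDr ler_wpM2l ?powR_ge0//.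
  have X0 : 0 < X by apply: lt_le_trans hX.
  rewrite (max_idPr hX).
  have sp Y : 0 < Y -> Y `^ b * Y `^ (- 1 - g - b) = Y `^ (- 1 - g).
    move=> Y0; rewrite -powRD; last by apply/implyP => _; rewrite gt_eqF.
    by congr (_ `^ _); ring.
  have [XM|MX] := leP X M.
    apply: (@le_trans _ _ (X `^ (- 1 - g))); last by rewrite lerDl powR_ge0.
    by rewrite -sp// ler_wpM2l ?powR_ge0//; apply: powR_neg_le => //; lra.
  apply: (@le_trans _ _ (M `^ (- 1 - g))); last by rewrite lerDr powR_ge0.
  by rewrite -sp// ler_wpM2r ?powR_ge0//; apply: powR_neg_le => //; lra.
rewrite ge0_integralD//; last 3 first.
- by move=> x _; rewrite lee_fin.
- by move=> x _; rewrite -EFinD lee_fin addr_ge0 ?decay_kernel_ge0.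
- exact: emeasurable_funD.
rewrite ge0_integralD//; last 2 first.
- by move=> x _; rewrite lee_fin decay_kernel_ge0.
- by move=> x _; rewrite lee_fin decay_kernel_ge0.
rewrite EFinD; apply: leeD; last first.
  by rewrite mulrDl mul1r EFinD; apply: leeD; exact: integral_decay_kernel.
under eq_integral do rewrite EFinM.
have eG : measurable_fun setT (EFin \o (fun x : T => G (x - A))).
  apply/measurable_EFinP.
  apply: (measurableT_comp mG (_ : measurable_fun setT (fun x : T => x - A : T))).
  exact: measurable_funB.
rewrite (ge0_integralZl mu measurableT eG); last 2 first.
- by move=> x _; rewrite lee_fin.
- by rewrite lee_fin powR_ge0.
rewrite (@ge0_integral_shift _ (- A) (fun x => (G x)%:E)); last 2 first.
- exact/measurable_EFinP.
- by move=> x; rewrite lee_fin.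
apply: (le_trans (lee_wpmul2l _ hG)); first by rewrite lee_fin powR_ge0.
rewrite -EFinM lee_fin mulrCA ler_wpM2l// mulrA -powRD; last by apply/implyP => _; rewrite gt_eqF.
by rewrite (_ : - 1 - b + (b + 1) = 0) ?powRr0 ?mul1r//; ring.
Qed.

Definition slice_kernel n (i : 'I_n.+1) (h b g : R) (A : n.+1.-tuple T -> T)
    (a : 'I_n.+1 -> R) (t : n.+1.-tuple T) : R :=
  singular_kernel h b g (A t) (a i) (tnth t i) *
  \prod_(k < n) decay_kernel h g (tnth t (lift i k) - a (lift i k)).

Lemma slice_kernel_ge0 n (i : 'I_n.+1) h b g A a t :
  0 <= slice_kernel i h b g A a t.
Proof.
rewrite mulr_ge0 ?singular_kernel_ge0//.
by apply: prodr_ge0 => k _; exact: decay_kernel_ge0.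
Qed.

Lemma measurable_slice_kernel n (i : 'I_n.+1) h b g A a :
  measurable_fun setT A ->
  measurable_fun setT (slice_kernel i h b g A a : n.+1.-tuple T -> T).
Proof.
move=> mA; apply: measurable_funM.
  apply: measurable_funM => //; apply: measurable_funM.
    apply: measurable_powR_comp; apply: measurableT_comp => //.
    by apply: measurable_funB => //; exact: measurable_tnth.
  apply: measurable_powR_comp; apply: measurable_maxr => //.
  apply: measurableT_comp => //.
  by apply: measurable_funB => //; exact: measurable_tnth.
apply: measurable_prod => k _.
apply: (measurableT_comp (measurable_decay_kernel h g)
  (_ : measurable_fun setT (fun t : n.+1.-tuple T => tnth t _ - _ : T))).
by apply: measurable_funB => //; exact: measurable_tnth.
Qed.

(** The last hypothesis says that [A] does not depend on coordinate [i]: integrating that coordinate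
    first, the singular point is frozen, and what remains is a product of decay kernels. The point
    is that [K] is independent of [h], [A] and [a]. *)
Lemma integral_slice_kernel n (b g : R) : - 1 < b -> b < 0 -> 0 < g ->
  exists2 K : R, 0 <= K & forall (i : 'I_n.+1) (h : R) A a, 0 < h ->
    measurable_fun setT A ->
    (forall y s, A (tuple_ins i y s) = A (tuple_ins i y 0)) ->
    (\int[leb n.+1]_t (slice_kernel i h b g A a t)%:E <= K%:E)%E.
Proof.
move=> b1 b0 g0.
have b10 : 0 < b + 1 by lra.
pose L := 2 `^ (1 + g) * (2 / g).
pose M := 2 / (b + 1) + 2 * L.
have L0 : 0 <= L by rewrite mulr_ge0 ?powR_ge0// divr_ge0// ltW.
have M0 : 0 <= M by rewrite addr_ge0 ?mulr_ge0// invr_ge0 ltW.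
exists (M * L ^+ n); first by rewrite mulr_ge0 ?exprn_ge0.
move=> i h A a h0 mA Ai.
pose q (y : n.-tuple T) : R :=
  \prod_(k < n) decay_kernel h g (tnth y k - a (lift i k)).
have mk k : measurable_fun setT (fun s : T => decay_kernel h g (s - a (lift i k)) : T).
  apply: (measurableT_comp (measurable_decay_kernel h g)
    (_ : measurable_fun setT (fun x : T => x - _ : T))).
  exact: measurable_funB.
apply: (@le_trans _ _ (M%:E * \int[leb n]_y (q y)%:E)%E).
  apply: (@ge0_integral_ins_prod _ _ i _
    (fun y => singular_kernel h b g (A (tuple_ins i y 0)) (a i))) => //.
  - exact: measurable_slice_kernel.
  - by move=> t; exact: slice_kernel_ge0.
  - move=> y s; rewrite /slice_kernel mulrC Ai tnth_ins; congr (_ * _).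
    by apply: eq_bigr => k _; rewrite tnth_ins_lift.
  - by move=> y; exact: measurable_singular_kernel.
  - by move=> y s; exact: singular_kernel_ge0.
  - exact: (measurable_prod_tnth mk).
  - by move=> y; apply: prodr_ge0 => k _; exact: decay_kernel_ge0.
  - by move=> y; exact: integral_singular_kernel.
rewrite EFinM; apply: lee_wpmul2l; first by rewrite lee_fin.
apply: (ge0_integral_prod_le mk) => //.
- by move=> k s; exact: decay_kernel_ge0.
- by move=> k; exact: integral_decay_kernel.
Qed.

End kernels.

(** * The radial equation *)

Section radial_profile.
Context {R : realType}.

(** The endpoints are unordered because the point where the derivative is controlled may lie on
    either side of the point of interest. *)
Lemma mean_value_bound (f df : R -> R) (a b K : R) :
  (forall x, Num.min a b <= x <= Num.max a b -> {for x, continuous f}) ->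
  (forall x, Num.min a b < x < Num.max a b ->
     is_derive x (1 : R) f (df x) /\ `|df x| <= K) ->
  `|f b - f a| <= K * `|b - a|.
Proof.
wlog ab : a b / a < b => [hw|].
  have [<- _ _|] := eqVneq a b; first by rewrite !subrr normr0 mulr0.
  rewrite neq_lt => /orP[ab|ba]; first exact: hw.
  by rewrite minC maxC distrC (distrC b); exact: hw.
rewrite minEle maxEle (ltW ab) => cf dfK.
have [||x xab ->] := @MVT R f df a b ab.
- by move=> x; rewrite in_itv/= => xab; have [] := dfK x xab.
- by apply: continuous_in_subspaceT => x; rewrite inE/= in_itv/=; exact: cf.
rewrite normrM ler_wpM2r//.
by rewrite in_itv/= in xab; have [] := dfK x xab.
Qed.

Definition conformal (s : R) : R := 2 / (1 - s ^+ 2).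

(** In dimension n = m + 2 the radial Laplacian is s^(1-n) rho^(-n) times the derivative of s^(n-1)
    rho^(n-2) F'; this is the quantity under the derivative. *)
Definition flux m (F1 : R -> R) (s : R) : R := s ^+ m.+1 * conformal s ^+ m * F1 s.

(* [F] is a radial solution on the axis, as a function of the Euclidean radius,
   and [F1] its derivative; the dimension is [m.+2]. *)
Record radial_profile m (p lam c chi1 chi2 : R) (F F1 : R -> R) : Prop := RadialProfile {
  rp_derive : forall s : R, - 1 < s < 1 -> is_derive s (1 : R) F (F1 s);
  rp_cont : forall s : R, - 1 < s < 1 -> {for s, continuous F1};
  rp_ode : forall s : R, 0 < s < 1 -> is_derive s (1 : R) (flux m F1)
     (- (s ^+ m.+1 * conformal s ^+ m.+2 * (lam * F s + F s `^ p)));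
  rp_decr : forall s t : R, 0 <= s -> s < t -> t < 1 -> F t < F s;
  rp_decay : forall s : R, 0 <= s < 1 ->
     chi1 * ((1 - s) / (1 + s)) `^ c <= F s <= chi2 * ((1 - s) / (1 + s)) `^ c }.

Lemma conformal_ge (s : R) : 0 <= s < 1 -> (1 - s)^-1 <= conformal s.
Proof.
move=> /andP[s0 s1]; have d0 : 0 < 1 - s by lra.
have d1 : 0 < 1 + s by lra.
rewrite /conformal (_ : 1 - s ^+ 2 = (1 - s) * (1 + s)); last by ring.
rewrite invfM mulrCA ler_pMr ?invr_gt0//.
by rewrite ler_pdivlMr// mul1r; lra.
Qed.

Lemma conformal_ge0 (s : R) : 0 <= s < 1 -> 0 <= conformal s.
Proof.
move=> s01; apply: le_trans (conformal_ge s01).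
by rewrite invr_ge0; move: s01 => /andP[? ?]; lra.
Qed.

Lemma conformal_le (s d : R) : 0 <= s < 1 -> 0 < d -> d <= 1 - s -> conformal s <= 2 / d.
Proof.
move=> /andP[s0 s1] d0 ds; rewrite /conformal ler_wpM2l// lef_pV2 ?posrE//; nra.
Qed.

Lemma is_derive_continuous (f : R -> R) (x d : R) :
  is_derive x (1 : R) f d -> {for x, continuous f}.
Proof. by move=> [df _]; apply/differentiable_continuous/derivable1_diffP. Qed.

Section estimates.
Variables (m : nat) (p lam c chi1 chi2 : R).
Hypotheses (p1 : 1 < p) (c0 : 0 < c) (chi10 : 0 < chi1) (chi20 : 0 < chi2).

Let B0 : R := `|lam| * chi2 + chi2 `^ p.

Let B0_ge0 : 0 <= B0.
Proof. by rewrite addr_ge0 ?powR_ge0// mulr_ge0// ltW. Qed.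

Lemma profile_ge0 F F1 s : radial_profile m p lam c chi1 chi2 F F1 ->
  0 <= s < 1 -> 0 <= F s.
Proof.
move=> P s01; have /andP[h _] := rp_decay P s01.
by apply: le_trans h; rewrite mulr_ge0 ?powR_ge0// ltW.
Qed.

Lemma profile_le F F1 s d : radial_profile m p lam c chi1 chi2 F F1 ->
  0 <= s < 1 -> 1 - s <= d -> F s <= chi2 * d `^ c.
Proof.
move=> P s01 sd; have /andP[_ h] := rp_decay P s01.
move: s01 => /andP[s0 s1].
apply: (le_trans h); rewrite ler_wpM2l ?(ltW chi20)//.
apply: ge0_ler_powR; rewrite ?nnegrE ?(ltW c0)//; last first.
- by apply: le_trans sd; rewrite ler_pdivrMr ?ler_peMr; lra.
- lra.
- by rewrite divr_ge0; lra.
Qed.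

Lemma profile_derive_le0 F F1 s : radial_profile m p lam c chi1 chi2 F F1 ->
  0 < s < 1 -> F1 s <= 0.
Proof.
move=> P /andP[s0 s1].
have dF : is_derive s (1 : R) F (F1 s) by apply: (rp_derive P); lra.
have [_ <-] := dF; rewrite -derive1E.
apply: (@decr_derive1_le0_itv _ F false true 0 1); last by rewrite in_itv/= s0.
- move=> x; rewrite ?inE/= in_itv/= => /andP[x0 x1].
  by have [|] := rp_derive P (s := x); first lra.
- move=> x y; rewrite !in_itv/= => /andP[x0 x1] /andP[y0 y1] xy.
  by apply: (rp_decr P) => //; lra.
Qed.

(** As 1 - s <= 1 and p > 1, the nonlinear term, of order (1 - s)^(c p), is dominated by (1 - s)^c
    like the linear one. *)
Lemma profile_source_le F F1 s d :
  radial_profile m p lam c chi1 chi2 F F1 ->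
  0 <= s < 1 -> 1 - s <= d -> `|lam * F s + F s `^ p| <= B0 * d `^ c.
Proof.
move=> P s01 sd.
have F0 := profile_ge0 P s01.
apply: (le_trans (ler_normD _ _)); rewrite mulrDl; apply: lerD.
  rewrite normrM (ger0_norm F0) -mulrA ler_wpM2l//.
  exact: (profile_le P).
rewrite ger0_norm ?powR_ge0//.
have Fs := profile_le P s01 (lexx _).
have s1 : 0 < 1 - s <= 1 by move: s01 => /andP[? ?]; lra.
apply: (@le_trans _ _ ((chi2 * (1 - s) `^ c) `^ p)).
  apply: ge0_ler_powR; rewrite ?nnegrE ?(ltW (lt_trans ltr01 p1))//.
  by rewrite mulr_ge0 ?powR_ge0// ltW.
rewrite powRM ?powR_ge0 ?(ltW chi20)// ler_wpM2l ?powR_ge0//.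
rewrite -powRrM; apply: (@le_trans _ _ ((1 - s) `^ c)).
  by apply: ger_powR => //; rewrite ler_peMr ?(ltW p1)// ltW.
have [d1 d2] := andP s1.
by apply: ge0_ler_powR; rewrite ?nnegrE ?(ltW c0) ?(ltW d1) ?(le_trans (ltW d1) sd).
Qed.

(** Two distances occur because the conformal factor requires 1 - s to be bounded below and the
    source term requires it to be bounded above. *)
Lemma flux_slope_le F F1 s d d' K :
  radial_profile m p lam c chi1 chi2 F F1 ->
  0 <= s < 1 -> 0 < d -> d <= 1 - s -> 1 - s <= d' -> (2 / d) ^+ m.+2 <= K ->
  `|- (s ^+ m.+1 * conformal s ^+ m.+2 * (lam * F s + F s `^ p))| <=
    s ^+ m.+1 * K * (B0 * d' `^ c).
Proof.
move=> P s01 d0 ds sd' dK.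
have s0 : 0 <= s by move: s01 => /andP[].
rewrite normrN normrM; apply: ler_pM => //; last exact: (profile_source_le P).
rewrite normrM !normrX (ger0_norm s0) (ger0_norm (conformal_ge0 s01)).
rewrite ler_wpM2l ?exprn_ge0//; apply: le_trans dK.
rewrite lerXn2r ?nnegrE ?conformal_ge0//.
  by rewrite divr_ge0 // ltW.
exact: conformal_le.
Qed.

Lemma flux_continuous F F1 s : radial_profile m p lam c chi1 chi2 F F1 ->
  - 1 < s < 1 -> {for s, continuous (flux m F1)}.
Proof.
move=> P s1.
have d0 : 1 - s ^+ 2 != 0 by rewrite gt_eqF//; nra.
have cc : {for s, continuous conformal}.
  apply: continuousM; first exact: cst_continuous.
  apply: continuousV => //; apply: continuousB; first exact: cst_continuous.
  exact: exprn_continuous.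
apply: continuousM; last exact: (rp_cont P).
apply: continuousM; first exact: exprn_continuous.
apply: (@continuous_comp _ _ _ conformal (fun x => x ^+ m)) => //.
exact: exprn_continuous.
Qed.

End estimates.
End radial_profile.

(* Near the boundary the mean value theorem on a segment of length comparable
   to [1 - s] gives one point where [F1] is controlled, and the flux equation
   carries the bound back to [s]. *)
Lemma profile_derive_ub (R : realType) (m : nat) (p lam c chi1 chi2 : R) :
  1 < p -> 0 < c -> 0 < chi1 -> 0 < chi2 -> exists2 C : R, 0 < C &
  forall F F1, radial_profile m p lam c chi1 chi2 F F1 ->
  forall s, 0 < s < 1 -> - F1 s * (1 - s) <= C * (1 - s) `^ c.
Proof.
move=> p1 c0 chi10 chi20.
have [B0 B0E] : {x : R | x = `|lam| * chi2 + chi2 `^ p} by eexists.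
have B0_ge0 : 0 <= B0 by rewrite B0E addr_ge0 ?powR_ge0// mulr_ge0// ltW.
have [k2 k2E] : {k2 : R | k2 = 4 ^+ m.+2} by exists (4 ^+ m.+2).
have k20 : 0 < k2 by rewrite k2E exprn_gt0.
have k20' := ltW k20.
have [h hE] : {h : R | h = (1 / 2) ^+ m.+1} by eexists.
have h0 : 0 < h by rewrite hE exprn_gt0// divr_gt0.
pose C1 : R := (4 ^+ m * (2 * chi2) + k2 * B0 / 2) / h.
pose C2 : R := k2 * B0 * 2 `^ c.
have C10 : 0 < C1.
  apply: divr_gt0 => //; apply: ltr_pwDl; first by rewrite !mulr_gt0 ?exprn_gt0.
  by apply: divr_ge0 => //; exact: mulr_ge0.
have C20 : 0 <= C2 by apply: mulr_ge0; [exact: mulr_ge0|exact: powR_ge0].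
exists (C1 + C2); first exact: ltr_wpDr.
move=> F F1 P s /andP[s0 s1].
have Ps : 0 <= - F1 s by rewrite oppr_ge0; apply: (profile_derive_le0 P); lra.
(* Near the centre the weight s^(m+1) degenerates. There the flux is compared with its value 0 at
   the origin: its slope carries the same power of s, which therefore cancels. *)
have [sh|hs] := ltP s (1 / 2).
  apply: (@le_trans _ _ (C2 * (1 - s) `^ c)); last first.
    by rewrite ler_wpM2r ?powR_ge0// lerDr ltW.
  have mv : `|flux m F1 s - flux m F1 0| <= (s ^+ m.+1 * k2 * B0) * `|s - 0|.
    apply: (@mean_value_bound _ _ (fun s => - (s ^+ m.+1 * conformal s ^+ m.+2 * (lam * F s + F s `^ p)))).
      rewrite minEle maxEle (ltW s0) => x /andP[x0 x1].
      by apply: (flux_continuous P); lra.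
    rewrite minEle maxEle (ltW s0) => x /andP[x0 x1].
    split; first by apply: (rp_ode P); lra.
    have x01 : 0 <= x < 1 by lra.
    apply: (le_trans (@flux_slope_le _ m p lam c chi1 chi2 p1 c0 chi10 chi20 _ _ x (1 / 2) 1 k2 P x01 _ _ _ _)); [lra|lra|lra| |].
      by rewrite (_ : 2 / (1 / 2) = 4) ?k2E//; lra.
    rewrite -B0E powR1 mulr1; apply: ler_wpM2r => //; apply: ler_wpM2r => //.
    by rewrite lerXn2r ?nnegrE//; lra.
  have f0 : flux m F1 0 = 0 by rewrite /flux exprS mul0r !mul0r.
  rewrite f0 !subr0 (ger0_norm (ltW s0)) in mv.
  have {}mv : - flux m F1 s <= s ^+ m.+1 * k2 * B0 * s.
    by apply: le_trans mv; rewrite ler_normr lexx orbT.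
  have lo : s ^+ m.+1 * (- F1 s) <= - flux m F1 s.
    rewrite /flux -mulrN ler_wpM2r// ler_peMr ?exprn_ge0 ?(ltW s0)//.
    rewrite exprn_ege1//; apply: le_trans (conformal_ge (s := s) _); last lra.
    by rewrite invf_ge1; lra.
  have : - F1 s <= k2 * B0 * s.
    rewrite -(@ler_pM2l _ (s ^+ m.+1)) ?exprn_gt0//.
    by apply: (le_trans lo); apply: (le_trans mv); rewrite -!mulrA.
  move=> F1s; apply: (@le_trans _ _ (- F1 s)).
    by rewrite ler_piMr//; lra.
  apply: (le_trans F1s); rewrite /C2 -!mulrA.
  apply: (@ler_wpM2l _ k2) => //; apply: (@ler_wpM2l _ B0) => //.
  (* Away from the boundary (1 - s)^c is at least 2^(-c), which explains the factor 2^c in [C2]. *)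
  apply: (@le_trans _ _ 1); first lra.
  apply: (@le_trans _ _ ((2 * (1 / 2)) `^ c)).
    by rewrite (_ : 2 * (1 / 2) = 1) ?powR1//; lra.
  rewrite powRM; [|lra|lra]; rewrite ler_wpM2l ?powR_ge0//.
  by apply: ge0_ler_powR; rewrite ?nnegrE ?(ltW c0)//; lra.
apply: (@le_trans _ _ (C1 * (1 - s) `^ c)); last first.
  by rewrite ler_wpM2r ?powR_ge0// lerDl.
have [d dE] : {d : R | d = 1 - s} by eexists.
have [E EE] : {E : R | E = d `^ c} by eexists.
have d0 : 0 < d by rewrite dE subr_gt0.
have dh : d <= 1 / 2 by clear -dE hs; lra.
have E0 : 0 <= E by rewrite EE powR_ge0.
rewrite -dE -EE.
(* Halfway to the boundary: between [s] and [s'] the distance to 1 stays between d / 2 and d, while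
   [F] drops by at most [F s], so the slope at some [xi] is at most of order d^(c-1). *)
have [s' s'E] : {s' : R | s' = s + d / 2} by eexists.
have ss' : s < s' by clear -s'E d0; lra.
have s'1 : s' < 1 by clear -s'E dE d0; lra.
have [||xi] := @MVT R F F1 s s' ss'.
- move=> x; rewrite in_itv/= => /andP[x0 x1]; apply: (rp_derive P); clear -x0 x1 s0 s'1; lra.
- apply: continuous_in_subspaceT => x; rewrite inE/= in_itv/= => /andP[x0 x1].
  by apply: is_derive_continuous; apply: (rp_derive P); clear -x0 x1 s0 s'1; lra.
rewrite in_itv/= => /andP[sxi xis'].
rewrite (_ : s' - s = d / 2); last by rewrite s'E; ring.
move=> mvF.
have xi1 : xi < 1 by apply: lt_trans s'1.
have dxi : d / 2 <= 1 - xi by clear -xis' s'E dE; lra.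
have dxi' : 1 - xi <= d by clear -sxi dE; lra.
have s01 : 0 <= s < 1 by rewrite ltW.
have xi0 : 0 < xi by exact: lt_trans sxi.
have xi01 : 0 <= xi < 1 by rewrite ltW.
have Fs : F s <= chi2 * E by rewrite EE; apply: (@profile_le _ m p lam c chi1 chi2 c0 chi20 F F1 s d P) => //; rewrite dE.
have Fs' : 0 <= F s' by apply: (profile_ge0 chi10 P); rewrite s'1 ltW// (lt_trans s0).
have xiub : - F1 xi * d <= 2 * chi2 * E by move: mvF Fs Fs'; clear; lra.
have Pxi : 0 <= - F1 xi by rewrite oppr_ge0; apply: (profile_derive_le0 P); rewrite xi0.
have D0 : 0 < d ^+ m by rewrite exprn_gt0.
have [K K'E] : {K : R | K = k2 / (d ^+ m * d * d)} by eexists.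
have KE : (2 / (d / 2)) ^+ m.+2 = K.
  rewrite (_ : 2 / (d / 2) = 4 / d); last by field; rewrite gt_eqF.
  by rewrite expr_div_n -k2E K'E !(exprSr d).
have K0 : 0 <= K by rewrite K'E divr_ge0// !mulr_ge0 ?(ltW D0) ?(ltW d0).
have mv : `|flux m F1 xi - flux m F1 s| <= (K * (B0 * E)) * `|xi - s|.
  apply: (@mean_value_bound _ _ (fun s => - (s ^+ m.+1 * conformal s ^+ m.+2 * (lam * F s + F s `^ p)))).
    rewrite minEle maxEle (ltW sxi) => x /andP[x0 x1].
    by apply: (flux_continuous P); clear -x0 x1 s0 xi1; lra.
  rewrite minEle maxEle (ltW sxi) => x /andP[x0 x1].
  split; first by apply: (rp_ode P); clear -x0 x1 s0 xi1; lra.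
  have x01 : 0 <= x < 1 by clear -x0 x1 s0 xi1; lra.
  apply: (le_trans (@flux_slope_le _ m p lam c chi1 chi2 p1 c0 chi10 chi20 _ _ x (d / 2) d K P x01 _ _ _ _)); [|clear -x1 dxi; lra|clear -x0 dE; lra| |].
  - by rewrite divr_gt0.
  - by rewrite KE.
  rewrite -B0E -EE; apply: ler_wpM2r; first exact: mulr_ge0.
  by rewrite ler_piMl// exprn_ile1//; case/andP: x01 => // _ /ltW.
have lo : h * (- F1 s) / d ^+ m <= - flux m F1 s.
  have hA : h <= s ^+ m.+1 by rewrite hE lerXn2r ?nnegrE ?divr_ge0// ltW.
  have hB : (d ^+ m)^-1 <= conformal s ^+ m.
    rewrite -exprVn lerXn2r ?nnegrE ?conformal_ge0 ?invr_ge0 ?(ltW d0)//.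
    by rewrite dE; exact: conformal_ge.
  rewrite /flux -mulrN mulrAC; apply: ler_wpM2r => //; apply: ler_pM => //.
    exact: ltW.
  by rewrite invr_ge0 ltW.
have hi : - flux m F1 xi <= (4 / d) ^+ m * (- F1 xi).
  have hA : xi ^+ m.+1 <= 1 by rewrite exprn_ile1// ltW.
  have hB : conformal xi ^+ m <= (4 / d) ^+ m.
    rewrite lerXn2r ?nnegrE ?conformal_ge0//.
      by rewrite divr_ge0// ltW.
    rewrite (_ : 4 / d = 2 / (d / 2)); last by field; rewrite gt_eqF.
    by apply: conformal_le => //; rewrite divr_gt0.
  have cxi : 0 <= conformal xi ^+ m by rewrite exprn_ge0// conformal_ge0.
  rewrite /flux -mulrN; apply: ler_wpM2r => //; rewrite -[leRHS]mul1r.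
  by apply: ler_pM => //; rewrite exprn_ge0// ltW.
have df : flux m F1 xi - flux m F1 s <= (K * (B0 * E)) * (d / 2).
  apply: (le_trans (ler_norm _)); apply: (le_trans mv).
  apply: ler_wpM2l; first by rewrite mulr_ge0// mulr_ge0.
  by rewrite ger0_norm ?subr_ge0 ?(ltW sxi)// lerBlDl -s'E ltW.
have key : h * (- F1 s) / d ^+ m <=
   (4 / d) ^+ m * (- F1 xi) + (K * (B0 * E)) * (d / 2).
  by move: lo hi df; clear; lra.
(* Multiplying by d^(m+1) removes every negative power of d, and all terms become of order d^c. *)
have key2 : h * (- F1 s) * d <= 4 ^+ m * (- F1 xi * d) + k2 * B0 / 2 * E.
  have := key; rewrite -(@ler_pM2r _ (d ^+ m * d)); last by rewrite mulr_gt0.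
  congr (_ <= _).
    by field; rewrite gt_eqF.
  by rewrite expr_div_n K'E; field; rewrite !gt_eqF.
rewrite -(@ler_pM2l _ h)// /C1.
apply: (@le_trans _ _ (h * (- F1 s) * d)); first by rewrite mulrA.
apply: (le_trans key2).
have -> : h * ((4 ^+ m * (2 * chi2) + k2 * B0 / 2) / h * E) =
   4 ^+ m * (2 * chi2 * E) + k2 * B0 / 2 * E.
  by field; rewrite gt_eqF.
by rewrite lerD2r ler_wpM2l ?exprn_ge0.
Qed.

(* [eta] is so small that the two-sided decay forces [F] to drop by a fixed
   proportion between [s0] and [1 - eta (1 - s0)]. *)
Lemma profile_derive_lb (R : realType) (m : nat) (p lam c chi1 chi2 : R) :
  1 < p -> 0 < c -> 0 < chi1 -> 0 < chi2 -> exists eta eps a : R,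
  [/\ 0 < eta <= 1 / 2, 0 < eps <= eta / 2, 0 < a &
  forall F F1, radial_profile m p lam c chi1 chi2 F F1 ->
  forall s0, 1 / 2 <= s0 < 1 -> exists xi : R,
    [/\ s0 < xi, eta * (1 - s0) <= 1 - xi &
     forall s, `|s - xi| <= eps * (1 - s0) ->
       a * (1 - s0) `^ c <= - F1 s * (1 - s0)]].
Proof.
move=> p1 c0 chi10 chi20.
have [k2 k2E] : {k2 : R | k2 = 4 ^+ m.+2} by exists (4 ^+ m.+2).
have k20 : 0 < k2 by rewrite k2E exprn_gt0.
have [B0 B0E] : {x : R | x = `|lam| * chi2 + chi2 `^ p} by eexists.
have B00 : 0 < B0.
  by rewrite B0E; apply: ltr_wpDl; [rewrite mulr_ge0// ltW|exact: powR_gt0].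
(* With eta^c <= [q], the upper decay bound at [s1] is at most half the lower decay bound at [s0];
   the other half is [a0]. *)
have [q qE] : {x : R | x = chi1 * (1 / 2) `^ c / (2 * chi2)} by eexists.
have q0 : 0 < q by rewrite qE divr_gt0 ?mulr_gt0 ?powR_gt0.
have [eta etaE] : {x : R | x = Num.min (1 / 2) (q `^ c^-1)} by eexists.
have eta0 : 0 < eta by rewrite etaE lt_min powR_gt0// andbT divr_gt0.
have etah : eta <= 1 / 2 by rewrite etaE ge_min lexx.
have etaq : chi2 * eta `^ c <= chi1 * (1 / 2) `^ c / 2.
  have : eta `^ c <= q.
    rewrite -[leRHS]powRr1 ?(ltW q0)// -(mulVf (lt0r_neq0 c0)) powRrM.
    apply: ge0_ler_powR; rewrite ?nnegrE ?(ltW c0) ?powR_ge0 ?(ltW eta0)//.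
    by rewrite etaE ge_min lexx orbT.
  move=> h; apply: (@le_trans _ _ (chi2 * q)); first by rewrite ler_pM2l.
  by rewrite le_eqVlt qE; apply/orP; left; apply/eqP; field; rewrite gt_eqF.
have [a0 a0E] : {x : R | x = chi1 * (1 / 2) `^ c / 2} by eexists.
have a00 : 0 < a0 by rewrite a0E divr_gt0// mulr_gt0// powR_gt0 divr_gt0.
have [e2 e2E] : {e2 : R | e2 = eta ^+ m.+2} by exists (eta ^+ m.+2).
have e20 : 0 < e2 by rewrite e2E exprn_gt0.
have [h hE] : {x : R | x = (1 / 2) ^+ m.+1} by eexists.
have h0 : 0 < h by rewrite hE exprn_gt0// divr_gt0.
have [M ME] : {x : R | x = k2 / e2 * (B0 * 2 `^ c)} by eexists.
have M0 : 0 < M by rewrite ME mulr_gt0 ?divr_gt0 ?mulr_gt0 ?powR_gt0.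
(* The first bound keeps the interval around [xi] at distance at least eta d / 2 from the boundary.
   The second makes the variation of the flux there at most half of its lower bound at [xi]; [M] is
   the slope of the flux in units of d. *)
have [eps epsE] : {x : R | x = Num.min (eta / 2) (h * a0 / 2 / M)} by eexists.
have ha0 : 0 < h * a0 by rewrite mulr_gt0.
have eps0 : 0 < eps by rewrite epsE lt_min divr_gt0//= divr_gt0// divr_gt0.
have epse : eps <= eta / 2 by rewrite epsE ge_min lexx.
have epsM : eps * M <= h * a0 / 2.
  by rewrite -ler_pdivlMr// epsE ge_min lexx orbT.
(* At distance at least eta d / 2 from the boundary the conformal factor is at most (4 / eta) / d,
   so [r / d ^+ m] converts the derivative into the flux. *)
have [r rE] : {x : R | x = (4 / eta) ^+ m} by eexists.
have r0 : 0 < r by rewrite rE exprn_gt0// divr_gt0.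
exists eta, eps, (h * a0 / 2 / r); split.
- by rewrite eta0.
- by rewrite eps0.
- by rewrite !divr_gt0.
move=> F F1 P s0 /andP[s0h s01].
have [d dE] : {x : R | x = 1 - s0} by eexists.
have [E EE] : {x : R | x = d `^ c} by eexists.
have d0 : 0 < d by rewrite dE subr_gt0.
have dh : d <= 1 / 2 by clear -dE s0h; lra.
have E0 : 0 <= E by rewrite EE powR_ge0.
rewrite -dE -EE.
have [s1 s1E] : {x : R | x = 1 - eta * d} by eexists.
have ed : eta * d <= d / 2 by clear -etah d0; nra.
have ed0 : 0 < eta * d by rewrite mulr_gt0.
have s0s1 : s0 < s1 by clear -s1E dE ed d0; lra.
have s11 : s1 < 1 by clear -s1E ed0; lra.
have [||xi] := @MVT R F F1 s0 s1 s0s1.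
- move=> x; rewrite in_itv/= => /andP[x0 x1]; apply: (rp_derive P).
  by clear -x0 x1 s0h s11; lra.
- apply: continuous_in_subspaceT => x; rewrite inE/= in_itv/= => /andP[x0 x1].
  by apply: is_derive_continuous; apply: (rp_derive P); clear -x0 x1 s0h s11; lra.
rewrite in_itv/= => /andP[s0xi xis1] mvF.
have xi1 : xi < 1 by apply: lt_trans s11.
have xid : eta * d <= 1 - xi by clear -xis1 s1E; lra.
have Fs0 : chi1 * (1 / 2) `^ c * E <= F s0.
  have s01' : 0 <= s0 < 1 by clear -s0h s01; lra.
  have /andP[+ _] := rp_decay P s01'; apply: le_trans.
  rewrite -mulrA; apply: ler_wpM2l; first exact: ltW.
  have s0p : 0 < 1 + s0 by clear -s0h; lra.
  rewrite EE -powRM ?(ltW d0)//.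
  apply: ge0_ler_powR; rewrite ?nnegrE ?(ltW c0)//.
  - by rewrite mulr_ge0// ltW.
  - by rewrite -dE divr_ge0// ltW.
- by rewrite mulrC -dE ler_pM2l// div1r lef_pV2 ?posrE//; clear -s01; lra.
have Fs1 : F s1 <= a0 * E.
  have := @profile_le _ m p lam c chi1 chi2 c0 chi20 F F1 s1 (eta * d) P.
  move=> /(_ _ _)/le_trans; apply.
  - by clear -s0s1 s11 s0h; lra.
  - by rewrite s1E opprB addrC subrK.
  rewrite EE a0E.
  by rewrite powRM ?(ltW eta0) ?(ltW d0)// mulrA; apply: ler_wpM2r => //; exact: powR_ge0.
have Pxi : 0 <= - F1 xi.
  by rewrite oppr_ge0; apply: (profile_derive_le0 P); clear -s0h s0xi xi1; lra.
have xilb : a0 * E <= - F1 xi * d.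
  apply: (@le_trans _ _ (- F1 xi * (s1 - s0))).
    by rewrite mulNr -mvF; move: Fs0 Fs1; rewrite a0E; clear; lra.
  by apply: ler_wpM2l => //; clear -s1E dE ed0; lra.
have epsd : eps * d <= eta * d / 2.
  by rewrite mulrAC; apply: ler_wpM2r => //; exact: ltW.
exists xi; split => // s sxi.
have := sxi; rewrite ler_norml => /andP[sl su].
have s14 : 1 / 4 <= s by clear -dE ed epsd sl s0xi s0h dh; lra.
have sd : eta * d / 2 <= 1 - s by clear -epsd su xid; lra.
have s1' : s < 1 by clear -sd ed0; lra.
have sd' : 1 - s <= 2 * d by clear -dE ed epsd sl s0xi d0; lra.
have xid' : 1 - xi <= d by clear -dE s0xi; lra.
have xi14 : 1 / 4 <= xi by clear -s0h s0xi; lra.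
have xid2 : eta * d / 2 <= 1 - xi by clear -xid ed0; lra.
have Ps : 0 <= - F1 s.
  by rewrite oppr_ge0; apply: (profile_derive_le0 P); clear -s14 s1'; lra.
have D0 : 0 < d ^+ m by rewrite exprn_gt0.
have [K K'E] : {x : R | x = k2 / e2 / (d ^+ m * d * d)} by eexists.
have KE : (2 / (eta * d / 2)) ^+ m.+2 = K.
  rewrite (_ : 2 / (eta * d / 2) = 4 / eta / d); last by field; rewrite !gt_eqF.
  by rewrite !expr_div_n -k2E -e2E K'E !(exprSr d).
have K0 : 0 <= K by rewrite K'E !divr_ge0 ?mulr_ge0 ?(ltW D0) ?(ltW d0) ?(ltW k20) ?(ltW e20).
have mv : `|flux m F1 s - flux m F1 xi| <= (K * (B0 * (2 * d) `^ c)) * `|s - xi|.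
  have inb x : Num.min xi s <= x <= Num.max xi s ->
      [/\ 1 / 4 <= x, x < 1, eta * d / 2 <= 1 - x & 1 - x <= 2 * d].
    rewrite ge_min le_max => /andP[/orP xl /orP xu].
    have [x14 xd'] : 1 / 4 <= x /\ 1 - x <= 2 * d.
      by clear -xl s14 xi14 sd' xid' d0; case: xl; lra.
    have [x1 xd] : x < 1 /\ eta * d / 2 <= 1 - x.
      by clear -xu s1' xi1 sd xid2; case: xu; lra.
    by split.
  apply: (@mean_value_bound _ _ (fun s => - (s ^+ m.+1 * conformal s ^+ m.+2 * (lam * F s + F s `^ p)))).
    by move=> x /inb[x0 x1 _ _]; apply: (flux_continuous P); clear -x0 x1; lra.
  move=> x /andP[x0 x1].
  have [y1 y2 y3 y4] : [/\ 1 / 4 <= x, x < 1, eta * d / 2 <= 1 - x & 1 - x <= 2 * d].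
    by apply: inb; rewrite !ltW.
  split; first by apply: (rp_ode P); clear -y1 y2; lra.
  have x01 : 0 <= x < 1 by clear -y1 y2; lra.
  apply: (le_trans (@flux_slope_le _ m p lam c chi1 chi2 p1 c0 chi10 chi20 F F1 x (eta * d / 2) (2 * d) K P x01 _ _ _ _)) => //.
  - by rewrite divr_gt0.
  - by rewrite KE.
  rewrite -B0E.
  apply: ler_wpM2r; first by rewrite mulr_ge0 ?powR_ge0 ?(ltW B00).
  by apply: ler_piMl => //; rewrite exprn_ile1//; case/andP: x01 => // _ /ltW.
have lo : h * (- F1 xi) / d ^+ m <= - flux m F1 xi.
  have hA : h <= xi ^+ m.+1 by rewrite hE lerXn2r ?nnegrE ?divr_ge0//; clear -s0h s0xi; lra.
  have xi01 : 0 <= xi < 1 by clear -xi14 xi1; lra.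
  have hB : (d ^+ m)^-1 <= conformal xi ^+ m.
    rewrite -exprVn lerXn2r ?nnegrE ?conformal_ge0 ?invr_ge0 ?(ltW d0)//.
    apply: (@le_trans _ _ (1 - xi)^-1); last exact: conformal_ge.
    by rewrite lef_pV2 ?posrE// subr_gt0.
  rewrite /flux -mulrN mulrAC; apply: ler_wpM2r => //; apply: ler_pM => //.
    exact: ltW.
  by rewrite invr_ge0 ltW.
have hi : - flux m F1 s <= r / d ^+ m * (- F1 s).
  have s0' : 0 <= s by clear -s14; lra.
  have hA : s ^+ m.+1 <= 1 by rewrite exprn_ile1// ltW.
  have s01' : 0 <= s < 1 by rewrite s0'.
  have hB : conformal s ^+ m <= r / d ^+ m.
    rewrite rE -expr_div_n lerXn2r ?nnegrE ?conformal_ge0//.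
      by rewrite !divr_ge0// ltW.
    rewrite (_ : 4 / eta / d = 2 / (eta * d / 2)); last by field; rewrite !gt_eqF.
    by apply: conformal_le => //; rewrite divr_gt0.
  have cs : 0 <= conformal s ^+ m by rewrite exprn_ge0// conformal_ge0.
  rewrite /flux -mulrN; apply: ler_wpM2r => //; rewrite -[leRHS]mul1r.
  by apply: ler_pM => //; exact: exprn_ge0.
have df : flux m F1 s - flux m F1 xi <= (K * (B0 * (2 `^ c * E))) * (eps * d).
  apply: (le_trans (ler_norm _)); apply: (le_trans mv).
  rewrite powRM ?(ltW d0)// -EE.
  apply: ler_wpM2l; first by rewrite mulr_ge0// mulr_ge0 ?(ltW B00)// mulr_ge0 ?powR_ge0.
  exact: sxi.
have key : h * (- F1 xi) / d ^+ m <=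
   r / d ^+ m * (- F1 s) + (K * (B0 * (2 `^ c * E))) * (eps * d).
  by clear -lo hi df; lra.
have key2 : h * (- F1 xi * d) <= r * (- F1 s * d) + eps * M * E.
  have := key; rewrite -(@ler_pM2r _ (d ^+ m * d)); last by rewrite mulr_gt0.
  congr (_ <= _).
    by field; rewrite gt_eqF.
  by rewrite K'E ME; field; rewrite !gt_eqF.
have key3 : h * (a0 * E) <= r * (- F1 s * d) + h * a0 / 2 * E.
  apply: (@le_trans _ _ (h * (- F1 xi * d))); first by rewrite ler_pM2l.
  by apply: (le_trans key2); rewrite lerD2l; apply: ler_wpM2r.
rewrite -(@ler_pM2l _ r)//.
have -> : r * (h * a0 / 2 / r * E) = h * a0 / 2 * E by field; rewrite gt_eqF.
by clear -key3; lra.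
Qed.

(** * From radial functions to the radial equation *)

Section euclidean.
Context {R : realType} {n : nat}.
Implicit Types (x y z : 'rV[R]_n).

Lemma enorm_ge0 x : 0 <= enorm x.
Proof. exact: sqrtr_ge0. Qed.

Lemma sqr_enorm x : enorm x ^+ 2 = \sum_(i < n) x 0 i ^+ 2.
Proof. by rewrite sqr_sqrtr// sumr_ge0// => i _; exact: sqr_ge0. Qed.

Lemma enormE x : enorm x = Num.sqrt (\sum_(i < n) x 0 i ^+ 2).
Proof. by []. Qed.

Lemma enorm_sum_delta x (i : 'I_n) (t : R) :
  \sum_(k < n) (x + t *: delta_mx 0 i) 0 k ^+ 2 =
  \sum_(k < n) x 0 k ^+ 2 + 2 * t * x 0 i + t ^+ 2.
Proof.
rewrite (bigD1 i)//= [X in _ = X + _ + _](bigD1 i)//=.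
rewrite !mxE !eqxx mulr1.
under eq_bigr => k ki do rewrite !mxE (negbTE ki) andbF mulr0 addr0.
by ring.
Qed.

Lemma enorm_axis (j : 'I_n) (s : R) : enorm (s *: delta_mx 0 j : 'rV[R]_n) = `|s|.
Proof.
rewrite -[s *: _]add0r enormE enorm_sum_delta !mxE mulr0 addr0.
by rewrite big1 ?add0r ?sqrtr_sqr// => k _; rewrite mxE expr0n.
Qed.

Lemma enorm0_eq0 x : enorm x = 0 -> x = 0.
Proof.
move=> x0; have := sqr_enorm x; rewrite x0 expr0n/= => /esym/eqP.
rewrite psumr_eq0 => [/allP h|i _]; last exact: sqr_ge0.
apply/rowP => i; rewrite mxE; have := h i (mem_index_enum _).
by rewrite sqrf_eq0 => /eqP.
Qed.

Lemma hball_sqr x : hball x <-> \sum_(i < n) x 0 i ^+ 2 < 1.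
Proof.
rewrite /hball/= -sqr_enorm; split => h.
  by rewrite expr_lt1// enorm_ge0.
by rewrite expr_lt1// ?enorm_ge0 in h.
Qed.

Lemma derive_line (f : 'rV[R]_n -> R) (x v : 'rV[R]_n) (s : R) :
  'D_v f (x + s *: v) = 'D_1 (fun t : R => f (x + t *: v)) s.
Proof.
have E : (fun h : R => h^-1 *: (f (h *: v + (x + s *: v)) - f (x + s *: v))) =
         (fun h : R => h^-1 *: (f (x + (h *: (1 : R) + s) *: v) - f (x + s *: v))).
  by apply/funext => h; rewrite scalerDl addrCA [h *: 1]mulr1.
by rewrite /derive /= E.
Qed.

Lemma is_derive_line (f : 'rV[R]_n -> R) (x v : 'rV[R]_n) (s : R) :
  derivable f (x + s *: v) v ->
  is_derive s (1 : R) (fun t : R => f (x + t *: v)) ('D_v f (x + s *: v)).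
Proof.
have E : (fun h : R => h^-1 *: (f (h *: v + (x + s *: v)) - f (x + s *: v))) =
         (fun h : R => h^-1 *: (f (x + (h *: (1 : R) + s) *: v) - f (x + s *: v))).
  by apply/funext => h; rewrite scalerDl addrCA [h *: 1]mulr1.
move=> df; split; last by rewrite derive_line.
by move: df; rewrite /derivable /= E.
Qed.

End euclidean.

Section radial_functions.
Context {R : realType} {n : nat} (j : 'I_n) (u : R -> R).
Local Notation U := (radial_at u 0 : 'rV[R]_n -> R).
Local Notation e := (delta_mx 0 j : 'rV[R]_n).

(** Along a whole coordinate axis, signed radii included, the profile inherits the regularity of [U]
    at the centre as well; nothing is assumed about the differentiability of [u]. *)
Definition axis_profile (s : R) : R := U (s *: e).
Definition axis_derivative (s : R) : R := partial j U (s *: e).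
Local Notation F := axis_profile.
Local Notation F1 := axis_derivative.

Hypothesis CU : Ck 2 hball U.

Lemma hball_axis (s : R) : - 1 < s < 1 -> hball (s *: e).
Proof. by move=> s1; rewrite /hball/= enorm_axis ltr_norml. Qed.

Lemma radial_axis x : U x = F (enorm x).
Proof.
rewrite /F /radial_at /hdist !subr0 enorm_axis ger0_norm//.
exact: enorm_ge0.
Qed.

Lemma axis_derive (s : R) : - 1 < s < 1 -> is_derive s (1 : R) F (F1 s).
Proof.
move=> s1; have [_ /(_ j)[dU _]] := CU.
have := @is_derive_line R n U 0 e s; rewrite add0r => /(_ (dU _ (hball_axis s1))).
by under eq_fun do rewrite add0r.
Qed.

Lemma axis_profile_even (s : R) : F (- s) = F s.
Proof. by rewrite /F !radial_axis !enorm_axis normrN. Qed.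

(** The profile is even along the axis. *)
Lemma axis_derivative0 : F1 0 = 0.
Proof.
have d0 := @axis_derive 0 ltac:(lra).
have dN : is_derive (0 : R) (1 : R) (-%R : R -> R) (- 1) by exact: is_deriveNid.
have d0' : is_derive (- (0 : R)) (1 : R) F (F1 0) by rewrite oppr0.
have dc := @is_derive1_comp _ F (-%R) 0 _ _ d0' dN.
have FN : F \o -%R = F by apply/funext => s /=; rewrite axis_profile_even.
rewrite FN in dc; have [_ h] := dc; have [_ h'] := d0.
by move: h; rewrite h' mulrN1; lra.
Qed.

Lemma enorm_line_derive x (i : 'I_n) : x != 0 ->
  is_derive (0 : R) (1 : R) (fun t : R => enorm (x + t *: delta_mx 0 i)) (x 0 i / enorm x).
Proof.
move=> x0; set S := \sum_(k < n) x 0 k ^+ 2.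
have S0 : 0 < S.
  rewrite /S -sqr_enorm exprn_gt0// lt_neqAle enorm_ge0 andbT eq_sym.
  by apply: contra x0 => /eqP/enorm0_eq0 ->.
rewrite (_ : (fun t => _) = Num.sqrt \o (fun t : R => S + 2 * t * x 0 i + t ^+ 2)); last first.
  by apply/funext => t; rewrite enormE enorm_sum_delta.
have h1 : is_derive (0 : R) (1 : R) (fun t : R => S + 2 * t * x 0 i + t ^+ 2) (2 * x 0 i).
  apply: is_derive_eq; rewrite /GRing.scale/=; ring.
have h2 : is_derive (S + 2 * 0 * x 0 i + 0 ^+ 2 : R) (1 : R) Num.sqrt (2 * enorm x)^-1.
  rewrite mulr0 mul0r expr0n/= !addr0 enormE.
  exact: is_derive1_sqrt.
have hc := @is_derive1_comp _ Num.sqrt (fun t : R => S + 2 * t * x 0 i + t ^+ 2) 0 _ _ h2 h1.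
apply: is_derive_eq; field.
by rewrite enormE -/S gt_eqF// sqrtr_gt0.
Qed.

Lemma partial_radial x (i : 'I_n) : hball x -> x != 0 ->
  partial i U x = F1 (enorm x) * (x 0 i / enorm x).
Proof.
move=> bx x0.
have := @derive_line R n U x (delta_mx 0 i) 0.
rewrite scale0r addr0 /partial => ->.
under eq_fun do rewrite radial_axis.
have h1 := enorm_line_derive i x0.
have nx : - 1 < enorm x < 1.
  by rewrite /hball/= in bx; rewrite bx andbT (lt_le_trans _ (enorm_ge0 x)).
have h2 : is_derive (enorm (x + 0 *: delta_mx 0 i)) (1 : R) F (F1 (enorm x)).
  by rewrite scale0r addr0; exact: axis_derive.
by have [_ ->] := @is_derive1_comp _ F _ 0 _ _ h2 h1.
Qed.

(** The radial part of the field subtracts 2 s^2 from the factor 1 + s^2. In terms of the hyperbolic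
    distance, (1 - s^2) F' is 2 U'. *)
Lemma vfield_radial x : hball x ->
  vfield j U x = (1 - enorm x ^+ 2) * F1 (enorm x) * (x 0 j / enorm x).
Proof.
(* At the centre the right-hand side is 0 because 0 / 0 = 0 by convention, and the left-hand side
   because the profile is even. *)
have [->|x0] := eqVneq x 0 => bx.
  have e0 : enorm (0 : 'rV[R]_n) = 0 by rewrite -(scale0r e) enorm_axis normr0.
  have := axis_derivative0; rewrite /axis_derivative scale0r => F10.
  by rewrite /vfield F10 !mxE !(mulr0, mul0r, subr0).
have xl l : x 0 l * partial l U x = F1 (enorm x) / enorm x * x 0 l ^+ 2.
  by rewrite partial_radial//; ring.
rewrite /vfield partial_radial// (eq_bigr _ (fun l _ => xl l)) -mulr_sumr -sqr_enorm.
by field; apply: contra x0 => /eqP/enorm0_eq0 ->.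
Qed.

Lemma axis_derivative_derive (s : R) : - 1 < s < 1 ->
  is_derive s (1 : R) F1 (partial j (partial j U) (s *: e)).
Proof.
move=> s1; have [_ /(_ j)[_ [_ /(_ j)[dU _]]]] := CU.
have := @is_derive_line R n (partial j U) 0 e s.
rewrite add0r => /(_ (dU _ (hball_axis s1))).
by under eq_fun do rewrite add0r.
Qed.

Lemma axis_derivative_continuous (s : R) : - 1 < s < 1 -> {for s, continuous F1}.
Proof. by move=> s1; exact: is_derive_continuous (axis_derivative_derive s1). Qed.

(** Inside the ball and off the centre, [rho y ^+ m * partial i U y] equals
    [P m (enorm y) * (y 0 i / enorm y)]. *)
Let P (m : nat) (s : R) : R := conformal s ^+ m * F1 s.

Lemma conformal_derivable (s : R) : - 1 < s < 1 -> derivable conformal s (1 : R).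
Proof.
move=> s1; apply: derivableM => //; apply: derivableV.
  by rewrite gt_eqF//; nra.
by apply: derivableB => //; exact: derivableX.
Qed.

Let P_derivable m (s : R) : - 1 < s < 1 -> derivable (P m) s (1 : R).
Proof.
move=> s1; have -> : P m = conformal ^+ m * F1.
  by apply/funext => x; rewrite /P fctE exprfctE.
apply: derivableM; last by have [] := axis_derivative_derive s1.
exact: derivableX (conformal_derivable s1).
Qed.

Lemma partial_flux_axis m (s : R) : 0 < s < 1 ->
  partial j (fun y => rho y ^+ m * partial j U y) (s *: e) = 'D_1 (P m) s.
Proof.
move=> s01.
have PE : (fun t => rho (0 + t *: e) ^+ m * partial j U (0 + t *: e)) = P m.
  apply/funext => t; rewrite add0r /P /F1 /conformal /rho enorm_axis.
  by rewrite -normrX ger0_norm// sqr_ge0.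
have := @derive_line R n (fun y => rho y ^+ m * partial j U y) 0 e s.
by rewrite add0r PE => dl; apply: (etrans dl).
Qed.

(** On the line through [s *: e] in direction [i], the function is t P(N) / N with N(t)^2 = s^2 +
    t^2. The factor t vanishes at 0, so the derivative there is the value of the cofactor, P(s) /
    s. *)
Lemma partial_flux_transverse m (s : R) (i : 'I_n) : 0 < s < 1 -> i != j ->
  partial i (fun y => rho y ^+ m * partial i U y) (s *: e) = P m s / s.
Proof.
move=> /andP[s0 s1] ij.
have := @derive_line R n (fun y => rho y ^+ m * partial i U y) (s *: e) (delta_mx 0 i) 0.
rewrite scale0r addr0 /partial => ->.
pose N (t : R) : R := enorm (s *: e + t *: delta_mx 0 i).
have se0 : s *: e != 0.
  apply/eqP => /(congr1 (fun x : 'rV[R]_n => x 0 j)).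
  by rewrite !mxE !eqxx mulr1 => /eqP; rewrite gt_eqF.
have N0 : N 0 = s by rewrite /N scale0r addr0 enorm_axis gtr0_norm.
have xi : (s *: e : 'rV[R]_n) 0 i = 0 by rewrite !mxE (negbTE ij) andbF mulr0.
have NE (t : R) : N t ^+ 2 = s ^+ 2 + t ^+ 2.
  by rewrite sqr_enorm enorm_sum_delta -sqr_enorm enorm_axis xi mulr0 addr0 gtr0_norm.
have dN := enorm_line_derive i se0.
rewrite xi mul0r -/N in dN.
pose k (t : R) : R := P m (N t) / N t.
have dPs : is_derive (N 0) (1 : R) (fun s => P m s / s) ('D_1 (fun s => P m s / s) s).
  rewrite N0; apply: derivableP; apply: derivableM; first by apply: P_derivable; lra.
  by apply: derivableV => //; rewrite gt_eqF.
have dk := @is_derive1_comp _ (fun s => P m s / s) N 0 _ _ dPs dN.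
have dtk : is_derive (0 : R) (1 : R) (fun t : R => t * k t) (P m s / s).
  have := @is_deriveM _ _ id k 0 1 1 _ _ dk.
  rewrite /k N0 => h; apply: is_derive_eq; rewrite /GRing.scale/=; ring.
have [_ <-] := dtk.
have s10 : 0 < 1 - s ^+ 2 by nra.
(* The radial formula is available only inside the ball, that is, for small [t]. *)
apply: near_eq_derive.
near=> t.
have bt : hball (s *: e + t *: delta_mx 0 i).
  rewrite /hball/= -/(N t) -(@expr_lt1 _ 2)// ?enorm_ge0// NE.
  have : `|t| < 1 - s ^+ 2.
    by near: t; exact: (@nbhs0_lt _ R).
  rewrite ltr_norml => /andP[t1 t2].
  have : t ^+ 2 < 1 - s ^+ 2.
    by nra.
  by lra.
have Nt : 0 < N t.
  rewrite lt_neqAle enorm_ge0 andbT; apply/eqP => h; have := NE t.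
  by rewrite -h expr0n/=; nra.
rewrite -[LHS]/(rho (s *: e + t *: delta_mx 0 i) ^+ m *
  partial i U (s *: e + t *: delta_mx 0 i)) partial_radial//; last first.
  by apply/eqP => h; move: Nt; rewrite /N h -(scale0r e) enorm_axis normr0 ltxx.
rewrite -/(N t) /k /P /rho -/(N t) -/(conformal (N t)).
have -> : (s *: e + t *: delta_mx 0 i : 'rV[R]_n) 0 i = t.
  by rewrite [LHS]mxE xi add0r !mxE !eqxx mulr1.
by ring.
Unshelve. all: by end_near. Qed.

(** On the axis the Laplacian consists of one axial term P' and n - 1 transverse terms P / s, and
    s^(n-1) (P' + (n-1) P / s) is the derivative of s^(n-1) P. *)
Lemma radial_ode p lam : (3 <= n)%N ->
  (forall x, hball x -> - hlaplacian U x - lam * U x = U x `^ p) ->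
  forall s : R, 0 < s < 1 ->
  is_derive s (1 : R) (flux n.-2 F1)
     (- (s ^+ n.-2.+1 * conformal s ^+ n.-2.+2 * (lam * F s + F s `^ p))).
Proof.
move=> n3 eqU s /[dup] s01 /andP[s0 s1].
have s1' : - 1 < s < 1 by lra.
have := eqU _ (hball_axis s1').
rewrite /hlaplacian (bigD1 j)//= subn2 partial_flux_axis//.
rewrite (eq_bigr (fun=> P n.-2 s / s)); last first.
  by move=> i ij; rewrite partial_flux_transverse.
rewrite sumr_const cardC1 card_ord.
have -> : rho (s *: e) = conformal s.
  by rewrite /rho /conformal enorm_axis -normrX ger0_norm ?sqr_ge0.
rewrite -/(F s) => ode.
have dP := derivableP (@P_derivable n.-2 s s1').
have dX : is_derive s (1 : R) (fun t : R => t ^+ n.-2.+1) (n.-2.+1%:R * s ^+ n.-2).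
  rewrite (_ : (fun t => _) = (id : R -> R) ^+ n.-2.+1); last first.
    by apply/funext => t; rewrite exprfctE.
  have := @is_deriveX _ _ (id : R -> R) n.-2.+1 s 1 1 (is_derive_id _ _).
  by rewrite /GRing.scale/= mulr1.
have dM := @is_deriveM _ _ (fun t : R => t ^+ n.-2.+1) (P n.-2) s 1 _ _ dX dP.
rewrite (_ : flux n.-2 F1 = (fun t : R => t ^+ n.-2.+1) * P n.-2); last first.
  by apply/funext => t; rewrite /flux /P -mulrA.
apply: is_derive_eq; rewrite /GRing.scale/=.
have n2 : n.-2.+2 = n by lia.
have n1 : n.-1 = n.-2.+1 by lia.
rewrite n1 -{1}n2 in ode.
have c0 : conformal s != 0.
  by rewrite gt_eqF// /conformal divr_gt0//; nra.
have cn0 : conformal s ^+ n.-2.+2 != 0 by rewrite expf_neq0.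
set D := 'D_1 (P n.-2) s in ode *.
have -> : D = - (conformal s ^+ n.-2.+2 * (lam * F s + F s `^ p)) - (P n.-2 s / s) *+ n.-2.+1.
  by rewrite -ode; field; rewrite cn0 gt_eqF.
rewrite -[P n.-2 s / s *+ n.-2.+1]mulr_natl (exprS s); field.
by rewrite gt_eqF.
Qed.

End radial_functions.

(** * The hyperbolic distance *)

Section hyperbolic_distance.
Context {R : realType} {n : nat}.
Implicit Types (x y z : 'rV[R]_n).

Definition cosh_hdist x y : R :=
  1 + 2 * enorm (x - y) ^+ 2 / ((1 - enorm x ^+ 2) * (1 - enorm y ^+ 2)).

Lemma hball_gap x : hball x -> 0 < 1 - enorm x ^+ 2.
Proof. by rewrite /hball/= => bx; have := enorm_ge0 x; nra. Qed.

Lemma cosh_hdist_ge1 x y : hball x -> hball y -> 1 <= cosh_hdist x y.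
Proof.
move=> /hball_gap bx /hball_gap by_; rewrite lerDl.
apply: divr_ge0; apply: mulr_ge0 => //; first exact: sqr_ge0.
all: exact: ltW.
Qed.

(** The base is e^d with t = cosh d. It lies between t and 2 t, so up to constants powers of
    [cosh_hdist] can replace exponentials of the distance. *)
Lemma expR_arcosh (c t : R) : 1 <= t ->
  expR (- (c * arcosh t)) = (t + Num.sqrt (t ^+ 2 - 1)) `^ (- c).
Proof.
move=> t1; rewrite /powR gt_eqF ?mulNr//.
by rewrite ltr_pwDl ?sqrtr_ge0//; lra.
Qed.

Lemma expR_hdist_le (c : R) x y : 0 <= c -> hball x -> hball y ->
  expR (- (c * hdist x y)) <= cosh_hdist x y `^ (- c).
Proof.
move=> c0 bx by_; have h := cosh_hdist_ge1 bx by_.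
rewrite expR_arcosh//; apply: powR_neg_le; [lra| |lra].
by rewrite lerDl sqrtr_ge0.
Qed.

Lemma expR_hdist_ge (c : R) x y : 0 <= c -> hball x -> hball y ->
  (2 * cosh_hdist x y) `^ (- c) <= expR (- (c * hdist x y)).
Proof.
move=> c0 bx by_; have h := cosh_hdist_ge1 bx by_.
rewrite -[hdist x y]/(arcosh (cosh_hdist x y)) expR_arcosh//.
have hs : Num.sqrt (cosh_hdist x y ^+ 2 - 1) <= cosh_hdist x y.
  rewrite -[leRHS]ger0_norm; last lra.
  by rewrite -sqrtr_sqr ler_wsqrtr// gerBl.
have s0 : 0 <= Num.sqrt (cosh_hdist x y ^+ 2 - 1) by exact: sqrtr_ge0.
by apply: powR_neg_le; lra.
Qed.

Lemma hdist0E x : hball x -> hdist x 0 = ln ((1 + enorm x) / (1 - enorm x)).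
Proof.
move=> bx; have g := hball_gap bx; have x0 := enorm_ge0 x.
have e0 : enorm (0 : 'rV[R]_n) = 0.
  by rewrite enormE big1 ?sqrtr0// => i _; rewrite mxE expr0n.
rewrite /hdist /arcosh subr0 e0; set s := enorm x in g x0 *.
have s1 : s < 1 by [].
have -> : (1 + 2 * s ^+ 2 / ((1 - s ^+ 2) * (1 - 0 ^+ 2))) ^+ 2 - 1 =
    (2 * s / (1 - s ^+ 2)) ^+ 2.
  by field; rewrite gt_eqF.
rewrite sqrtr_sqr ger0_norm; last by rewrite divr_ge0 ?mulr_ge0// ltW.
congr ln; field.
by rewrite !gt_eqF//; lra.
Qed.

Lemma expR_hdist0 (c : R) x : hball x ->
  expR (- (c * hdist x 0)) = ((1 - enorm x) / (1 + enorm x)) `^ c.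
Proof.
move=> bx; have x0 := enorm_ge0 x; have x1 : enorm x < 1 by [].
have q0 : 0 < (1 - enorm x) / (1 + enorm x) by rewrite divr_gt0; lra.
rewrite hdist0E// /powR gt_eqF// -invf_div lnV ?posrE//.
by rewrite mulrN opprK.
Qed.

End hyperbolic_distance.

Lemma ground_state_profile (R : realType) (n : nat) (p lam chi1 chi2 : R)
    (u : R -> R) (j : 'I_n) : (3 <= n)%N ->
  ground_state n p lam u -> sharp_decay n lam chi1 chi2 u ->
  radial_profile n.-2 p lam (decay_rate n lam) chi1 chi2
    (axis_profile j u) (axis_derivative j u).
Proof.
move=> n3 [_ CU _ udec eqU] dec.
have bax (s : R) : 0 <= s < 1 -> hball (s *: delta_mx 0 j : 'rV[R]_n).
  by move=> s1; apply: hball_axis; lra.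
have b0 : hball (0 : 'rV[R]_n) by rewrite -(scale0r (delta_mx 0 j)); apply: bax; lra.
split.
- by move=> s s1; exact: axis_derive.
- by move=> s s1; exact: axis_derivative_continuous.
- exact: radial_ode.
- move=> s t s0 st t1.
  have bs := bax s ltac:(lra); have bt := bax t ltac:(lra).
  rewrite /axis_profile /radial_at !hdist0E// !enorm_axis !ger0_norm; [|lra|lra].
  apply: udec.
    by apply: ln_ge0; rewrite ler_pdivlMr; lra.
  rewrite ltr_ln ?posrE ?divr_gt0//; try lra.
  rewrite ltr_pdivrMr; last lra.
  rewrite mulrAC ltr_pdivlMr; last lra.
  by nra.
- move=> s s1; have bs := bax s s1.
  have := dec _ _ bs b0.
  rewrite expR_hdist0// enorm_axis ger0_norm//.
  by move: s1 => /andP[].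
Qed.

(** * Geometry of the ball *)

Section radial_bounds.
Context {R : realType} {n : nat}.
Implicit Types (x y z : 'rV[R]_n).
Variables (lam chi1 chi2 : R) (u : R -> R).
Hypotheses (chi10 : 0 < chi1) (chi20 : 0 < chi2).
Hypothesis dec : sharp_decay n lam chi1 chi2 u.
Local Notation c := (decay_rate n lam).
Hypothesis c0 : 0 < c.

Lemma radial_at_le x z : hball x -> hball z ->
  radial_at u z x <= chi2 * cosh_hdist x z `^ (- c).
Proof.
move=> bx bz; have /andP[_ h] := dec bx bz; apply: (le_trans h).
by apply: ler_wpM2l; [exact: ltW|apply: expR_hdist_le => //; exact: ltW].
Qed.

Lemma radial_at_ge x z : hball x -> hball z ->
  chi1 * (2 * cosh_hdist x z) `^ (- c) <= radial_at u z x.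
Proof.
move=> bx bz; have /andP[h _] := dec bx bz; apply: le_trans h.
by apply: ler_wpM2l; [exact: ltW|apply: expR_hdist_ge => //; exact: ltW].
Qed.

Lemma radial_at_ge0 x z : hball x -> hball z -> 0 <= radial_at u z x.
Proof.
move=> bx bz; apply: le_trans (radial_at_ge bx bz).
by rewrite mulr_ge0 ?powR_ge0// ltW.
Qed.

End radial_bounds.

Section ball_geometry.
Context {R : realType} {n : nat}.
Implicit Types (x y z : 'rV[R]_n).
Local Notation gap x := (1 - enorm x ^+ 2).

Lemma coord_le_enorm x i : `|x 0 i| <= enorm x.
Proof.
rewrite enormE -sqrtr_sqr; apply: ler_wsqrtr.
by rewrite (bigD1 i)//= lerDl sumr_ge0// => k _; exact: sqr_ge0.
Qed.

(** Arguing coordinate by coordinate costs a factor n but avoids the triangle inequality for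
    [enorm]. *)
Lemma gap_lipschitz x z : hball x -> hball z ->
  `|gap x - gap z| <= 2 * n%:R * enorm (x - z).
Proof.
move=> bx bz.
rewrite (_ : gap x - gap z = \sum_(i < n) (z 0 i - x 0 i) * (z 0 i + x 0 i)); last first.
  rewrite (_ : gap x - gap z = enorm z ^+ 2 - enorm x ^+ 2); last by ring.
  by rewrite !sqr_enorm -sumrB; apply: eq_bigr => i _; ring.
apply: (le_trans (ler_norm_sum _ _ _)).
rewrite (_ : 2 * n%:R * _ = \sum_(i < n) 2 * enorm (x - z)); last first.
  by rewrite sumr_const card_ord -[RHS]mulr_natr mulrAC.
apply: ler_sum => i _; rewrite normrM mulrC ler_pM//.
  apply: (le_trans (ler_normD _ _)).
  have hx := coord_le_enorm x i; have hz := coord_le_enorm z i.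
  have : enorm x < 1 := bx; have : enorm z < 1 := bz; lra.
by have := coord_le_enorm (x - z) i; rewrite !mxE distrC.
Qed.

Lemma gap_le_scale x z : hball x -> hball z ->
  gap x <= (1 + 2 * n%:R) * Num.max (gap z) (enorm (x - z)).
Proof.
move=> bx bz; have := gap_lipschitz bx bz; rewrite ler_norml => /andP[_ h].
set M := Num.max _ _; have h1 : gap z <= M by rewrite le_max lexx.
have h2 : enorm (x - z) <= M by rewrite le_max lexx orbT.
have : 2 * n%:R * enorm (x - z) <= 2 * n%:R * M by rewrite ler_wpM2l.
lra.
Qed.

(** The right-hand side is w t + 2 D^2, with w, t the gaps of x, z and D = |x - z|. If t <= 4 n D
    the second term suffices, which gives the constant 8 n^2; otherwise the Lipschitz bound yields w
    >= t / 2 and the first term suffices. *)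
Lemma cosh_hdist_scale x z : hball x -> hball z -> (0 < n)%N ->
  Num.max (gap z) (enorm (x - z)) ^+ 2 / (8 * n%:R ^+ 2) <=
  cosh_hdist x z * (gap x * gap z).
Proof.
move=> bx bz n0.
have n1 : 1 <= n%:R :> R by rewrite ler1n.
have [gx gz] := (hball_gap bx, hball_gap bz).
rewrite (_ : cosh_hdist x z * _ = gap x * gap z + 2 * enorm (x - z) ^+ 2); last first.
  by rewrite /cosh_hdist; field; rewrite !gt_eqF.
have := gap_lipschitz bx bz; rewrite ler_norml => /andP[h _].
have D0 := enorm_ge0 (x - z).
move: (enorm (x - z)) D0 h => D D0 h.
move: (gap x) (gap z) gx gz h => w t w0 t0 h.
have N0 : 0 < 8 * n%:R ^+ 2 :> R by rewrite mulr_gt0// exprn_gt0//; lra.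
rewrite ler_pdivrMr//.
move: (n%:R : R) n1 h N0 => N N1 h N0.
have N2 : 1 <= N ^+ 2 by rewrite exprn_ege1.
have wt : 0 <= w * t by rewrite mulr_ge0// ltW.
have D2 : 0 <= D ^+ 2 by exact: sqr_ge0.
have [tD|Dt] := leP t D; first by nra.
have [tND|NDt] := leP t (4 * N * D).
  have : t ^+ 2 <= (4 * N * D) ^+ 2 by rewrite lerXn2r ?nnegrE//; [lra|rewrite !mulr_ge0//; lra].
  by nra.
have wt2 : t / 2 <= w by lra.
have : t ^+ 2 / 2 <= w * t by nra.
by nra.
Qed.

(* Half-length of the chord of the ball through [x] in the direction [i]; it does
   not depend on [x 0 i]. *)
Definition chord (i : 'I_n) x : R :=
  Num.sqrt (1 - \sum_(k < n | k != i) x 0 k ^+ 2).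

Lemma sqr_chord i x : hball x -> chord i x ^+ 2 = gap x + x 0 i ^+ 2.
Proof.
move=> bx; have E : 1 - \sum_(k < n | k != i) x 0 k ^+ 2 = gap x + x 0 i ^+ 2.
  by rewrite sqr_enorm [in RHS](bigD1 i)//=; ring.
rewrite /chord E sqr_sqrtr//.
by rewrite addr_ge0 ?sqr_ge0// ltW// hball_gap.
Qed.

(** The squares of the half-chords add up to n (1 - |x|^2) + |x|^2 >= 1, so they cannot all be
    small. *)
Lemma exists_chord_ge x : hball x -> (0 < n)%N ->
  exists i : 'I_n, n%:R^-1 <= chord i x.
Proof.
move=> bx n0; apply: contrapT => /forallNP h.
have n1 : 1 <= n%:R :> R by rewrite ler1n.
have g := hball_gap bx.
have : \sum_(i < n) chord i x ^+ 2 < \sum_(i < n) n%:R^-1 :> R.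
  apply: ltr_sum; first by apply/hasP; exists (Ordinal n0) => //; rewrite mem_index_enum.
  move=> i _; have /negP := h i; rewrite -ltNge => hi.
  have c0 : 0 <= chord i x by exact: sqrtr_ge0.
  have nV : n%:R^-1 <= 1 :> R by rewrite invf_le1//; lra.
  nra.
under eq_bigr => i _ do rewrite sqr_chord//.
rewrite big_split/= !sumr_const card_ord -sqr_enorm -[X in _ < X]mulr_natr mulVf; last first.
  by rewrite pnatr_eq0 -lt0n.
rewrite -mulr_natr; nra.
Qed.

(** For a long chord, 1 - |x|^2 = (A - |x_i|) (A + |x_i|) >= (A - |x_i|) / n, where A is the
    half-chord. The good index and the nearer endpoint depend on x; summing over all indices and
    both endpoints removes this choice before integration. *)
Lemma powR_gap_le (b : R) x : b < 0 -> hball x -> (0 < n)%N ->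
  gap x `^ b <= n%:R `^ (- b) *
    \sum_(i < n) (`|x 0 i - chord i x| `^ b + `|x 0 i - - chord i x| `^ b).
Proof.
move=> b0 bx n0; have [i hi] := exists_chord_ge bx n0.
have n1 : 1 <= n%:R :> R by rewrite ler1n.
have g := hball_gap bx.
pose k : R := chord i x - `|x 0 i|.
have ci : 0 <= chord i x by exact: sqrtr_ge0.
have E : gap x = k * (chord i x + `|x 0 i|).
  rewrite (_ : k * _ = chord i x ^+ 2 - `|x 0 i| ^+ 2); last by rewrite /k; ring.
  by rewrite (sqr_chord i bx) real_normK ?num_real//; ring.
have cp : 0 < chord i x + `|x 0 i|.
  by apply: (lt_le_trans (_ : 0 < n%:R^-1)); [rewrite invr_gt0; lra|rewrite (le_trans hi)// lerDl].
have k0 : 0 < k by move: g; rewrite E pmulr_lgt0.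
have kg : k / n%:R <= gap x.
  rewrite E ler_wpM2l ?(ltW k0)//.
  by apply: (le_trans hi); rewrite lerDl.
apply: (@le_trans _ _ (n%:R `^ (- b) * k `^ b)).
  apply: (@le_trans _ _ ((k / n%:R) `^ b)).
    by apply: powR_neg_le => //; [rewrite divr_gt0//; lra|exact: ltW].
  rewrite powRM ?(ltW k0) ?invr_ge0 ?ler0n//.
  rewrite mulrC -(@powR_inv1 _ n%:R) ?ler0n//.
  by rewrite -powRrM mulN1r.
rewrite ler_wpM2l ?powR_ge0// (bigD1 i)//=.
apply: (@le_trans _ _ (`|x 0 i - chord i x| `^ b + `|x 0 i - - chord i x| `^ b)); last first.
  by rewrite lerDl sumr_ge0// => l _; rewrite addr_ge0// powR_ge0.
have [xi|xi] := leP 0 (x 0 i).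
  rewrite (_ : `|x 0 i - chord i x| = k) ?lerDl ?powR_ge0//.
  by move: k0; rewrite /k (ger0_norm xi) => k0; rewrite distrC gtr0_norm.
rewrite (_ : `|x 0 i - - chord i x| = k) ?lerDr ?powR_ge0//.
by move: k0; rewrite /k ltr0_norm// opprK => k0; rewrite opprK addrC gtr0_norm.
Qed.

End ball_geometry.

(** * Upper bound for the integrand *)

Section upper_bound.
Context {R : realType}.
Local Notation gap x := (1 - enorm x ^+ 2).

Definition kernel_at k (i : 'I_k.+1) (h b g A : R) (x z : 'rV[R]_k.+1) : R :=
  singular_kernel h b g A (z 0 i) (x 0 i) *
  \prod_(l < k) decay_kernel h g (x 0 (lift i l) - z 0 (lift i l)).

(** M dominates the scale max(h, |x_l - z_l|) of each coordinate, and all exponents of these scales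
    are negative. The exponent of M is shared out as 1 + g per coordinate, with the extra b given to
    coordinate [i]. *)
Lemma kernel_at_ge k (i : 'I_k.+1) (h b g A M : R) (x z : 'rV[R]_k.+1) :
  0 < h -> - 1 < b -> 0 < g -> h <= M -> (forall l, `|x 0 l - z 0 l| <= M) ->
  h `^ (k.+1%:R * g) * `|x 0 i - A| `^ b * M `^ (- (k.+1%:R * (1 + g)) - b) <=
  kernel_at i h b g A x z.
Proof.
move=> h0 b1 g0 hM xM; have M0 : 0 < M by exact: lt_le_trans hM.
have mM l : Num.max h `|x 0 l - z 0 l| <= M by rewrite ge_max hM xM.
have m0 l : 0 < Num.max h `|x 0 l - z 0 l| by rewrite lt_max h0.
apply: (@le_trans _ _ ((h `^ g * (`|x 0 i - A| `^ b * M `^ (- 1 - g - b))) *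
    \prod_(l < k) (h `^ g * M `^ (- 1 - g)))).
  rewrite prodr_const card_ord le_eqVlt; apply/orP; left; apply/eqP.
  rewrite exprMn -!powR_mulrn ?powR_ge0// -!powRrM.
  have -> : k.+1%:R = 1 + k%:R :> R by rewrite -natr1 addrC.
  have hne : h != 0 by rewrite gt_eqF.
  have Mne : M != 0 by rewrite gt_eqF.
  have -> : h `^ ((1 + k%:R) * g) = h `^ g * h `^ (g * k%:R).
    rewrite -powRD; last by rewrite hne implybT.
    by congr (_ `^ _); ring.
  have -> : M `^ (- ((1 + k%:R) * (1 + g)) - b) =
      M `^ (- 1 - g - b) * M `^ ((- 1 - g) * k%:R).
    rewrite -powRD; last by rewrite Mne implybT.
    by congr (_ `^ _); ring.
  by ring.
have P0 : 0 <= h `^ g * M `^ (- 1 - g) by rewrite mulr_ge0 ?powR_ge0.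
apply: ler_pM.
- by rewrite !mulr_ge0 ?powR_ge0.
- by apply: prodr_ge0.
- apply: ler_wpM2l; first exact: powR_ge0.
  apply: ler_wpM2l; first exact: powR_ge0.
  by apply: powR_neg_le => //; lra.
apply: ler_prod => l _; rewrite P0/=.
apply: ler_wpM2l; first exact: powR_ge0.
by apply: powR_neg_le => //; lra.
Qed.

Lemma rho_powR k (x : 'rV[R]_k) : hball x ->
  rho x ^+ k = 2 ^+ k * gap x `^ (- k%:R).
Proof.
move=> bx; have g := hball_gap bx.
by rewrite /rho expr_div_n powR_invn ?(ltW g).
Qed.

Lemma vfield_ub k (p lam chi1 chi2 : R) : (3 <= k)%N -> 1 < p ->
  0 < decay_rate k lam -> 0 < chi1 -> 0 < chi2 ->
  exists2 C : R, 0 < C & forall u, ground_state k p lam u ->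
    sharp_decay k lam chi1 chi2 u ->
    forall (j : 'I_k) (x : 'rV[R]_k), hball x ->
      `|vfield j (radial_at u 0) x| <= C * gap x `^ decay_rate k lam.
Proof.
move=> k3 p1 c0 chi10 chi20; set c := decay_rate k lam.
have [C C0 hC] := @profile_derive_ub R k.-2 p lam c chi1 chi2 p1 c0 chi10 chi20.
exists (2 * C); first by rewrite mulr_gt0.
move=> u gs sd j x bx; have P := ground_state_profile j k3 gs sd.
have [_ CU _ _ _] := gs.
have g := hball_gap bx.
rewrite (vfield_radial _ CU)//.
have [->|x0] := eqVneq x 0.
  by rewrite mxE mul0r mulr0 normr0 mulr_ge0 ?powR_ge0// mulr_ge0// ltW.
have s0 : 0 < enorm x.
  rewrite lt_neqAle enorm_ge0 andbT eq_sym.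
  by apply: contra x0 => /eqP/enorm0_eq0 ->.
have s1 : enorm x < 1 by [].
have s01 : 0 < enorm x < 1 by rewrite s0.
have F0 := profile_derive_le0 P s01.
rewrite !normrM normfV.
apply: (@le_trans _ _ (`|gap x| * `|axis_derivative j u (enorm x)|)).
  rewrite ler_piMr ?mulr_ge0// ler_pdivrMr ?normr_gt0 ?gt_eqF// mul1r.
  by rewrite [leRHS]ger0_norm ?enorm_ge0// coord_le_enorm.
rewrite (gtr0_norm g) (ler0_norm F0).
apply: (@le_trans _ _ (2 * (C * (1 - enorm x) `^ c))).
  apply: (@le_trans _ _ (2 * (- axis_derivative j u (enorm x) * (1 - enorm x)))).
    rewrite (_ : 2 * _ = 2 * (1 - enorm x) * (- axis_derivative j u (enorm x))); last by ring.
    by apply: ler_wpM2r; [rewrite oppr_ge0|nra].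
  by rewrite ler_pM2l//; exact: hC P _ s01.
rewrite mulrA; apply: ler_wpM2l; first by rewrite mulr_ge0// ltW.
by apply: ge0_ler_powR; rewrite ?nnegrE ?(ltW c0) ?(ltW g) ?subr_ge0 ?(ltW s1)//; nra.
Qed.

Lemma integrand_ub k (p lam chi1 chi2 : R) : (3 <= k.+1)%N -> 1 < p ->
  k.+1%:R - 1 < 2 * decay_rate k.+1 lam -> 0 < chi1 -> 0 < chi2 ->
  exists b g C : R, [/\ - 1 < b, b < 0, 0 < g, 0 <= C &
    forall u, ground_state k.+1 p lam u -> sharp_decay k.+1 lam chi1 chi2 u ->
    forall (j : 'I_k.+1) (x z : 'rV[R]_k.+1), hball x -> hball z ->
      `|radial_at u z x `^ p * vfield j (radial_at u 0) x * rho x ^+ k.+1| <=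
      C * gap z `^ decay_rate k.+1 lam *
      \sum_(i < k.+1) (kernel_at i (gap z) b g (chord i x) x z +
                       kernel_at i (gap z) b g (- chord i x) x z)].
Proof.
move=> k3 p1; set c := decay_rate k.+1 lam => hc chi10 chi20.
pose N : R := k.+1%:R.
have N1 : 1 <= N by rewrite ler1n.
rewrite -/N in hc.
have c0 : 0 < c by lra.
have cp0 : 0 < c * (p - 1) by rewrite mulr_gt0// subr_gt0.
(* The total power of w: c p from U[z]^p, c from the vector field and -n from the density. It
   exceeds -1 because p > 1 and 2 c > n - 1. *)
pose al : R := c * p + c - N.
have al1 : - 1 < al by rewrite /al; lra.
(* [al] may be nonnegative, while the singular kernel needs a negative exponent. *)
pose b : R := Num.min al (- (1 / 2)).
have b1 : - 1 < b by rewrite lt_min al1/=; lra.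
have b0 : b < 0 by rewrite gt_min; apply/orP; right; lra.
have bal : b <= al by rewrite ge_min lexx.
pose g : R := c * (p - 1) / N.
have g0 : 0 < g by rewrite divr_gt0//; lra.
have Ng : N * g = c * (p - 1) by rewrite /g; field; lra.
have [CV CV0 hCV] := @vfield_ub k.+1 p lam chi1 chi2 k3 p1 c0 chi10 chi20.
pose L : R := 1 + 2 * N.
pose Q : R := 8 * N ^+ 2.
have Q0 : 0 < Q by rewrite mulr_gt0// exprn_gt0//; lra.
pose C : R := chi2 `^ p * Q `^ (c * p) * CV * 2 ^+ k.+1 * L `^ (al - b) * N `^ (- b).
exists b, g, C; split => //.
  by rewrite !mulr_ge0 ?powR_ge0// ?exprn_ge0// ltW.
move=> u gs sd j x z bx bz.
have n0 : (0 < k.+1)%N by [].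
have [gx gz] := (hball_gap bx, hball_gap bz).
set w := 1 - enorm x ^+ 2 in gx *; set t := 1 - enorm z ^+ 2 in gz *.
pose M : R := Num.max t (enorm (x - z)).
have tM : t <= M by rewrite le_max lexx.
have M0 : 0 < M by exact: lt_le_trans tM.
have xM l : `|x 0 l - z 0 l| <= M.
  rewrite le_max; apply/orP; right.
  by have := coord_le_enorm (x - z) l; rewrite !mxE.
have wM : w <= L * M by exact: gap_le_scale.
have TM : M ^+ 2 / Q <= cosh_hdist x z * (w * t) by exact: cosh_hdist_scale.
have T1 := cosh_hdist_ge1 bx bz.
have [wn tn Mn] : [/\ w != 0, t != 0 & M != 0] by rewrite !gt_eqF.
have U0 := radial_at_ge0 chi10 sd c0 bx bz.
have hU : radial_at u z x `^ p <=
    chi2 `^ p * (Q `^ (c * p) * (w `^ (c * p) * t `^ (c * p) * M `^ (- (2 * (c * p))))).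
  apply: (@le_trans _ _ ((chi2 * cosh_hdist x z `^ (- c)) `^ p)).
    apply: ge0_ler_powR; rewrite ?nnegrE//; first lra.
      by rewrite mulr_ge0 ?powR_ge0// ltW.
    exact: (radial_at_le chi20 sd c0 bx bz).
  rewrite powRM ?powR_ge0 ?(ltW chi20)//; apply: ler_wpM2l; first exact: powR_ge0.
  rewrite -powRrM mulNr.
  apply: (@le_trans _ _ ((M ^+ 2 / (Q * (w * t))) `^ (- (c * p)))).
    apply: powR_neg_le.
    - by rewrite divr_gt0 ?exprn_gt0// mulr_gt0// mulr_gt0.
    - by rewrite invfM mulrA ler_pdivrMr ?mulr_gt0.
    - by rewrite oppr_le0 mulr_ge0; lra.
  rewrite le_eqVlt; apply/orP; left; apply/eqP.
  rewrite powRM ?sqr_ge0 ?invr_ge0 ?mulr_ge0 ?(ltW Q0) ?(ltW gx) ?(ltW gz)//.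
  rewrite -powR_mulrn ?(ltW M0)// -powRrM.
  rewrite -(@powR_inv1 _ (Q * (w * t))); last by rewrite !mulr_ge0 ?ltW.
  rewrite -powRrM mulrNN mul1r !powRM ?mulr_ge0 ?(ltW Q0) ?(ltW gx) ?(ltW gz)//.
  by rewrite mulrN; ring.
have hV := hCV u gs sd j x bx.
have hr := rho_powR bx; rewrite -/w in hr hV.
have r0 : 0 <= rho x ^+ k.+1 by rewrite hr mulr_ge0 ?exprn_ge0 ?powR_ge0.
rewrite 2!normrM (ger0_norm (powR_ge0 _ _)) (ger0_norm r0).
set V := `|vfield _ _ _| in hV *.
have step1 : radial_at u z x `^ p * V * rho x ^+ k.+1 <=
    chi2 `^ p * Q `^ (c * p) * CV * 2 ^+ k.+1 *
     (w `^ al * (t `^ (c * p) * M `^ (- (2 * (c * p))))).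
  apply: (@le_trans _ _ (chi2 `^ p * (Q `^ (c * p) * (w `^ (c * p) * t `^ (c * p) * M `^ (- (2 * (c * p))))) * (CV * w `^ c) * rho x ^+ k.+1)).
    by apply: ler_wpM2r => //; apply: ler_pM; [exact: powR_ge0|exact: normr_ge0|exact: hU|exact: hV].
  rewrite hr le_eqVlt; apply/orP; left; apply/eqP.
  have -> : w `^ al = w `^ (c * p) * w `^ c * w `^ (- k.+1%:R).
    rewrite -!powRD ?wn ?implybT//.
  ring.
apply: (le_trans step1).
(* The surplus power of w is traded for a power of M through w <= L M; this restores the exponent of
   M that scale invariance dictates. *)
have hw : w `^ al <= L `^ (al - b) * M `^ (al - b) * w `^ b.
  have {1}-> : al = (al - b) + b by ring.
  rewrite powRD ?wn ?implybT//; apply: ler_wpM2r; first exact: powR_ge0.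
  rewrite -powRM; [|rewrite /L; lra|exact: ltW].
  apply: ge0_ler_powR; rewrite ?nnegrE ?(ltW gx)//; first by rewrite subr_ge0.
  by apply: le_trans wM; exact: ltW.
have hwb := powR_gap_le b0 bx n0; rewrite -/w in hwb.
set S := \sum_(i < _) _ in hwb.
have tc : t `^ (c * p) = t `^ c * t `^ (N * g).
  rewrite -powRD ?tn ?implybT//; congr (_ `^ _); rewrite Ng; ring.
have Mc : M `^ (al - b) * M `^ (- (2 * (c * p))) = M `^ (- (N * (1 + g)) - b).
  rewrite -powRD ?Mn ?implybT//; congr (_ `^ _).
  rewrite mulrDr Ng /al; ring.
set K1 := chi2 `^ p * Q `^ (c * p) * CV * 2 ^+ k.+1.
have K10 : 0 <= K1 by rewrite !mulr_ge0 ?powR_ge0// ?exprn_ge0// ltW.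
apply: (@le_trans _ _ (K1 * ((L `^ (al - b) * M `^ (al - b) * (N `^ (- b) * S)) * (t `^ (c * p) * M `^ (- (2 * (c * p))))))).
  apply: ler_wpM2l => //; apply: ler_wpM2r; first by rewrite mulr_ge0 ?powR_ge0.
  apply: (le_trans hw); apply: ler_wpM2l; first by rewrite mulr_ge0 ?powR_ge0.
  exact: hwb.
rewrite (_ : K1 * _ = C * t `^ c * (S * (t `^ (N * g) * M `^ (- (N * (1 + g)) - b)))); last first.
  by rewrite tc -Mc /C /K1; ring.
apply: ler_wpM2l.
  by rewrite mulr_ge0 ?powR_ge0// /C !mulr_ge0 ?powR_ge0 ?exprn_ge0// ltW.
rewrite /S mulr_suml; apply: ler_sum => i _.
rewrite mulrDl; apply: lerD.
  have := @kernel_at_ge k i t b g (chord i x) M x z gz b1 g0 tM xM.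
  by apply: le_trans; rewrite -/N le_eqVlt; apply/orP; left; apply/eqP; ring.
have := @kernel_at_ge k i t b g (- chord i x) M x z gz b1 g0 tM xM.
by apply: le_trans; rewrite -/N le_eqVlt; apply/orP; left; apply/eqP; ring.
Qed.

End upper_bound.

(** * Lower bound for the symmetrised integrand *)

Section reflection.
Context {R : realType} {n : nat} (j : 'I_n).
Implicit Types (x y z : 'rV[R]_n).

Definition coord_refl x : 'rV[R]_n := \row_k (if k == j then - x 0 k else x 0 k).

Lemma reflectK : involutive coord_refl.
Proof. by move=> x; apply/rowP => k; rewrite !mxE; case: (k == j); rewrite ?opprK. Qed.

Lemma reflectB x y : coord_refl (x - y) = coord_refl x - coord_refl y.
Proof. by apply/rowP => k; rewrite !mxE; case: ifP => // _; ring. Qed.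

Lemma enorm_reflect x : enorm (coord_refl x) = enorm x.
Proof.
rewrite !enormE; congr Num.sqrt; apply: eq_bigr => k _; rewrite mxE.
by case: ifP; rewrite ?sqrrN.
Qed.

Lemma enorm_reflectB x z : enorm (coord_refl x - z) = enorm (x - coord_refl z).
Proof. by rewrite -{1}(reflectK z) -reflectB enorm_reflect. Qed.

Lemma sqr_enorm_reflectB x z :
  enorm (coord_refl x - z) ^+ 2 = enorm (x - z) ^+ 2 + 4 * (x 0 j * z 0 j).
Proof.
rewrite !sqr_enorm (bigD1 j)//= [in RHS](bigD1 j)//= !mxE eqxx.
rewrite (eq_bigr (fun i => (x - z) 0 i ^+ 2)); first by ring.
by move=> i ij; rewrite !mxE (negbTE ij).
Qed.

Lemma hball_reflect x : hball (coord_refl x) <-> hball x.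
Proof. by rewrite /hball/= enorm_reflect. Qed.

Lemma radial_at_reflect (u : R -> R) x z :
  radial_at u z (coord_refl x) = radial_at u (coord_refl z) x.
Proof. by rewrite /radial_at /hdist enorm_reflectB !enorm_reflect. Qed.

Lemma rho_reflect x : rho (coord_refl x) = rho x.
Proof. by rewrite /rho enorm_reflect. Qed.

Lemma vfield_reflect (u : R -> R) x : Ck 2 hball (radial_at u 0 : 'rV[R]_n -> R) ->
  hball x -> vfield j (radial_at u 0) (coord_refl x) = - vfield j (radial_at u 0) x.
Proof.
move=> CU bx; rewrite !(vfield_radial _ CU)//; last exact/hball_reflect.
by rewrite enorm_reflect mxE eqxx; ring.
Qed.

End reflection.

Section monotonicity.
Context {R : realType} {n : nat}.
Implicit Types (x y z : 'rV[R]_n).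

Lemma arcosh_ge0 (t : R) : 1 <= t -> 0 <= arcosh t.
Proof.
move=> t1; apply: ln_ge0; have := sqrtr_ge0 (t ^+ 2 - 1); lra.
Qed.

Lemma arcosh_le (s t : R) : 1 <= s -> s <= t -> arcosh s <= arcosh t.
Proof.
move=> s1 st.
have h : Num.sqrt (s ^+ 2 - 1) <= Num.sqrt (t ^+ 2 - 1).
  by apply: ler_wsqrtr; rewrite lerB// lerXn2r ?nnegrE; lra.
have h0 := sqrtr_ge0 (s ^+ 2 - 1).
by rewrite ler_ln ?posrE; lra.
Qed.

Variable u : R -> R.
Hypothesis udec : forall r s : R, 0 <= r -> r < s -> u s < u r.

Lemma profile_noninc (r s : R) : 0 <= r -> r <= s -> u s <= u r.
Proof.
move=> r0; rewrite le_eqVlt => /orP[/eqP->//|rs].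
by apply: ltW; exact: udec.
Qed.

Lemma radial_at_antitone x y z : hball x -> hball y -> hball z ->
  cosh_hdist x z <= cosh_hdist y z -> radial_at u z y <= radial_at u z x.
Proof.
move=> bx by_ bz h; apply: profile_noninc.
  exact/arcosh_ge0/cosh_hdist_ge1.
by apply: arcosh_le => //; exact: cosh_hdist_ge1.
Qed.

End monotonicity.

(** * Estimates on a box near the boundary *)

Section boundary_box.
Context {R : realType} {n : nat}.
Implicit Types (x y z : 'rV[R]_n).
Local Notation gap x := (1 - enorm x ^+ 2).

(** The box is centred at the point of norm [xi] on the ray through [z]. The squares of the norms
    differ by at most 3 n r, and dividing by |x| + xi >= 1 / 2 gives 6 n r. *)
Lemma box_radius x z (xi r : R) : 0 < enorm z -> 1 / 2 <= xi -> xi <= 1 ->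
  0 <= r -> r <= 1 -> (forall k, `|x 0 k - xi / enorm z * z 0 k| <= r) ->
  `|enorm x - xi| <= 6 * n%:R * r.
Proof.
move=> z0 xih xi1 r0 r1 xa.
pose a (k : 'I_n) : R := xi / enorm z * z 0 k.
have aE : \sum_(k < n) a k ^+ 2 = xi ^+ 2.
  under eq_bigr => k _ do rewrite exprMn.
  by rewrite -mulr_sumr -sqr_enorm; field; rewrite gt_eqF.
have q0 : 0 <= xi / enorm z by rewrite divr_ge0 ?(ltW z0)//; lra.
have ak k : `|a k| <= 1.
  rewrite normrM (ger0_norm q0).
  apply: (@le_trans _ _ (xi / enorm z * enorm z)); last by rewrite divfK ?gt_eqF.
  by rewrite ler_wpM2l// coord_le_enorm.
have s2 : `|enorm x ^+ 2 - xi ^+ 2| <= 3 * n%:R * r.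
  rewrite -aE sqr_enorm -sumrB.
  apply: (le_trans (ler_norm_sum _ _ _)).
  rewrite (_ : 3 * n%:R * _ = \sum_(k < n) 3 * r); last first.
    by rewrite sumr_const card_ord -[RHS]mulr_natr; ring.
  apply: ler_sum => k _; rewrite subr_sqr normrM mulrC; apply: ler_pM => //.
  rewrite (_ : x 0 k + a k = (x 0 k - a k) + 2 * a k); last by ring.
  apply: (le_trans (ler_normD _ _)); rewrite normrM ger0_norm//.
  by have := xa k; have := ak k; rewrite -/(a k); lra.
have := s2; rewrite subr_sqr normrM (ger0_norm (_ : 0 <= enorm x + xi)); last first.
  by rewrite addr_ge0 ?enorm_ge0//; lra.
have := enorm_ge0 x; move: (enorm x) (`|enorm x - xi|) (normr_ge0 (enorm x - xi)).
by move=> s D D0 s0; nra.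
Qed.

Lemma box_distance x z (xi r : R) : 0 < enorm z -> enorm z <= xi ->
  (forall k, `|x 0 k - xi / enorm z * z 0 k| <= r) ->
  enorm (x - z) ^+ 2 <= n%:R * (r + (xi - enorm z)) ^+ 2.
Proof.
move=> z0 zxi xa.
rewrite sqr_enorm (_ : n%:R * _ = \sum_(k < n) (r + (xi - enorm z)) ^+ 2); last first.
  by rewrite sumr_const card_ord -[RHS]mulr_natr mulrC.
have q0 : 0 <= (xi - enorm z) / enorm z by rewrite divr_ge0 ?subr_ge0// ltW.
apply: ler_sum => k _; rewrite -[leLHS]real_normK ?num_real//.
have h : `|(x - z) 0 k| <= r + (xi - enorm z).
  rewrite (_ : (x - z) 0 k = (x 0 k - xi / enorm z * z 0 k) + (xi - enorm z) / enorm z * z 0 k); last first.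
    by rewrite !mxE; field; rewrite gt_eqF.
  apply: (le_trans (ler_normD _ _)); apply: lerD => //.
  rewrite normrM (ger0_norm q0).
  apply: (@le_trans _ _ ((xi - enorm z) / enorm z * enorm z)); last by rewrite divfK ?gt_eqF.
  by rewrite ler_wpM2l// coord_le_enorm.
by rewrite lerXn2r ?nnegrE// (le_trans _ h).
Qed.

Lemma cosh_hdist_ub x z (eta d D : R) : hball x -> 0 < eta -> 0 < d ->
  eta * d / 2 <= 1 - enorm x -> enorm z = 1 - d -> d <= 1 -> 0 <= D ->
  enorm (x - z) ^+ 2 <= D * (2 * d) ^+ 2 ->
  cosh_hdist x z <= 1 + 16 * D / eta.
Proof.
move=> bx eta0 d0 xd zd d1 D0 xz; have x0 := enorm_ge0 x.
rewrite /cosh_hdist zd lerD2l.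
have ed : 0 < eta * d / 2 by rewrite divr_gt0// mulr_gt0.
have gx : eta * d / 2 <= gap x by move: x0 xd ed; move: (enorm x) => s; nra.
have gz : d <= 1 - (1 - d) ^+ 2 by nra.
rewrite ler_pdivrMr; last by rewrite mulr_gt0//; [exact: lt_le_trans gx|exact: lt_le_trans gz].
apply: (@le_trans _ _ (16 * D / eta * (eta * d / 2 * d))).
  rewrite (_ : _ * (eta * d / 2 * d) = 2 * (D * (2 * d) ^+ 2)); last by field; rewrite gt_eqF.
  by rewrite ler_pM2l.
apply: ler_wpM2l; first by rewrite divr_ge0 ?(ltW eta0)// mulr_ge0.
by apply: ler_pM; rewrite ?(ltW d0) ?(ltW ed).
Qed.

(** The reflected point stays at a fixed Euclidean distance from [z], since its squared distance
    contains 4 x_j z_j >= 2 kappa^2, while the gap of [z] is at most 2 d; hence the growth like 1 /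
    d. *)
Lemma cosh_hdist_reflect_lb (j : 'I_n) x z (kappa d : R) : hball x -> hball z ->
  0 < kappa -> 0 < d -> enorm z = 1 - d ->
  x 0 j <= - (kappa / 2) -> z 0 j <= - kappa ->
  kappa ^+ 2 / d <= cosh_hdist (coord_refl j x) z.
Proof.
move=> bx bz k0 d0 zd xj zj.
have [gx gz] := (hball_gap bx, hball_gap bz).
have w1 : gap x <= 1 by rewrite gerBl sqr_ge0.
have t1 : gap z <= 2 * d by rewrite zd; nra.
have gg : gap x * gap z <= 2 * d.
  by rewrite -[leRHS]mul1r; apply: ler_pM => //; exact: ltW.
have D0 := sqr_ge0 (enorm (x - z)).
have xz : kappa ^+ 2 / 2 <= x 0 j * z 0 j.
  by move: (x 0 j) (z 0 j) xj zj => a b; nra.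
rewrite /cosh_hdist enorm_reflect sqr_enorm_reflectB.
apply: (@le_trans _ _ (2 * kappa ^+ 2 / (gap x * gap z))).
  rewrite -mulrA mulrCA ler_wpM2l ?sqr_ge0//.
  by rewrite ler_pdivlMr ?mulr_gt0// mulrC ler_pdivrMr.
rewrite -[leLHS]add0r; apply: lerD => //.
apply: ler_wpM2r; first by rewrite invr_ge0 mulr_ge0// ltW.
by rewrite ler_wpM2l//; have := sqr_ge0 kappa; clear -D0 xz; lra.
Qed.

Lemma rho_lb x (d : R) : hball x -> 0 < d -> 1 - enorm x <= 2 * d ->
  1 / 2 <= rho x * d.
Proof.
move=> bx d0 xd; have g := hball_gap bx; have x0 := enorm_ge0 x.
rewrite /rho mulrAC ler_pdivlMr//.
have x1 : enorm x < 1 by [].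
by move: (enorm x) xd x0 g x1 => s; nra.
Qed.

End boundary_box.

Section symmetrised_integrand.
Context {R : realType} {n : nat}.
Variables (p lam chi1 chi2 : R).
Hypotheses (n3 : (3 <= n)%N) (p1 : 1 < p) (c0 : 0 < decay_rate n lam).
Hypotheses (chi10 : 0 < chi1) (chi20 : 0 < chi2).
Local Notation c := (decay_rate n lam).

Definition sym_integrand (u : R -> R) (j : 'I_n) (z x : 'rV[R]_n) : R :=
  (radial_at u z x `^ p - radial_at u z (coord_refl j x) `^ p) *
  vfield j (radial_at u 0) x * rho x ^+ n.

Lemma sym_integrand_ge0 u j z x : ground_state n p lam u ->
  sharp_decay n lam chi1 chi2 u -> hball z -> z 0 j <= 0 -> hball x ->
  0 <= sym_integrand u j z x.
Proof.
move=> gs sd bz zj bx; have [_ CU _ udec _] := gs.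
have P := ground_state_profile j n3 gs sd.
have brx : hball (coord_refl j x) by exact/hball_reflect.
have [gx gz] := (hball_gap bx, hball_gap bz).
rewrite /sym_integrand mulr_ge0//; last first.
  by rewrite exprn_ge0// /rho divr_ge0// ltW.
rewrite (vfield_radial _ CU)//.
have [->|x0] := eqVneq x 0; first by rewrite mxE mul0r !mulr0.
have s0 : 0 < enorm x.
  rewrite lt_neqAle enorm_ge0 andbT eq_sym.
  by apply: contra x0 => /eqP/enorm0_eq0 ->.
have s01 : 0 < enorm x < 1 by rewrite s0.
have F0 := profile_derive_le0 P s01.
have U1 := radial_at_ge0 chi10 sd c0 bx bz.
have U2 := radial_at_ge0 chi10 sd c0 brx bz.
(* The two values differ by a term with the sign of x_j z_j. With z_j <= 0 the difference of the
   powers of U thus has the sign of -x_j, which is also the sign of the vector field. *)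
have cE : cosh_hdist (coord_refl j x) z = cosh_hdist x z +
    8 * (x 0 j * z 0 j) / ((1 - enorm x ^+ 2) * (1 - enorm z ^+ 2)).
  rewrite /cosh_hdist sqr_enorm_reflectB enorm_reflect; ring.
have W0 : 0 <= (1 - enorm x ^+ 2) * - axis_derivative j u (enorm x) / enorm x.
  by rewrite divr_ge0 ?enorm_ge0// mulr_ge0 ?oppr_ge0// ltW.
suff h : 0 <= ((1 - enorm x ^+ 2) * - axis_derivative j u (enorm x) / enorm x) *
   (- x 0 j * (radial_at u z x `^ p - radial_at u z (coord_refl j x) `^ p)).
  apply: le_trans h _; rewrite le_eqVlt; apply/orP; left; apply/eqP.
  move: (radial_at u z x `^ p) (radial_at u z (coord_refl j x) `^ p) => A B.
  move: (axis_derivative j u (enorm x)) (x 0 j) (enorm x) => F y s; ring.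
apply: mulr_ge0 => //.
have pp : 0 <= p := ltW (lt_trans ltr01 p1).
have [xj|xj] := leP 0 (x 0 j).
  apply: mulr_le0; first by rewrite oppr_le0.
  rewrite subr_le0; apply: ge0_ler_powR; rewrite ?nnegrE//.
  apply: (radial_at_antitone udec) => //; rewrite cE gerDl.
  by rewrite pmulr_lle0 ?invr_gt0 ?mulr_gt0// pmulr_rle0// mulr_ge0_le0.
apply: mulr_ge0; first by rewrite oppr_ge0 ltW.
rewrite subr_ge0; apply: ge0_ler_powR; rewrite ?nnegrE//.
apply: (radial_at_antitone udec) => //; rewrite cE lerDl.
apply: divr_ge0; last by rewrite mulr_ge0// ltW.
by rewrite pmulr_rge0// mulr_le0// ltW.
Qed.

End symmetrised_integrand.

(** The factor [(1 - enorm z) ^+ n] is the volume of the box up to a constant; it compensates the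
    density, which is of order (1 - |z|)^(-n) there. *)
Lemma sym_integrand_lb (R : realType) (n : nat) (p lam chi1 chi2 kappa : R) :
  (3 <= n)%N -> 1 < p -> 0 < decay_rate n lam -> 0 < chi1 -> 0 < chi2 ->
  0 < kappa ->
  exists delta0 e C : R, [/\ 0 < delta0, 0 < e, 0 < C &
   forall u, ground_state n p lam u -> sharp_decay n lam chi1 chi2 u ->
   forall (j : 'I_n) (z : 'rV[R]_n), hball z -> z 0 j <= - kappa ->
     1 - enorm z < delta0 ->
   exists a : 'I_n -> R, forall x : 'rV[R]_n,
     (forall k, `|x 0 k - a k| <= e * (1 - enorm z)) ->
     hball x /\ C * (1 - enorm z) `^ decay_rate n lam <=
                sym_integrand p u j z x * (1 - enorm z) ^+ n].
Proof.
move=> n3 p1 c0 chi10 chi20 kap0; set c := decay_rate n lam in c0 *.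
have [eta [eps [al [/andP[eta0 etah] /andP[eps0 epse] al0 hF]]]] :=
  @profile_derive_lb R n.-2 p lam c chi1 chi2 p1 c0 chi10 chi20.
have [N NE] : {N : R | N = n%:R} by exists n%:R.
have N1 : 1 <= N by rewrite NE ler1n; lia.
(* By [box_radius], a box of half-side e d changes the Euclidean radius by at most eps d, the length
   on which the derivative is controlled. *)
have [e eE] : {e : R | e = eps / (6 * N)} by exists (eps / (6 * N)).
have e0 : 0 < e by rewrite eE divr_gt0//; lra.
have e6 : 6 * N * e = eps by rewrite eE; field; lra.
have e1 : e <= 1 / 24.
  by rewrite eE ler_pdivrMr; nra.
have [K KE] : {K : R | K = 1 + 16 * N / eta} by exists (1 + 16 * N / eta).
have K1 : 1 <= K by rewrite KE lerDl divr_ge0//; lra.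
(* [K] bounds [cosh_hdist x z] on the box, so [mu] bounds U[z] there from below. *)
have [mu muE] : {mu : R | mu = chi1 * (2 * K) `^ (- c)} by exists (chi1 * (2 * K) `^ (- c)).
have mu0 : 0 < mu by rewrite muE mulr_gt0// powR_gt0//; lra.
have k20 : 0 < kappa ^+ 2 by rewrite exprn_gt0.
have [q qE] : {q : R | q = (mu / (2 * chi2)) `^ c^-1} by exists ((mu / (2 * chi2)) `^ c^-1).
have q0 : 0 < q by rewrite qE powR_gt0// divr_gt0// mulr_gt0.
(* The three bounds ensure that |z| >= 1 / 2, that x_j <= - kappa / 2 on the box, and that U[z] at
   the reflected point is at most mu / 2; the last is what determines [q]. *)
have [delta0 delta0E] : {delta0 : R | delta0 = Num.min (Num.min (1 / 2) (kappa / 4)) (kappa ^+ 2 * q)}.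
  by eexists.
have d00 : 0 < delta0.
  by rewrite delta0E !lt_min divr_gt0//= divr_gt0//= mulr_gt0.
have [mu' mu'E] : {mu' : R | mu' = mu `^ p - (mu / 2) `^ p} by eexists.
have mu'0 : 0 < mu'.
  rewrite mu'E subr_gt0; apply: gt0_ltr_powR; rewrite ?nnegrE; lra.
have [C CE] : {C : R | C = mu' * (eta * kappa / 4 * al) * (1 / 2) ^+ n} by eexists.
have C0 : 0 < C.
  by rewrite CE !mulr_gt0 ?exprn_gt0//; lra.
exists delta0, e, C; split => // u gs sd j z bz zj zd.
have [_ CU _ udec _] := gs.
have P := ground_state_profile j n3 gs sd.
have [d dE] : {d : R | d = 1 - enorm z} by eexists.
rewrite -dE in zd *.
have z1 : enorm z < 1 by [].
have zE : enorm z = 1 - d by rewrite dE; ring.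
have d0 : 0 < d by rewrite dE subr_gt0.
have [dh dk dq] : [/\ d < 1 / 2, d < kappa / 4 & d < kappa ^+ 2 * q].
  by move: zd; rewrite delta0E !lt_min => /andP[/andP[-> ->] ->].
have z0 : 0 < enorm z by clear -zE dh; lra.
have zh : 1 / 2 <= enorm z < 1 by rewrite z1 andbT; clear -zE dh; lra.
have [xi [zxi xid hxi]] := hF _ _ P (enorm z) zh.
rewrite -dE in xid hxi.
have etad : 0 < eta * d by rewrite mulr_gt0.
have xi1 : xi <= 1 by clear -etad xid; lra.
have xih : 1 / 2 <= xi by clear -zxi zE dh; lra.
have ed0 : 0 <= e * d by rewrite mulr_ge0// ltW.
have ed : e * d <= d / 24.
  by rewrite mulrC; apply: ler_wpM2l; [exact: ltW|rewrite -[leRHS]mul1r].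
exists (fun k => xi / enorm z * z 0 k) => x xa.
have ed1 : e * d <= 1 by clear -ed dh; lra.
have sxi := box_radius z0 xih xi1 ed0 ed1 xa.
rewrite (_ : 6 * n%:R * (e * d) = eps * d) in sxi; last by rewrite -NE -e6; ring.
have F1lb := hxi _ sxi.
have epsd : eps * d <= eta * d / 2.
  by rewrite mulrAC; apply: ler_wpM2r => //; exact: ltW.
have epsd4 : eps * d <= d / 4.
  by clear -d0 epsd etah; move: epsd; nra.
have [sl su] : xi - eps * d <= enorm x /\ enorm x <= xi + eps * d.
  by clear -sxi; move: sxi; rewrite ler_norml => /andP[? ?]; split; lra.
have gs1 : eta * d / 2 <= 1 - enorm x by clear -su epsd xid; lra.
have x1 : enorm x < 1 by clear -gs1 etad; lra.
have x0 : 0 < enorm x by clear -sl xih epsd4 dh; lra.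
have bx : hball x by [].
split=> //.
have [gx gz] := (hball_gap bx, hball_gap bz).
have brx : hball (coord_refl j x) by exact/hball_reflect.
have D2 : enorm (x - z) ^+ 2 <= N * (2 * d) ^+ 2.
  apply: (le_trans (box_distance z0 (ltW zxi) xa)); rewrite -NE.
  apply: ler_wpM2l; first by clear -N1; lra.
  have h0 : 0 <= e * d + (xi - enorm z) by clear -ed0 zxi; lra.
  have h1 : e * d + (xi - enorm z) <= 2 * d by clear -ed xi1 zE d0; lra.
  by rewrite lerXn2r ?nnegrE// (le_trans h0).
have TK : cosh_hdist x z <= K.
  rewrite KE; apply: (cosh_hdist_ub bx eta0 d0 gs1 zE _ _ D2).
    by clear -dh; lra.
  by clear -N1; lra.
have T1 := cosh_hdist_ge1 bx bz.
have U1 : mu <= radial_at u z x.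
  rewrite muE; apply: le_trans (radial_at_ge chi10 sd c0 bx bz).
  apply: ler_wpM2l; first exact: ltW.
  apply: powR_neg_le; last by rewrite oppr_le0 ltW.
    by clear -T1; lra.
  by rewrite ler_pM2l.
have xj : x 0 j <= - (kappa / 2).
  have := xa j; rewrite ler_norml => /andP[_ h].
  have r1 : 1 <= xi / enorm z by rewrite ler_pdivlMr// mul1r ltW.
  have aj : xi / enorm z * z 0 j <= z 0 j.
    by clear -r1 zj kap0; move: (xi / enorm z) (z 0 j) r1 zj => a b; nra.
  by clear -h aj zj ed dk kap0 d0; lra.
have T2 := cosh_hdist_reflect_lb bx bz kap0 d0 zE xj zj.
have U2 : radial_at u z (coord_refl j x) <= mu / 2.
  apply: (le_trans (radial_at_le chi20 sd c0 brx bz)).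
  have cN : - c <= 0 by rewrite oppr_le0 ltW.
  have h : cosh_hdist (coord_refl j x) z `^ (- c) <= mu / (2 * chi2).
    apply: (@le_trans _ _ ((kappa ^+ 2 / d) `^ (- c))).
      by apply: powR_neg_le => //; rewrite divr_gt0.
    apply: (@le_trans _ _ (q^-1 `^ (- c))).
      apply: powR_neg_le => //; first by rewrite invr_gt0.
      by rewrite ler_pdivlMr// mulrC ler_pdivrMr//; exact: ltW.
    rewrite -(@powR_inv1 _ q) ?(ltW q0)// -powRrM mulN1r opprK qE -powRrM mulVf ?gt_eqF//.
    by rewrite powRr1// divr_ge0 ?mulr_ge0 ?(ltW mu0) ?(ltW chi20).
  apply: (@le_trans _ _ (chi2 * (mu / (2 * chi2)))); first by rewrite ler_pM2l.
  by rewrite le_eqVlt; apply/orP; left; apply/eqP; field; rewrite gt_eqF.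
have Ur0 := radial_at_ge0 chi10 sd c0 brx bz.
have U0 := radial_at_ge0 chi10 sd c0 bx bz.
have pp : 0 <= p := ltW (lt_trans ltr01 p1).
have muh : 0 <= mu / 2 by rewrite divr_ge0// ltW.
have dU : mu' <= radial_at u z x `^ p - radial_at u z (coord_refl j x) `^ p.
  rewrite mu'E; apply: lerB; apply: ge0_ler_powR; rewrite ?nnegrE//.
  exact: ltW.
have [E EE] : {E : R | E = d `^ c} by eexists.
have E0 : 0 <= E by rewrite EE; exact: powR_ge0.
rewrite -EE in F1lb *.
have hV : eta * kappa / 4 * al * E <= vfield j (radial_at u 0) x.
  rewrite (vfield_radial _ CU)//.
  have h1 : kappa / 2 <= - x 0 j / enorm x.
    rewrite ler_pdivlMr//; clear -xj x1 x0 kap0.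
    by move: (x 0 j) (enorm x) xj x1 x0 => a s; nra.
  have F0 : 0 <= - axis_derivative j u (enorm x).
    by rewrite oppr_ge0; apply: (profile_derive_le0 P); rewrite x0.
  have gxd : eta * d / 2 <= 1 - enorm x ^+ 2.
    by clear -gs1 x0 x1; move: (enorm x) gs1 x0 x1 => s; nra.
  move: (axis_derivative j u (enorm x)) F1lb F0 => F F1lb F0.
  have h2 : eta / 2 * (al * E) <= (1 - enorm x ^+ 2) * - F.
    apply: (@le_trans _ _ (eta / 2 * (- F * d))).
      by apply: ler_wpM2l => //; rewrite divr_ge0// ltW.
    rewrite (_ : eta / 2 * _ = eta * d / 2 * (- F)); last by ring.
    exact: ler_wpM2r.
  rewrite (_ : _ * E = (eta / 2 * (al * E)) * (kappa / 2)); last by field.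
  rewrite (_ : (1 - enorm x ^+ 2) * F * (x 0 j / enorm x) =
    (1 - enorm x ^+ 2) * - F * (- x 0 j / enorm x)); last by ring.
  apply: ler_pM => //; last by rewrite divr_ge0// ltW.
  by rewrite mulr_ge0 ?divr_ge0 ?mulr_ge0 ?(ltW eta0) ?(ltW al0).
have hr : (1 / 2) ^+ n <= rho x ^+ n * d ^+ n.
  have rx : 0 <= rho x by rewrite /rho divr_ge0// ltW.
  have h2 : 0 <= 1 / 2 :> R by exact: divr_ge0.
  have rd := mulr_ge0 rx (ltW d0).
  rewrite -exprMn lerXn2r ?nnegrE//.
  apply: rho_lb => //.
  by clear -sl epsd4 d0 zxi zE; lra.
rewrite /sym_integrand -mulrA (_ : C * E = mu' * (eta * kappa / 4 * al * E) * (1 / 2) ^+ n); last first.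
  by rewrite CE; ring.
have V0 : 0 <= eta * kappa / 4 * al * E.
  by rewrite !mulr_ge0 ?invr_ge0 ?(ltW al0) ?(ltW eta0) ?(ltW kap0).
apply: ler_pM => //.
- by rewrite mulr_ge0// ltW.
- by apply: ler_pM => //; exact: ltW.
Qed.

(** * The integral *)

Section measurability.
Context {R : realType} {n : nat}.
Local Notation T := (measurableTypeR R).
Local Notation row t := (row_of_tuple t).
Implicit Types (t : n.-tuple T).

Definition tuple_ball : set (n.-tuple T) := [set t | hball (row t)].

Lemma row_tnth t i : row t 0 i = tnth t i.
Proof. by rewrite mxE. Qed.

Lemma measurable_sqr_dist (z : 'rV[R]_n) (P : pred 'I_n) :
  measurable_fun setT (fun t => \sum_(i < n | P i) (tnth t i - z 0 i) ^+ 2 : T).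
Proof.
have -> : (fun t => \sum_(i < n | P i) (tnth t i - z 0 i) ^+ 2) =
    (fun t => \sum_(i <- [seq i <- enum 'I_n | P i]) (tnth t i - z 0 i) ^+ 2).
  by apply/funext => t; rewrite big_filter big_enum_cond.
apply: measurable_sum => i; apply: measurable_funX.
by apply: measurable_funB => //; exact: measurable_tnth.
Qed.

Lemma measurable_sqr_enorm :
  measurable_fun setT (fun t => \sum_(i < n) tnth t i ^+ 2 : T).
Proof.
have := measurable_sqr_dist 0 xpredT.
by under eq_fun do under eq_bigr do rewrite mxE subr0.
Qed.

Lemma sqr_enorm_row t : enorm (row t) ^+ 2 = \sum_(i < n) tnth t i ^+ 2.
Proof. by rewrite sqr_enorm; apply: eq_bigr => i _; rewrite row_tnth. Qed.

Lemma measurable_sqrt_comp (f : n.-tuple T -> T) :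
  measurable_fun setT f -> measurable_fun setT (fun t => Num.sqrt (f t) : T).
Proof.
move=> mf; apply: (measurableT_comp (_ : measurable_fun setT (@Num.sqrt R : T -> T)) mf).
by apply: continuous_measurable_fun; exact: sqrt_continuous.
Qed.

Lemma measurable_chord (i : 'I_n) :
  measurable_fun setT (fun t => chord i (row t) : T).
Proof.
apply: measurable_sqrt_comp; apply: measurable_funB => //.
have := measurable_sqr_dist 0 [pred k | k != i].
by under eq_fun do under eq_bigr do rewrite mxE subr0 -row_tnth.
Qed.

Lemma measurable_tuple_ball : measurable tuple_ball.
Proof.
rewrite (_ : tuple_ball = [set: n.-tuple T] `&`
    (fun t => \sum_(i < n) tnth t i ^+ 2 : T) @^-1` `]-oo, (1 : R)[).
  by apply: measurable_sqr_enorm => //; exact: measurable_itv.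
rewrite setTI; apply/seteqP; split => t /=.
  by move/hball_sqr; rewrite in_itv/= -sqr_enorm sqr_enorm_row.
by rewrite in_itv/= -sqr_enorm_row sqr_enorm => /hball_sqr.
Qed.

Variables (p lam : R) (u : R -> R) (j : 'I_n).
Hypothesis gs : ground_state n p lam u.

Definition integrand (z x : 'rV[R]_n) : R :=
  radial_at u z x `^ p * vfield j (radial_at u 0) x * rho x ^+ n.

(** Measurability of [u] comes from its monotonicity: truncating the argument of [arcosh] at 1 makes
    [W] monotone on the whole line. The derivative of the profile is continuous on the open interval
    and extended by 0, and inverses are written as powers with exponent -1. *)
Lemma measurable_integrand (z : 'rV[R]_n) : hball z ->
  measurable_fun tuple_ball (fun t => integrand z (row t) : T).
Proof.
move=> bz; have [_ CU _ udec _] := gs.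
have gz := hball_gap bz.
pose W (r : R) : R := u (arcosh (Num.max 1 r)).
have mW : measurable_fun setT W.
  apply: nonincreasing_measurable => // r s rs.
  apply: (profile_noninc udec); first by apply: arcosh_ge0; rewrite le_max lexx.
  by apply: arcosh_le; [rewrite le_max lexx|rewrite ge_max !le_max lexx rs orbT].
pose F1 : T -> T := axis_derivative j u \_ `](- 1), 1[.
have mF1 : measurable_fun setT F1.
  apply/(measurable_restrictT _ (measurable_itv _)).
  apply: open_continuous_measurable_fun; first exact: interval_open.
  move=> s; rewrite inE/= in_itv/= => s1; exact: axis_derivative_continuous.
pose sq t : T := \sum_(i < n) tnth t i ^+ 2.
have msq : measurable_fun setT sq by exact: measurable_sqr_enorm.
pose ginv t : T := (1 - sq t) `^ (- 1).
have mg : measurable_fun setT (fun t => 1 - sq t : T) by exact: measurable_funB.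
have mginv : measurable_fun setT ginv by exact: measurable_powR_comp.
pose ch t : T := 1 + 2 * (\sum_(i < n) (tnth t i - z 0 i) ^+ 2) *
  (ginv t * (1 - enorm z ^+ 2)^-1).
have mch : measurable_fun setT ch.
  apply: measurable_funD => //; apply: measurable_funM.
    by apply: measurable_funM => //; exact: (measurable_sqr_dist z xpredT).
  exact: measurable_funM.
pose s t : T := Num.sqrt (sq t).
have ms : measurable_fun setT s by exact: measurable_sqrt_comp.
pose G t : T := W (ch t) `^ p * ((1 - sq t) * F1 (s t) * (tnth t j * s t `^ (- 1))) *
  (2 * ginv t) ^+ n.
have mG : measurable_fun setT G.
  apply: measurable_funM.
    apply: measurable_funM.
      by apply: measurable_powR_comp; exact: (measurableT_comp mW mch).
    apply: measurable_funM.
      exact: measurable_funM mg (measurableT_comp mF1 ms).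
    apply: measurable_funM; first exact: measurable_tnth.
    exact: measurable_powR_comp.
  by apply: measurable_funX; exact: measurable_funM.
apply: (eq_measurable_fun G); last exact: measurable_funTS.
move=> t /set_mem bt; have g := hball_gap (bt : hball (row t)).
have sqE : sq t = enorm (row t) ^+ 2 by rewrite sqr_enorm_row.
have sE : s t = enorm (row t) by rewrite /s sqE sqrtr_sqr ger0_norm ?enorm_ge0.
have gE : ginv t = (1 - enorm (row t) ^+ 2)^-1.
  by rewrite /ginv sqE powR_inv1 ?(ltW g).
have chE : ch t = cosh_hdist (row t) z.
  rewrite /ch /cosh_hdist gE -invfM; congr (1 + 2 * _ / _).
  by rewrite sqr_enorm; apply: eq_bigr => i _; rewrite !mxE.
rewrite /G /integrand chE gE sqE sE.
rewrite (vfield_radial _ CU)// row_tnth powR_inv1 ?enorm_ge0//.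
rewrite /F1 patchE mem_set; last first.
  rewrite /= in_itv/=; apply/andP; split; last exact: bt.
  by apply: lt_le_trans (enorm_ge0 _); lra.
by rewrite /W (max_idPr _)//; exact: cosh_hdist_ge1.
Qed.

Lemma row_tuple_refl t : row (tuple_refl j t) = coord_refl j (row t).
Proof. by apply/rowP => k; rewrite !mxE tnth_mktuple; case: eqP. Qed.

Lemma tuple_ball_refl t : tuple_ball (tuple_refl j t) <-> tuple_ball t.
Proof. by rewrite /tuple_ball/= row_tuple_refl; exact: hball_reflect. Qed.

Lemma integrand_reflect (z x : 'rV[R]_n) : hball x ->
  integrand z (coord_refl j x) = - integrand (coord_refl j z) x.
Proof.
move=> bx; have [_ CU _ _ _] := gs.
by rewrite /integrand radial_at_reflect vfield_reflect// rho_reflect mulrN mulNr.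
Qed.

Lemma integrand_sym (z x : 'rV[R]_n) : hball x ->
  integrand z x + integrand z (coord_refl j x) = sym_integrand p u j z x.
Proof.
move=> bx; have [_ CU _ _ _] := gs.
rewrite /integrand vfield_reflect// rho_reflect /sym_integrand.
move: (radial_at u z x `^ p) (radial_at u z (coord_refl j x) `^ p) => A B.
by move: (vfield _ _ _) (rho x ^+ n) => V r; ring.
Qed.

End measurability.

(** * Reflection symmetry of the integral *)

Section integral_bounds.
Context {R : realType} {n : nat}.
Local Notation T := (measurableTypeR R).
Local Notation leb := (@lebesgue_tuple R n).
Local Notation row t := (row_of_tuple t).
Variables (p lam : R) (u : R -> R) (j : 'I_n).
Hypothesis gs : ground_state n p lam u.
Implicit Types (z : 'rV[R]_n) (t : n.-tuple T).

Definition ball_integrand z : n.-tuple T -> T :=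
  (fun t => integrand p u j z (row t)) \_ (@tuple_ball R n).

Lemma ball_integrand_in z t : tuple_ball t ->
  ball_integrand z t = integrand p u j z (row t).
Proof. by move=> bt; rewrite /ball_integrand patchE mem_set. Qed.

Lemma ball_integrand_out z t : ~ tuple_ball t -> ball_integrand z t = 0.
Proof. by move=> bt; rewrite /ball_integrand patchE memNset. Qed.

Lemma measurable_ball_integrand z : hball z ->
  measurable_fun setT (ball_integrand z).
Proof.
move=> bz; apply/(measurable_restrictT _ (@measurable_tuple_ball R n)).
exact: (measurable_integrand _ gs).
Qed.

Lemma hintegralE z : hintegral (fun x => radial_at u z x `^ p * vfield j (radial_at u 0) x)
  = (\int[leb]_t (ball_integrand z t)%:E)%E.
Proof.
rewrite /hintegral /integral_Rn integral_mkcond; apply: eq_integral => t _.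
by rewrite /ball_integrand !patchE; case: ifP.
Qed.

Opaque ball_integrand.

Lemma ball_integrand_refl z t :
  ball_integrand z (tuple_refl j t) = - ball_integrand (coord_refl j z) t.
Proof.
have [bt|nbt] := pselect (tuple_ball t).
  rewrite (ball_integrand_in _ bt) ball_integrand_in; last exact/tuple_ball_refl.
  by rewrite row_tuple_refl (integrand_reflect _ gs).
rewrite (ball_integrand_out _ nbt) ball_integrand_out ?oppr0//.
by move/tuple_ball_refl.
Qed.

Lemma integral_ball_integrand_reflect z : hball z ->
  leb.-integrable setT (EFin \o ball_integrand (coord_refl j z)) ->
  (\int[leb]_t (ball_integrand (coord_refl j z) t)%:E =
   - \int[leb]_t (ball_integrand z t)%:E)%E.
Proof.
move=> bz h; have mf : measurable_fun setT (EFin \o ball_integrand z).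
  by apply/measurable_EFinP; exact: measurable_ball_integrand.
have h1 : (\int[leb]_t (ball_integrand z t)%:E =
    \int[leb]_t - (EFin \o ball_integrand (coord_refl j z)) t)%E.
  transitivity (\int[leb]_t (EFin \o ball_integrand z) (tuple_refl j t))%E.
    exact: esym (integral_tuple_refl j mf).
  by apply: eq_integral => t _ /=; rewrite ball_integrand_refl EFinN.
have h2 := integralN (integrable_add_def measurableT h).
exact: (esym (etrans (congr1 oppe (etrans h1 h2)) (oppeK _))).
Qed.

Lemma ball_integrand_sym z t :
  ball_integrand z t - ball_integrand (coord_refl j z) t =
  ((fun t => sym_integrand p u j z (row t)) \_ (@tuple_ball R n)) t.
Proof.
rewrite -ball_integrand_refl patchE.
have [bt|nbt] := pselect (tuple_ball t).
  rewrite (ball_integrand_in _ bt) ball_integrand_in; last exact/tuple_ball_refl.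
  by rewrite row_tuple_refl (integrand_sym _ gs)// mem_set.
rewrite (ball_integrand_out _ nbt) ball_integrand_out ?addr0; last first.
  by move/tuple_ball_refl.
by rewrite memNset.
Qed.

Lemma integral_ball_integrand_sym z : hball z ->
  leb.-integrable setT (EFin \o ball_integrand z) ->
  leb.-integrable setT (EFin \o ball_integrand (coord_refl j z)) ->
  (\int[leb]_t (ball_integrand z t)%:E + \int[leb]_t (ball_integrand z t)%:E =
   \int[leb]_t (ball_integrand z t - ball_integrand (coord_refl j z) t)%:E)%E.
Proof.
move=> bz iz iz'; have E := integral_ball_integrand_reflect bz iz'.
have E' := esym (etrans (congr1 oppe E) (oppeK _)).
exact: (etrans (congr1 (adde _) E') (esym (integralB measurableT iz iz'))).
Qed.

End integral_bounds.

Opaque ball_integrand.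

Lemma kernel_at_row (R : realType) k (i : 'I_k.+1) (h b g : R)
    (A : k.+1.-tuple (measurableTypeR R) -> measurableTypeR R) (z : 'rV[R]_k.+1) t :
  kernel_at i h b g (A t) (row_of_tuple t) z =
  slice_kernel i h b g A (fun l => z 0 l) t.
Proof.
rewrite /kernel_at /slice_kernel row_tnth; congr (_ * _).
by apply: eq_bigr => l _; rewrite row_tnth.
Qed.

Lemma chord_ins (R : realType) k (i : 'I_k.+1) (y : k.-tuple (measurableTypeR R)) s :
  chord i (row_of_tuple (tuple_ins i y s)) = chord i (row_of_tuple (tuple_ins i y 0)).
Proof.
rewrite /chord; congr (Num.sqrt (1 - _)); apply: eq_bigr => l li.
rewrite !row_tnth; case: (unliftP i l) li => [m ->|->]; last by rewrite eqxx.
by rewrite !tnth_ins_lift.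
Qed.

(** e^(-d) = (1 - s) / (1 + s), and (1 + s)^2 <= 4. *)
Lemma gap_le_exp_hdist (R : realType) n (c : R) (z : 'rV[R]_n) : 0 < c -> hball z ->
  (1 - enorm z ^+ 2) `^ c <= 4 `^ c * expR (- (c * hdist z 0)).
Proof.
move=> c0 bz; have z0 := enorm_ge0 z; have z1 : enorm z < 1 := bz.
have q0 : 0 <= (1 - enorm z) / (1 + enorm z) by rewrite divr_ge0//; lra.
rewrite expR_hdist0// -powRM//.
have g := hball_gap bz.
apply: ge0_ler_powR; rewrite ?nnegrE ?(ltW c0) ?(ltW g)//.
  by rewrite mulr_ge0.
rewrite mulrA ler_pdivlMr; last lra.
have s1 : 0 <= 1 - enorm z by rewrite subr_ge0 ltW.
have s2 : 0 <= 4 - (1 + enorm z) ^+ 2 by nra.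
by have := mulr_ge0 s1 s2; lra.
Qed.

(** Bounding the absolute value yields both the upper estimate and the integrability on which the
    symmetrisation rests. No condition relates [z] to [j], so it also applies to the reflected
    point. *)
Lemma ball_integral_ub (R : realType) (k : nat) (p lam chi1 chi2 : R) :
  (3 <= k.+1)%N -> 1 < p -> k.+1%:R - 1 < 2 * decay_rate k.+1 lam ->
  0 < chi1 -> 0 < chi2 ->
  exists2 C : R, 0 <= C & forall u,
    ground_state k.+1 p lam u -> sharp_decay k.+1 lam chi1 chi2 u ->
    forall (j : 'I_k.+1) (z : 'rV[R]_k.+1), hball z ->
      (\int[@lebesgue_tuple R k.+1]_t `|ball_integrand p u j z t|%:E <=
        (C * expR (- (decay_rate k.+1 lam * hdist z 0)))%:E)%E.
Proof.
move=> k3 p1 hc chi10 chi20.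
have [b [g [C [b1 b0 g0 C0 hC]]]] := integrand_ub k3 p1 hc chi10 chi20.
have [K K0 hK] := @integral_slice_kernel R k b g b1 b0 g0.
set c := decay_rate k.+1 lam in hc hC *.
have c0 : 0 < c.
  have : 1 <= k.+1%:R :> R by rewrite ler1n.
  by clear -hc; lra.
exists (C * 4 `^ c * (k.+1%:R * (2 * K))); first by rewrite !mulr_ge0 ?powR_ge0.
move=> u gs sd j z bz; have gz := hball_gap bz.
set h := 1 - enorm z ^+ 2 in gz hC.
pose T := measurableTypeR R.
pose A (i : 'I_k.+1) (t : k.+1.-tuple T) : T := chord i (row_of_tuple t).
have mA i : measurable_fun setT (A i) by exact: measurable_chord.
have mNA i : measurable_fun setT (fun t => - A i t : T).
  exact: (measurableT_comp (@oppr_measurable R setT) (mA i)).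
pose S1 i t := slice_kernel i h b g (A i) (fun l => z 0 l) t.
pose S2 i t := slice_kernel i h b g (fun t => - A i t : T) (fun l => z 0 l) t.
have S10 i t : 0 <= S1 i t by exact: slice_kernel_ge0.
have S20 i t : 0 <= S2 i t by exact: slice_kernel_ge0.
have mS1 i : measurable_fun setT (EFin \o S1 i).
  by apply/measurable_EFinP; exact: measurable_slice_kernel.
have mS2 i : measurable_fun setT (EFin \o S2 i).
  by apply/measurable_EFinP; exact: measurable_slice_kernel.
have mS i : measurable_fun setT (fun t => (S1 i t)%:E + (S2 i t)%:E)%E.
  exact: (emeasurable_funD (mS1 i) (mS2 i)).
have mSS : measurable_fun setT (fun t => \sum_(i < k.+1) ((S1 i t)%:E + (S2 i t)%:E))%E.
  by apply: emeasurable_sum => i; exact: mS.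
have Ch0 : 0 <= C * h `^ c by rewrite mulr_ge0 ?powR_ge0.
apply: (@le_trans _ _ (\int[@lebesgue_tuple R k.+1]_t
   ((C * h `^ c)%:E * \sum_(i < k.+1) ((S1 i t)%:E + (S2 i t)%:E)))%E).
  apply: ge0_le_integral => //.
  - apply/measurable_EFinP; apply: measurableT_comp => //.
    exact: (measurable_ball_integrand _ gs).
  - exact: measurable_funeM.
  move=> t _; rewrite (eq_bigr (fun i => (S1 i t + S2 i t)%:E)); last by move=> i _; rewrite EFinD.
  rewrite sumEFin -EFinM lee_fin.
  have [bt|nbt] := pselect (tuple_ball t); last first.
    rewrite ball_integrand_out// normr0 mulr_ge0//.
    by apply: sumr_ge0 => i _; exact: addr_ge0.
  rewrite ball_integrand_in//.
  apply: (le_trans (hC u gs sd j (row_of_tuple t) z bt bz)).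
  rewrite ler_wpM2l// ler_sum// => i _.
  by rewrite (kernel_at_row i h b g (A i)) (kernel_at_row i h b g (fun t => - A i t : T)).
rewrite ge0_integralZl//; last by move=> t _; apply: sume_ge0 => i _; rewrite -EFinD lee_fin addr_ge0.
rewrite ge0_integral_sum//; last by move=> i t _; rewrite -EFinD lee_fin addr_ge0.
have hS i : (\int[@lebesgue_tuple R k.+1]_t ((S1 i t)%:E + (S2 i t)%:E) <= (2 * K)%:E)%E.
  rewrite (ge0_integralD _ measurableT _ (mS1 i) _ (mS2 i)); last 2 first.
  - by move=> t _ /=; rewrite lee_fin.
  - by move=> t _ /=; rewrite lee_fin.
  rewrite mulrDl mul1r EFinD; apply: leeD; apply: hK => //.
    by move=> y s; exact: chord_ins.
  by move=> y s; rewrite /A chord_ins.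
apply: (@le_trans _ _ ((C * h `^ c)%:E * (k.+1%:R * (2 * K))%:E)%E).
  apply: lee_wpmul2l; first by rewrite lee_fin.
  apply: (@le_trans _ _ (\sum_(i < k.+1) (2 * K)%:E)%E).
    by apply: lee_sum => i _; exact: hS.
  by rewrite sumEFin sumr_const card_ord -[X in (X%:E <= _)%E]mulr_natr mulrC.
rewrite -EFinM lee_fin.
have hh := gap_le_exp_hdist c0 bz; rewrite -/h in hh.
rewrite (_ : C * 4 `^ c * _ * _ = C * (4 `^ c * expR (- (c * hdist z 0))) * (k.+1%:R * (2 * K))); last by ring.
apply: ler_wpM2r; first by rewrite !mulr_ge0.
exact: ler_wpM2l.
Qed.

Lemma ball_integral_lb (R : realType) (n : nat) (p lam chi1 chi2 kappa : R) :
  (3 <= n)%N -> 1 < p -> 0 < decay_rate n lam -> 0 < chi1 -> 0 < chi2 ->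
  0 < kappa ->
  exists delta0 C : R, [/\ 0 < delta0, 0 < C & forall u,
    ground_state n p lam u -> sharp_decay n lam chi1 chi2 u ->
    forall (j : 'I_n) (z : 'rV[R]_n), hball z -> z 0 j <= - kappa ->
      1 - enorm z < delta0 ->
      (@lebesgue_tuple R n).-integrable setT (EFin \o ball_integrand p u j z) ->
      (@lebesgue_tuple R n).-integrable setT
        (EFin \o ball_integrand p u j (coord_refl j z)) ->
      ((C * expR (- (decay_rate n lam * hdist z 0)))%:E <=
        \int[@lebesgue_tuple R n]_t (ball_integrand p u j z t)%:E)%E].
Proof.
move=> n3 p1 c0 chi10 chi20 k0.
have [delta0 [e [C [d00 e0 C0 hC]]]] := sym_integrand_lb n3 p1 c0 chi10 chi20 k0.
(* The box has side 2 e d, and symmetrising produces twice the integral. *)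
exists delta0, (C * (2 * e) ^+ n / 2); split => //.
  by rewrite divr_gt0// mulr_gt0// exprn_gt0// mulr_gt0.
move=> u gs sd j z bz zj zd iz iz'.
set c := decay_rate n lam in c0 hC *.
have [a ha] := hC u gs sd j z bz zj zd.
have z0 := enorm_ge0 z; have z1 : enorm z < 1 := bz.
have Ed : expR (- (c * hdist z 0)) <= (1 - enorm z) `^ c.
  rewrite expR_hdist0//; apply: ge0_ler_powR; rewrite ?nnegrE ?(ltW c0) ?subr_ge0 ?(ltW z1)//.
    by rewrite divr_ge0 ?subr_ge0 ?(ltW z1)//; lra.
  by rewrite ler_pdivrMr; [rewrite ler_peMr|]; lra.
have [d dE] : {d : R | d = 1 - enorm z} by eexists.
rewrite -dE in ha Ed zd.
have d0 : 0 < d by rewrite dE subr_gt0.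
have rfin : (\int[@lebesgue_tuple R n]_t (ball_integrand p u j z t)%:E)%E \is a fin_num.
  exact: (integrable_fin_num measurableT iz).
have hr := etrans (f_equal2 adde (fineK rfin) (fineK rfin))
  (integral_ball_integrand_sym gs bz iz iz').
rewrite -(fineK rfin) lee_fin; set r := fine _ in hr *.
pose Q := @tuple_box R n a (e * d).
have mQ : measurable Q by exact: measurable_tuple_box.
have dn0 : 0 < d ^+ n by rewrite exprn_gt0.
(* A lower bound for the symmetrised integrand on the box [Q]; outside [Q] only its nonnegativity is
   used. *)
pose m : R := C * d `^ c / d ^+ n.
have m0 : 0 <= m by rewrite divr_ge0 ?mulr_ge0 ?powR_ge0// ltW.
have mz : measurable_fun setT (fun t => (ball_integrand p u j z t - ball_integrand p u j (coord_refl j z) t)%:E).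
  apply/measurable_EFinP; apply: measurable_funB; apply: (measurable_ball_integrand _ gs) => //.
  exact/hball_reflect.
have h : ((m * (2 * (e * d)) ^+ n)%:E <= \int[@lebesgue_tuple R n]_t
    (ball_integrand p u j z t - ball_integrand p u j (coord_refl j z) t)%:E)%E.
  rewrite EFinM -(@lebesgue_tuple_box R n a); last by rewrite mulr_ge0// ltW.
  have mI : measurable_fun setT (EFin \o (\1_Q : n.-tuple (measurableTypeR R) -> R)).
    by apply/measurable_EFinP; exact: measurable_indic.
  have -> : lebesgue_tuple (tuple_box a (e * d)) =
      (\int[@lebesgue_tuple R n]_t (EFin \o \1_Q) t)%E.
    by rewrite /= integral_indic// setIT.
  rewrite -(ge0_integralZl _ measurableT mI); last 2 first.
  - by move=> t _; rewrite lee_fin.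
  - by rewrite lee_fin.
  apply: ge0_le_integral => //.
  - by move=> t _; rewrite -EFinM lee_fin mulr_ge0.
  - exact: measurable_funeM.
  move=> t _; rewrite -EFinM lee_fin (ball_integrand_sym _ gs) patchE.
  have [tQ|tQ] := pselect (Q t).
    have [|bt ht] := ha (row_of_tuple t).
      by move=> i; rewrite row_tnth; exact: tQ.
    rewrite mem_set// indicE mem_set//= mulr1 /m ler_pdivrMr//.
  rewrite indicE memNset//= mulr0.
  case: ifPn => // /set_mem bt.
  apply: (sym_integrand_ge0 n3 p1 c0 chi10 gs sd bz) => //.
  by apply: (le_trans zj); rewrite oppr_le0 ltW.
have {}h : m * (2 * (e * d)) ^+ n <= r + r by move: h; rewrite -hr lee_fin.
have E2 : m * (2 * (e * d)) ^+ n = C * (2 * e) ^+ n * d `^ c.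
  by rewrite /m mulrA exprMn; field; rewrite gt_eqF.
rewrite E2 in h.
apply: (@le_trans _ _ (C * (2 * e) ^+ n / 2 * d `^ c)).
  by apply: ler_wpM2l => //; rewrite divr_ge0// mulr_ge0 ?exprn_ge0 ?mulr_ge0// ltW.
by clear -h; lra.
Qed.

Theorem lemma4p4 (R : realType) (n : nat) (p lambda : R)
  (hn : (3 <= n)%N) (hp : 1 < p)
  (hcase :
    (p < (n%:R + 2) / (n%:R - 2) /\ lambda < (n%:R - 1) ^+ 2 / 4) \/
    [/\ (4 <= n)%N, p = (n%:R + 2) / (n%:R - 2),
        n%:R * (n%:R - 2) / 4 < lambda & lambda < (n%:R - 1) ^+ 2 / 4])
  (chi1 chi2 : R) (hchi1 : 0 < chi1) (hchi2 : 0 < chi2)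
  (kappa : R) (hkappa0 : 0 < kappa) (hkappa1 : kappa < 1) :
  exists delta0 C : R, [/\ 0 < delta0, 1 <= C &
    forall u : R -> R,
      ground_state n p lambda u -> sharp_decay n lambda chi1 chi2 u ->
      forall (j : 'I_n) (z : 'rV[R]_n),
        hball z -> kappa <= `|z 0 j| -> 1 - enorm z < delta0 ->
        let E := expR (- (decay_rate n lambda * hdist z 0)) in
        let I := hintegral (fun x =>
          radial_at u z x `^ p * vfield j (radial_at u 0) x) in
        (z 0 j < - kappa -> ((C^-1 * E)%:E <= I)%E /\ (I <= (C * E)%:E)%E) /\
        (kappa < z 0 j -> ((C^-1 * E)%:E <= - I)%E /\ (- I <= (C * E)%:E)%E)].
Proof.
have hlam : lambda < (n%:R - 1) ^+ 2 / 4 by case: hcase => [[]|[]].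
clear hcase hkappa1; case: n hn hlam => // k k3 hlam.
(* The discriminant in the decay rate is positive, so c exceeds (n - 1) / 2. *)
have hc : k.+1%:R - 1 < 2 * decay_rate k.+1 lambda.
  rewrite /decay_rate (_ : 2 * _ = k.+1%:R - 1 + Num.sqrt ((k.+1%:R - 1) ^+ 2 - 4 * lambda)); last by field.
  by rewrite ltrDl sqrtr_gt0; clear -hlam; lra.
have c0 : 0 < decay_rate k.+1 lambda.
  have : 1 <= k.+1%:R :> R by rewrite ler1n.
  by clear -hc; lra.
have [C1 C10 hC1] := ball_integral_ub k3 hp hc hchi1 hchi2.
have [delta0 [C2 [d00 C20 hC2]]] := ball_integral_lb k3 hp c0 hchi1 hchi2 hkappa0.
(* The sum dominates 1, [C1] and the inverse of [C2] simultaneously. *)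
pose C : R := 1 + C1 + C2^-1.
have C2V : 0 < C2^-1 by rewrite invr_gt0.
have C_ge1 : 1 <= C by rewrite /C; clear -C10 C2V; lra.
have C_ge0 : 0 < C by apply: lt_le_trans C_ge1.
have CC1 : C1 <= C by rewrite /C; clear -C2V; lra.
have CC2 : C^-1 <= C2.
  rewrite -[leRHS]invrK lef_pV2 ?posrE// /C; clear -C10; lra.
exists delta0, C; split => // u gs sd j z bz _ zd E I.
have E0 : 0 <= E by exact: expR_ge0.
pose J w := (\int[@lebesgue_tuple R k.+1]_t (ball_integrand p u j w t)%:E)%E.
have IJ : I = J z by exact: hintegralE.
have mJ w : hball w -> measurable_fun setT (EFin \o ball_integrand p u j w).
  by move=> bw; apply/measurable_EFinP; exact: (measurable_ball_integrand _ gs).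
have iJ w : hball w -> (@lebesgue_tuple R k.+1).-integrable setT (EFin \o ball_integrand p u j w).
  move=> bw; apply/integrableP; split; first exact: mJ.
  by apply: le_lt_trans (hC1 u gs sd j w bw) _; exact: ltry.
have brz : hball (coord_refl j z) by exact/hball_reflect.
have Jrefl : J (coord_refl j z) = (- J z)%E.
  by apply: (integral_ball_integrand_reflect gs) => //; exact: iJ.
have absJ : (`|J z| <= (C * E)%:E)%E.
  apply: (le_trans (le_abse_integral _ _ (mJ z bz))) => //.
  apply: (le_trans (hC1 u gs sd j z bz)).
  by rewrite lee_fin ler_wpM2r.
(* Stated for any point of the same norm, hence with the same [E]: it is applied to [z] when z_j < -
   kappa and to its reflection when z_j > kappa. *)
have lb w : hball w -> w 0 j <= - kappa -> enorm w = enorm z -> ((C^-1 * E)%:E <= J w)%E.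
  move=> bw wj wz.
  have Ew : expR (- (decay_rate k.+1 lambda * hdist w 0)) = E.
    by rewrite /E !expR_hdist0// wz.
  have := hC2 u gs sd j w bw wj; rewrite wz Ew => /(_ zd (iJ w bw) (iJ _ _)) h.
  apply: le_trans (h _); last exact/hball_reflect.
  by rewrite lee_fin ler_wpM2r.
rewrite IJ; split => zj.
  split; first by apply: lb => //; exact: ltW.
  by apply: le_trans absJ; exact: lee_abs.
split.
  rewrite -Jrefl; apply: lb => //; last exact: enorm_reflect.
  by rewrite mxE eqxx lerN2 ltW.
by apply: le_trans absJ; rewrite -abseN; exact: lee_abs.
Qed.
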